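(* Let $X$ be a proper $\mathrm{CAT}(-1)$ space with distance function $d$, let $o\in X$ be a base point, and let $\Gamma<\operatorname{Isom}(X)$ be a finitely generated, non-elementary discrete group. Suppose that for some $\alpha\in(0,1]$ the Poincaré series $$P_\Gamma(\alpha,o)=\sum_{\gamma\in\Gamma}e^{-\alpha d(o,\gamma o)}$$ is finite. Then the $\alpha$-dimensional Hausdorff measure of the limit set $\Lambda(\Gamma)$, with respect to the visual metric $\rho_o$, satisfies $$\mathcal H^\alpha\bigl(\Lambda(\Gamma)\bigr)=0.$$ In particular, $\Lambda(\Gamma)$ is homeomorphic to the Cantor set and its Hausdorff dimension (with respect to $\rho_o$) satisfies $\dim_{\mathcal H}(\Lambda(\Gamma))=\delta(\Gamma)$, where $\delta(\Gamma)$ is the critical exponent of $\Gamma$.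
   Context: $\partial_\infty X$ is the visual boundary of $X$ (asymptotic classes of geodesic rays), and $\overline X=X\cup\partial_\infty X$ carries the cone topology. The limit set $\Lambda(\Gamma)\subset\partial_\infty X$ is the set of accumulation points in $\partial_\infty X$ of the orbit $\Gamma o$; it does not depend on $o$. $\Gamma$ is non-elementary if $|\Lambda(\Gamma)|\ge 3$. The critical exponent is $\delta(\Gamma)=\inf\{s>0: P_\Gamma(s,o)<\infty\}$ with $P_\Gamma(s,o)=\sum_{\gamma\in\Gamma}e^{-s d(o,\gamma o)}$; it does not depend on $o$. For $x,y\in X$ the Gromov product is $(x,y)_o=\frac12(d(o,x)+d(o,y)-d(x,y))$. For $\xi,\eta\in\partial_\infty X$, with $c_\xi,c_\eta$ the unit-speed geodesic rays from $o$ to $\xi,\eta$, set $(\xi,\eta)_o=\lim_{t\to\infty}(c_\xi(t),c_\eta(t))_o$. The visual (Bourdon) metric on $\partial_\infty X$ is $\rho_o(\xi,\eta)=e^{-(\xi,\eta)_o}$ (with $\rho_o(\xi,\xi)=0$). For a subset $E$ of a metric space and $\alpha>0$, $\mathcal H^\alpha(E)=\lim_{\epsilon\to0}\mathcal H^\alpha_\epsilon(E)$, where $\mathcal H^\alpha_\epsilon(E)$ is the infimum of $\sum_j(\operatorname{diam}U_j)^\alpha$ over countable covers $\{U_j\}$ of $E$ by sets of diameter $\le\epsilon$. $\dim_{\mathcal H}(E)=\inf\{\alpha>0:\mathcal H^\alpha(E)=0\}$. *)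

(* Defs.v *)
From HB Require Import structures.
From mathcomp Require Import all_boot all_order all_algebra.
From mathcomp Require Import all_classical all_reals all_analysis.

Set Implicit Arguments.
Unset Strict Implicit.
Unset Printing Implicit Defensive.

Import Order.TTheory GRing.Theory Num.Theory.
Import numFieldNormedType.Exports.

Local Open Scope classical_set_scope.
Local Open Scope ring_scope.

(** The distance is a parameter because the same notion is used in [X] and in
    the comparison plane. *)

Definition geodesic_segment (R : realType) (T : Type) (d : T -> T -> R)
    (c : R -> T) (x y : T) : Prop :=
  [/\ c 0 = x, c (d x y) = y &
      forall s t, 0 <= s <= d x y -> 0 <= t <= d x y ->
        d (c s) (c t) = `|s - t|].

(** Hyperboloid model: cosh d(u, v) = - lorentz u v. *)

Definition lorentz (R : realType) (u v : R * R * R) : R :=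
  u.1.1 * v.1.1 + u.1.2 * v.1.2 - u.2 * v.2.

Definition hyperbolic_plane (R : realType) : Type :=
  {u : R * R * R | (lorentz u u == -1) && (0 < u.2)}.

Definition arcosh (R : realType) (x : R) : R := ln (x + Num.sqrt (x ^+ 2 - 1)).

Definition hyperbolic_dist (R : realType) (u v : hyperbolic_plane R) : R :=
  arcosh (- lorentz (val u) (val v)).

(** A geodesic triangle has vertices [v i] and sides [c i] from [v i] to
    [v (i + 1)], indices mod 3; [v'] and [c'] describe a comparison triangle, and
    [c' i s] is the comparison point of [c i s]. *)
Definition cat_minus_one (R : realType) (X : metricType R) : Prop :=
  (forall x y : X, exists c : R -> X, geodesic_segment mdist c x y) /\
  (forall (v : 'I_3 -> X) (c : 'I_3 -> R -> X)
          (v' : 'I_3 -> hyperbolic_plane R)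
          (c' : 'I_3 -> R -> hyperbolic_plane R),
    (forall i, geodesic_segment mdist (c i) (v i) (v (ordS i))) ->
    (forall i, geodesic_segment (@hyperbolic_dist R)
                 (c' i) (v' i) (v' (ordS i))) ->
    (forall i, hyperbolic_dist (v' i) (v' (ordS i)) =
               mdist (v i) (v (ordS i))) ->
    forall i j s t,
      0 <= s <= mdist (v i) (v (ordS i)) ->
      0 <= t <= mdist (v j) (v (ordS j)) ->
      mdist (c i s) (c j t) <= hyperbolic_dist (c' i s) (c' j t)).

Definition proper_space (R : realType) (X : metricType R) : Prop :=
  forall (x : X) (r : R), compact [set y : X | mdist x y <= r].

Definition isometry (R : realType) (X : metricType R) (g : X -> X) : Prop :=
  (forall x y, mdist (g x) (g y) = mdist x y) /\ (forall y, exists x, g x = y).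

Definition isometry_group (R : realType) (X : metricType R)
    (G : set (X -> X)) : Prop :=
  [/\ (forall g, G g -> isometry g),
      G id,
      (forall g h, G g -> G h -> G (g \o h)) &
      (forall g, G g -> exists2 h, G h & cancel g h /\ cancel h g)].

Definition finitely_generated (R : realType) (X : metricType R)
    (G : set (X -> X)) : Prop :=
  exists S : set (X -> X), [/\ finite_set S, S `<=` G &
    forall H, isometry_group H -> S `<=` H -> G `<=` H].

Definition discrete_group (R : realType) (X : metricType R)
    (G : set (X -> X)) : Prop :=
  G `<=` isolated (G : set {compact-open, X -> X}).

(** Only the values of a ray on the nonnegative reals matter; a boundary point
    contains every extension of its rays to negative arguments. *)

Definition geodesic_ray (R : realType) (X : metricType R) (c : R -> X) : Prop :=
  forall s t, 0 <= s -> 0 <= t -> mdist (c s) (c t) = `|s - t|.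

Definition asymptotic (R : realType) (X : metricType R) (c c' : R -> X) : Prop :=
  exists K : R, forall t, 0 <= t -> mdist (c t) (c' t) <= K.

Definition boundary (R : realType) (X : metricType R) : Type :=
  set_type [set xi : set (R -> X) | exists2 c, geodesic_ray c &
    xi = [set c' | geodesic_ray c' /\ asymptotic c c']].

HB.instance Definition _ (R : realType) (X : metricType R) :=
  Choice.on (boundary X).

(** In a proper CAT(-1) space the geodesics selected by [ray_to] and
    [segment_to] exist and are unique on their domains, so that the choice and
    its default value are irrelevant. *)

Definition ray_to (R : realType) (X : metricType R) (o : X)
    (xi : boundary X) : R -> X :=
  xget (fun=> o) [set c : R -> X | val xi c /\ c 0 = o].

Definition segment_to (R : realType) (X : metricType R) (o x : X) : R -> X :=
  xget (fun=> o) [set c : R -> X | geodesic_segment mdist c o x].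

(** Nearest-point projection of the bordification onto the closed ball of
    center [o] and radius [r]. *)
Definition ball_proj (R : realType) (X : metricType R) (o : X) (r : R)
    (z : X + boundary X) : X :=
  match z with
  | inl x => segment_to o x (Num.min r (mdist o x))
  | inr xi => ray_to o xi r
  end.

(** The cone topology: the coarsest topology making all projections onto closed
    balls centered at [o] continuous, i.e. the inverse limit of these balls. *)
Definition bordification (R : realType) (X : metricType R) (o : X) : Type :=
  initial_topology (fun z : X + boundary X =>
    (fun r => ball_proj o r%:num z) : prod_topology (fun _ : {nonneg R} => X)).

HB.instance Definition _ (R : realType) (X : metricType R) (o : X) :=
  Topological.on (bordification o).

Definition limit_set (R : realType) (X : metricType R) (o : X)
    (G : set (X -> X)) : set (boundary X) :=
  [set xi | limit_point [set (inl (g o) : bordification o) | g in G]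
              (inr xi : bordification o)].

Definition limit_space (R : realType) (X : metricType R) (o : X)
    (G : set (X -> X)) : topologicalType :=
  set_type [set (inr xi : bordification o) | xi in limit_set o G].

Definition non_elementary (R : realType) (X : metricType R) (o : X)
    (G : set (X -> X)) : Prop :=
  ([set: 'I_3] #<= limit_set o G)%card.

Definition poincare_series (R : realType) (X : metricType R) (o : X)
    (G : set (X -> X)) (s : R) : \bar R :=
  \esum_(g in G) (expR (- s * mdist o (g o)))%:E.

Definition critical_exponent (R : realType) (X : metricType R) (o : X)
    (G : set (X -> X)) : \bar R :=
  ereal_inf [set s%:E | s in [set s : R |
    0 < s /\ (poincare_series o G s < +oo)%E]].

Definition gromov_product (R : realType) (X : metricType R) (o x y : X) : R :=
  (mdist o x + mdist o y - mdist x y) / 2.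

Definition boundary_gromov_product (R : realType) (X : metricType R) (o : X)
    (xi eta : boundary X) : R :=
  lim (gromov_product o (ray_to o xi t) (ray_to o eta t) @[t --> +oo]).

Definition visual_dist (R : realType) (X : metricType R) (o : X)
    (xi eta : boundary X) : R :=
  if xi == eta then 0 else expR (- boundary_gromov_product o xi eta).

Section Hausdorff.
Context (R : realType) (T : Type) (d : T -> T -> R).

(** The value 0 is adjoined so that the empty set has diameter 0. *)
Definition diameter (U : set T) : \bar R :=
  ereal_sup (0%E |` [set (d x.1 x.2)%:E | x in U `*` U]).

(** Finite covers are sequences that are eventually empty. *)
Definition hausdorff_premeasure (alpha eps : R) (E : set T) : \bar R :=
  ereal_inf [set (\sum_(0 <= j <oo) poweR (diameter (U j)) alpha)%E |
    U in [set U : nat -> set T | E `<=` \bigcup_j U j /\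
                                 forall j, (diameter (U j) <= eps%:E)%E]].

Definition hausdorff_measure (alpha : R) (E : set T) : \bar R :=
  lim (hausdorff_premeasure alpha eps E @[eps --> 0^'+]).

Definition hausdorff_dim (E : set T) : \bar R :=
  ereal_inf [set alpha%:E | alpha in [set alpha : R |
    0 < alpha /\ hausdorff_measure alpha E = 0%E]].

End Hausdorff.

Definition homeomorphic (S T : topologicalType) : Prop :=
  exists f : S -> T, exists g : T -> S,
    [/\ cancel f g, cancel g f, continuous f & continuous g].

(* Main.v *)
Require Import Defs.
From HB Require Import structures.
From mathcomp Require Import all_boot all_order all_algebra.
From mathcomp Require Import all_classical all_reals all_analysis.
From mathcomp Require Import finmap zify ring lra.

Set Implicit Arguments.
Unset Strict Implicit.
Unset Printing Implicit Defensive.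

Import Order.TTheory GRing.Theory Num.Theory.
Import numFieldNormedType.Exports.

Local Open Scope classical_set_scope.
Local Open Scope ring_scope.

(** The orbit of [Gamma], with consecutive points of the Cayley graph joined by
    edges, is a picture of the group in which an edge at distance [r] from [o] is
    seen from [o] under an angle of order [exp (- r)]. Everything rests on one
    estimate for a CAT(-1) space, read off from a comparison triangle in the
    hyperboloid: geodesics from [o] to [x] and to [y] are at distance at most
    [exp (s - (x, y)_o)] at time [s] ([geodesics_contract]). Cutting along a
    suitable sphere, it gives the chain inequality
    [exp (- (x_0, x_n)_o) <= 3 * sum_i exp (- (x_i, x_(i+1))_o)], whose constant does
    not depend on [n] ([vis_chain]), and Gromov hyperbolicity ([four_point]).

    _The measure vanishes._ Remove a large finite ball from the Cayley graph.
    The rest has finitely many components touching the ball, and every limit point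
    is a limit of one of them. By the chain inequality the limit points of a
    component [A] lie in a set of diameter at most a constant times
    [sum_(g in A) exp (- d (o, g o))]. As [alpha <= 1], the power [alpha] of this sum
    is at most the sum of the powers, so the total cost of the cover is bounded by
    a tail of the Poincare series ([limit_set_premeasure]).

    _The Cantor set._ The limit space is compact and metrizable. It has no
    isolated point because it has at least three points and elements of the group
    push two of them close to a given limit point ([limit_set_perfect]). It is zero
    dimensional because its one-dimensional measure vanishes: the distance to a
    fixed ray at a fixed time is a Lipschitz function, whose values on the limit
    set form a null set of real numbers, and the values that are avoided cut the
    limit set into clopen pieces ([avoided_distance]).

    _The dimension._ The same cover shows that the dimension is at most the
    critical exponent. For the lower bound suppose that the series diverges at
    [t], and let [s < t]. A compactness argument and pigeonhole on annuli produce
    many elements of nearly the same length [m], at least [exp (s * m)] of them,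
    which all leave [o] in nearly the same direction and come back from nearly the
    same direction ([divergent_semigroup]). If the two directions agree they are
    separated by composing with an element that does not fix the limiting
    direction; there is one because a discrete group with three limit points
    fixes no boundary point ([no_fixed_end]). The elements then generate a free
    semigroup whose words are uniform quasigeodesics. Its boundary is a tree of
    limit points in which a set of diameter [r] meets only one branch of level
    about [- ln r / m], so a cover of small [s]-dimensional cost misses a branch
    ([semigroup_premeasure], [greedy_branch]). *)

(** * Hyperbolic functions and segments of the hyperboloid *)

Definition cosh (R : realType) (x : R) : R := (expR x + expR (- x)) / 2.
Definition sinh (R : realType) (x : R) : R := (expR x - expR (- x)) / 2.

Section HyperbolicFunctions.
Context {R : realType}.
Implicit Types x y u a g : R.

Lemma cosh2_sinh2 x : cosh x ^+ 2 - sinh x ^+ 2 = 1.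
Proof.
have h := expRxMexpNx_1 x; rewrite /cosh /sinh.
by transitivity (expR x * expR (- x)) => //; field.
Qed.

Lemma coshD_sinh x : cosh x + sinh x = expR x.
Proof. by rewrite /cosh /sinh; field. Qed.

Lemma cosh0 : cosh (0 : R) = 1.
Proof. by rewrite /cosh oppr0 expR0; lra. Qed.

Lemma sinh0 : sinh (0 : R) = 0.
Proof. by rewrite /sinh oppr0 expR0; lra. Qed.

Lemma coshN x : cosh (- x) = cosh x.
Proof. by rewrite /cosh opprK addrC. Qed.

Lemma cosh_abs x : cosh `|x| = cosh x.
Proof. by case: (ger0P x) => // _; rewrite coshN. Qed.

Lemma sinh_ge0 x : 0 <= x -> 0 <= sinh x.
Proof.
move=> x0; rewrite /sinh divr_ge0 // subr_ge0 ler_expR; lra.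
Qed.

Lemma sinh_gt0 x : 0 < x -> 0 < sinh x.
Proof.
move=> x0; rewrite /sinh divr_gt0 // subr_gt0 ltr_expR; lra.
Qed.

Lemma expR_ge_quad x : 0 <= x -> 1 + x + x ^+ 2 / 2 <= expR x.
Proof.
move=> x0; rewrite /expR.
have -> : 1 + x + x ^+ 2 / 2 = series (exp_coeff x) 3.
  by rewrite /series /= !big_nat_recr //= big_geq // /exp_coeff /= add0r
    !factS fact0 expr0 expr1 !divr1.
apply: nondecreasing_cvgn_le (is_cvg_series_exp_coeff x) 3%N.
by apply: nondecreasing_series => n _ _; rewrite /exp_coeff /= divr_ge0 // exprn_ge0.
Qed.

Lemma sinh_ge x : 0 <= x -> x <= sinh x.
Proof.
move=> x0; have h := expR_ge_quad x0.
rewrite /sinh expRN.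
have E0 := expR_gt0 x.
have : (expR x)^-1 <= (1 + x + x ^+ 2 / 2)^-1.
  by rewrite lef_pV2 // posrE; nra.
have : (1 + x + x ^+ 2 / 2)^-1 <= 1 - x + x ^+ 2 / 2.
  rewrite -[leLHS]mul1r ler_pdivrMr; last by nra.
  have : 0 <= x ^+ 4 by rewrite exprn_ge0.
  nra.
lra.
Qed.

Lemma cosh_double u : cosh u = 1 + 2 * sinh (u / 2) ^+ 2.
Proof.
rewrite /cosh /sinh.
have -> : expR u = expR (u / 2) ^+ 2 by rewrite -expRM_natl; congr expR; field.
have -> : expR (- u) = expR (- (u / 2)) ^+ 2.
  by rewrite -expRM_natl; congr expR; field.
have h := expRxMexpNx_1 (u / 2).
transitivity (expR (u / 2) * expR (- (u / 2)) +
  2 * ((expR (u / 2) - expR (- (u / 2))) / 2) ^+ 2); first by field.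
by rewrite h.
Qed.

Lemma cosh_ge1 u : 1 <= cosh u.
Proof. by rewrite cosh_double; have := sqr_ge0 (sinh (u / 2)); lra. Qed.

(** Comparing with this parabola turns the hyperbolic law of cosines into the
    bound of [geodesics_contract], without loss of a constant. *)
Lemma cosh_ge_quad u : 0 <= u -> 1 + u ^+ 2 / 2 <= cosh u.
Proof.
move=> u0; rewrite cosh_double; have : u / 2 <= sinh (u / 2) by apply: sinh_ge; lra.
move: (sinh _) => S; nra.
Qed.

Lemma arcosh_cosh u : 0 <= u -> arcosh (cosh u) = u.
Proof.
move=> u0; rewrite /arcosh.
have -> : cosh u ^+ 2 - 1 = sinh u ^+ 2 by rewrite -(cosh2_sinh2 u); ring.
by rewrite sqrtr_sqr ger0_norm ?sinh_ge0 // coshD_sinh expRK.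
Qed.

Lemma ler_arcosh x y : 1 <= x -> x <= y -> arcosh x <= arcosh y.
Proof.
move=> x1 xy; rewrite /arcosh ler_ln ?posrE; first last.
- by rewrite ltr_wpDr ?sqrtr_ge0 //; lra.
- by rewrite ltr_wpDr ?sqrtr_ge0 //; lra.
rewrite lerD // ler_sqrt; nra.
Qed.

Lemma ler_cosh x y : 0 <= x -> x <= y -> cosh x <= cosh y.
Proof.
move=> x0 xy; rewrite !cosh_double.
have : 0 <= sinh (x / 2) by apply: sinh_ge0; lra.
suff : sinh (x / 2) <= sinh (y / 2) by nra.

rewrite /sinh ler_pM2r // lerB // ler_expR; lra.
Qed.

(** The source of the exponential decay: the half-angle formula for the angle
    at [o] has two quotients [sinh (a - g) / sinh a]. *)
Lemma sinh_sub_le a g : 0 <= g -> sinh (a - g) <= expR (- g) * sinh a.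
Proof.
move=> g0; rewrite /sinh mulrA ler_pM2r // mulrBr -!expRD.
have -> : - g + a = a - g by ring.
by rewrite lerB // ler_expR; lra.
Qed.

Lemma coshB x y : cosh (x - y) = cosh x * cosh y - sinh x * sinh y.
Proof.
rewrite /cosh /sinh (_ : - (x - y) = - x + y) ?expRD; last by ring.
by field.
Qed.

Lemma coshD x y : cosh (x + y) = cosh x * cosh y + sinh x * sinh y.
Proof.
by rewrite /cosh /sinh opprD !expRD; field.
Qed.

Lemma cosh_sub_prod x y :
  cosh x - cosh y = 2 * (sinh ((x + y) / 2) * sinh ((x - y) / 2)).
Proof.
have -> : cosh x = cosh ((x + y) / 2 + (x - y) / 2) by congr cosh; field.
have -> : cosh y = cosh ((x + y) / 2 - (x - y) / 2) by congr cosh; field.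
by rewrite coshB coshD; ring.
Qed.

End HyperbolicFunctions.

Section HyperbolicSegments.
Context {R : realType}.
Implicit Types (u v : R * R * R) (l s t : R).

(** The spherical-type interpolation of [u] and [v] in the ambient linear space,
    which traces the geodesic with unit speed when [l] is the distance. *)
Definition hseg_vec u v l t : R * R * R :=
  let a := sinh (l - t) / sinh l in
  let b := sinh t / sinh l in
  (a * u.1.1 + b * v.1.1, a * u.1.2 + b * v.1.2, a * u.2 + b * v.2).

Lemma lorentz_comb u v a b a' b' :
  lorentz (a * u.1.1 + b * v.1.1, a * u.1.2 + b * v.1.2, a * u.2 + b * v.2)
    (a' * u.1.1 + b' * v.1.1, a' * u.1.2 + b' * v.1.2, a' * u.2 + b' * v.2) =
  a * a' * lorentz u u + b * b' * lorentz v v +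
  (a * b' + b * a') * lorentz u v.
Proof. rewrite /lorentz /=; ring. Qed.

Lemma lorentz_hseg_vec u v l s t : 0 < l ->
  lorentz u u = -1 -> lorentz v v = -1 -> lorentz u v = - cosh l ->
  lorentz (hseg_vec u v l s) (hseg_vec u v l t) = - cosh (s - t).
Proof.
move=> l0 uu vv uv; rewrite /hseg_vec lorentz_comb uu vv uv.
have := l0; rewrite -expR_gt1 => L1.
have E : expR (l - s) = expR l * expR (- s) by rewrite expRD.
have E' : expR (l - t) = expR l * expR (- t) by rewrite expRD.
have F : expR (- (l - s)) = expR (- l) * expR s by rewrite opprB expRD mulrC.
have F' : expR (- (l - t)) = expR (- l) * expR t by rewrite opprB expRD mulrC.
have G : expR (s - t) = expR s * expR (- t) by rewrite expRD.
have G' : expR (- (s - t)) = expR (- s) * expR t by rewrite opprB expRD mulrC.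
rewrite /cosh /sinh E E' F F' G G' !expRN.
have := expR_gt0 s; have := expR_gt0 t; move: L1.
move: (expR l) (expR s) (expR t) => L S T L1 T0 S0.
have LL : L * L - 1 != 0 by rewrite gt_eqF //; nra.
have L0 : L != 0 by rewrite gt_eqF //; lra.
by field; rewrite L0 LL !gt_eqF.
Qed.

(** Outside [0, l] the vector may leave the upper sheet; the default value [u]
    also makes the segment of length zero constant. *)
Definition hseg (u v : hyperbolic_plane R) l t : hyperbolic_plane R :=
  insubd u (hseg_vec (val u) (val v) l t).

Lemma hyperbolicP (u : hyperbolic_plane R) :
  lorentz (val u) (val u) = -1 /\ 0 < (val u).2.
Proof. by case: u => u /= /andP[/eqP]. Qed.

Lemma val_hseg (u v : hyperbolic_plane R) l t : 0 < l -> 0 <= t <= l ->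
  lorentz (val u) (val v) = - cosh l ->
  val (hseg u v l t) = hseg_vec (val u) (val v) l t.
Proof.
move=> l0 /andP[t0 tl] uv; rewrite /hseg val_insubd.
have [uu u0] := hyperbolicP u; have [vv v0] := hyperbolicP v.
rewrite lorentz_hseg_vec // subrr cosh0 eqxx /=.
have sl := sinh_gt0 l0.
case: ifP => // /negbT /negP []; rewrite /hseg_vec /=.
have [->|tn] := eqVneq t 0.
  by rewrite subr0 sinh0 mul0r mul0r addr0 divff ?mul1r ?gt_eqF.
have a0 : 0 <= sinh (l - t) / sinh l.
  by rewrite divr_ge0 ?sinh_ge0 ?subr_ge0 // ltW.
have b0 : 0 < sinh t / sinh l.
  by rewrite divr_gt0 ?sinh_gt0 // lt_neqAle eq_sym tn.
by apply: ltr_wpDl; [exact: mulr_ge0 a0 (ltW u0) | exact: mulr_gt0].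
Qed.

Lemma hyperbolic_dist_cosh (u v : hyperbolic_plane R) l :
  0 <= l -> lorentz (val u) (val v) = - cosh l -> hyperbolic_dist u v = l.
Proof. by move=> l0 uv; rewrite /hyperbolic_dist uv opprK arcosh_cosh. Qed.

Lemma hseg_vec0 u v l : 0 < l -> hseg_vec u v l 0 = u.
Proof.
move=> l0; rewrite /hseg_vec subr0 sinh0 mul0r divff ?gt_eqF ?sinh_gt0 //.
by rewrite !mul0r !mul1r !addr0; case: u => [[]].
Qed.

Lemma hseg_vec1 u v l : 0 < l -> hseg_vec u v l l = v.
Proof.
move=> l0; rewrite /hseg_vec subrr sinh0 mul0r divff ?gt_eqF ?sinh_gt0 //.
by rewrite !mul0r !mul1r !add0r; case: v => [[]].
Qed.

Lemma hyperbolic_distxx (u : hyperbolic_plane R) : hyperbolic_dist u u = 0.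
Proof. by apply: hyperbolic_dist_cosh; rewrite // cosh0 (hyperbolicP u).1. Qed.

Lemma hseg_degenerate (u v : hyperbolic_plane R) t : hseg u v 0 t = u.
Proof.
apply: val_inj; rewrite val_insubd ifF // /hseg_vec sinh0 invr0 !mulr0 !mul0r.
by rewrite /= !addr0 ltxx andbF.
Qed.

Lemma hseg_geodesic (u v : hyperbolic_plane R) l : 0 <= l ->
  (l = 0 -> u = v) -> lorentz (val u) (val v) = - cosh l ->
  geodesic_segment (@hyperbolic_dist R) (hseg u v l) u v.
Proof.
rewrite le_eqVlt => /orP[/eqP <- /(_ erefl) <- _|l0 _ uv].
  split; rewrite ?hseg_degenerate // hyperbolic_distxx => s t.
  rewrite -!eq_le => /eqP <- /eqP <-.
  by rewrite subrr normr0 hyperbolic_distxx.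
have d := hyperbolic_dist_cosh (ltW l0) uv.
have [uu u0] := hyperbolicP u; have [vv v0] := hyperbolicP v.
split.
- by apply: val_inj; rewrite val_hseg ?lexx ?ltW // hseg_vec0.
- by rewrite d; apply: val_inj; rewrite val_hseg ?lexx ?ltW // hseg_vec1.
- rewrite d => s t sl tl; apply: hyperbolic_dist_cosh => //.
  by rewrite !val_hseg // lorentz_hseg_vec // cosh_abs.
Qed.

End HyperbolicSegments.

(** * The comparison triangle *)

Section ComparisonTriangle.
Context {R : realType}.
Variables (a b l : R).
Hypotheses (a0 : 0 < a) (b0 : 0 < b) (l0 : 0 <= l).
Hypotheses (abl : `|a - b| <= l) (lab : l <= a + b).

(* the cosine and the sine of the angle at the vertex between [a] and [b] *)
Let p := (cosh a * cosh b - cosh l) / (sinh a * sinh b).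
Let q := Num.sqrt (1 - p ^+ 2).

Let sa := sinh_gt0 a0.
Let sb := sinh_gt0 b0.
Let sab : 0 < sinh a * sinh b. Proof. exact: mulr_gt0. Qed.

Let p_bounds : -1 <= p <= 1.
Proof.
have h1 : cosh (a - b) <= cosh l by rewrite -cosh_abs ler_cosh.
have h2 : cosh l <= cosh (a + b) by rewrite ler_cosh.
rewrite coshB in h1; rewrite coshD in h2.
by rewrite /p ler_pdivlMr // ler_pdivrMr //; apply/andP; split; lra.
Qed.

Let q2 : q ^+ 2 = 1 - p ^+ 2.
Proof. by rewrite sqr_sqrtr //; case/andP: p_bounds; nra. Qed.

Lemma origin_subproof :
  (lorentz (0, 0, 1) (0, 0, 1) == -1 :> R) && (0 < (1 : R)).
Proof. by rewrite /lorentz /= ltr01 andbT; apply/eqP; ring. Qed.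

Definition hyperbolic_point (u : R * R * R)
  (hu : (lorentz u u == -1) && (0 < u.2)) : hyperbolic_plane R :=
  @exist (R * R * R) (fun u => is_true ((lorentz u u == -1) && (0 < u.2))) u hu.

Definition tri_o : hyperbolic_plane R := hyperbolic_point origin_subproof.

Lemma tri_x_subproof (v := (sinh a, 0, cosh a)) :
  (lorentz v v == -1 :> R) && (0 < v.2).
Proof.
rewrite /lorentz /= (lt_le_trans ltr01 (cosh_ge1 a)) andbT.
by apply/eqP; have := cosh2_sinh2 a; lra.
Qed.

Definition tri_x : hyperbolic_plane R := hyperbolic_point tri_x_subproof.

Lemma tri_y_subproof (v := (p * sinh b, q * sinh b, cosh b)) :
  (lorentz v v == -1 :> R) && (0 < v.2).
Proof.
rewrite /lorentz /= (lt_le_trans ltr01 (cosh_ge1 b)) andbT.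
apply/eqP; have := cosh2_sinh2 b.
rewrite (_ : p * sinh b * (p * sinh b) + q * sinh b * (q * sinh b) =
  sinh b ^+ 2 * (p ^+ 2 + q ^+ 2)); last by ring.
by rewrite q2; lra.
Qed.

Definition tri_y : hyperbolic_plane R := hyperbolic_point tri_y_subproof.

Lemma lorentz_tri_ox : lorentz (val tri_o) (val tri_x) = - cosh a.
Proof. by rewrite /lorentz /=; ring. Qed.

Lemma lorentz_tri_oy : lorentz (val tri_o) (val tri_y) = - cosh b.
Proof. by rewrite /lorentz /=; ring. Qed.

Lemma lorentz_tri_xy : lorentz (val tri_x) (val tri_y) = - cosh l.
Proof.
by rewrite /lorentz /= /p; field; rewrite !gt_eqF.
Qed.

Lemma tri_xy_eq : l = 0 -> tri_x = tri_y.
Proof.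
move=> le0; have ab : a = b.
  by move: abl; rewrite le0 normr_le0 subr_eq0 => /eqP.
have p1 : p = 1.
  rewrite /p le0 cosh0 ab -[X in _ - X](cosh2_sinh2 b).
  by field; rewrite gt_eqF.
by apply: val_inj; rewrite /= /q p1 expr1n subrr sqrtr0 ab mul1r mul0r.
Qed.

(** With [p] the cosine of the angle at the apex and [g] the Gromov product of
    the other two vertices, the law of cosines at height [s] reads
    [cosh d = 1 + (1 - p) * sinh s ^ 2], and the half-angle formula gives
    [1 - p <= 2 * exp (- 2 * g)]. *)
Lemma tri_dist_le s : 0 <= s -> s <= a -> s <= b ->
  hyperbolic_dist (hseg tri_o tri_x a s) (hseg tri_o tri_y b s) <=
  expR (s - (a + b - l) / 2).
Proof.
move=> s0 sa' sb'; rewrite /hyperbolic_dist.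
rewrite !val_hseg ?s0 //; first last.
- exact: lorentz_tri_ox.
- exact: lorentz_tri_oy.
set g := (a + b - l) / 2.
have -> : - lorentz (hseg_vec (val tri_o) (val tri_x) a s)
  (hseg_vec (val tri_o) (val tri_y) b s) = 1 + (1 - p) * sinh s ^+ 2.
  rewrite /lorentz /hseg_vec /=.
  have ha : sinh (a - s) / sinh a + sinh s / sinh a * cosh a = cosh s.
    rewrite (_ : sinh (a - s) = sinh a * cosh s - cosh a * sinh s).
      by field; rewrite gt_eqF.
    by rewrite /sinh /cosh (_ : - (a - s) = - a + s) ?expRD; [field|ring].
  have hb : sinh (b - s) / sinh b + sinh s / sinh b * cosh b = cosh s.
    rewrite (_ : sinh (b - s) = sinh b * cosh s - cosh b * sinh s).
      by field; rewrite gt_eqF.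
    by rewrite /sinh /cosh (_ : - (b - s) = - b + s) ?expRD; [field|ring].
  rewrite !mulr0 !mulr1 !add0r ha hb.
  have := cosh2_sinh2 s => h.
  transitivity (cosh s ^+ 2 - p * sinh s ^+ 2); last by lra.
  by field; rewrite !gt_eqF.
have g0 : 0 <= g by rewrite /g divr_ge0 // subr_ge0.
have p1 : 0 <= 1 - p <= 2 * expR (- g) ^+ 2.
  have -> : 1 - p = 2 * (sinh (a - g) * sinh (b - g)) / (sinh a * sinh b).
    rewrite (_ : sinh (a - g) * sinh (b - g) =
      (cosh l - cosh (a - b)) / 2); last first.
      rewrite cosh_sub_prod (_ : (l + (a - b)) / 2 = a - g); last first.
        by rewrite /g; field.
      rewrite (_ : (l - (a - b)) / 2 = b - g); last by rewrite /g; field.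
      by field.
    by rewrite coshB /p; field; rewrite !gt_eqF.
  have ag : 0 <= a - g.
    by rewrite /g; move: abl; rewrite ler_norml => /andP[]; lra.
  have bg : 0 <= b - g.
    by rewrite /g; move: abl; rewrite ler_norml => /andP[]; lra.
  have := sinh_sub_le a g0; have := sinh_sub_le b g0.
  have := sinh_ge0 ag; have := sinh_ge0 bg => h1 h2 h3 h4.
  apply/andP; split; first exact: divr_ge0 (mulr_ge0 (ler0n _ 2) (mulr_ge0 h2 h1)) (ltW sab).
  by rewrite ler_pdivrMr //; have := ler_pM h2 h1 h4 h3; lra.
have u0 := expR_ge0 (s - g).
rewrite -[leRHS](arcosh_cosh u0) ler_arcosh //.
  by rewrite lerDl mulr_ge0 ?sqr_ge0 //; case/andP: p1.
apply: le_trans (cosh_ge_quad u0).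
rewrite lerD2l expRD.
have : 2 * sinh s <= expR s by rewrite /sinh; have := expR_ge0 (- s); lra.
have := sinh_ge0 s0; have := expR_gt0 (- g); case/andP: p1.
move: (expR (- g)) (sinh s) (expR s) => G S E p0 p1 G0 S0 SE.
apply: (@le_trans _ _ (2 * G ^+ 2 * S ^+ 2)); first by rewrite ler_wpM2r ?sqr_ge0.
have : (2 * S) ^+ 2 <= E ^+ 2 by rewrite ler_sqr ?nnegrE; lra.
have : 0 <= G ^+ 2 by rewrite sqr_ge0.
rewrite !exprMn; move: (G ^+ 2) (S ^+ 2) (E ^+ 2) => G2 S2 E2.
nra.
Qed.

End ComparisonTriangle.

Section Comparison.
Context {R : realType} {X : metricType R}.
Hypothesis hcat : cat_minus_one X.

Let pick3 (T : Type) (x y z : T) (i : 'I_3) : T :=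
  match val i with 0%N => x | 1%N => y | _ => z end.

Let split3 (P : 'I_3 -> Prop) :
  P (@Ordinal 3 0 isT) -> P (@Ordinal 3 1 isT) -> P (@Ordinal 3 2 isT) ->
  forall i, P i.
Proof.
move=> P0 P1 P2 [[|[|[|//]]] i3].
- by rewrite (_ : Ordinal i3 = Ordinal (isT : (0 < 3)%N)) //; apply: val_inj.
- by rewrite (_ : Ordinal i3 = Ordinal (isT : (1 < 3)%N)) //; apply: val_inj.
- by rewrite (_ : Ordinal i3 = Ordinal (isT : (2 < 3)%N)) //; apply: val_inj.
Qed.

Lemma geodesic_segment_rev (T : Type) (d : T -> T -> R) c x y :
  (forall u v, d u v = d v u) -> 0 <= d x y ->
  geodesic_segment d c x y -> geodesic_segment d (fun t => c (d x y - t)) y x.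
Proof.
move=> dC d0 [c0 c1 cd]; split; rewrite ?subr0 //.
  by rewrite [d y x]dC subrr.
move=> s t; rewrite [d y x]dC => /andP[s0 s1] /andP[t0 t1].
rewrite cd ?subr_ge0 ?s1 ?t1 ?gerBl ?s0 ?t0 //.
by rewrite distrC; congr `|_|; ring.
Qed.

Lemma hyperbolic_distC (u v : hyperbolic_plane R) :
  hyperbolic_dist u v = hyperbolic_dist v u.
Proof. by rewrite /hyperbolic_dist /lorentz; congr arcosh; ring. Qed.

(** The only consequence of the comparison inequality that is used below. *)
Lemma geodesics_contract (o x y : X) c c' s :
  geodesic_segment mdist c o x -> geodesic_segment mdist c' o y ->
  0 <= s -> s <= mdist o x -> s <= mdist o y ->
  mdist (c s) (c' s) <= expR (s - gromov_product o x y).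
Proof.
move=> cg cg' s0 sx sy.
have [se|sn] := eqVneq s 0.
  by rewrite se; case: cg cg' => -> _ _ [-> _ _]; rewrite mdistxx expR_ge0.
have sp : 0 < s by rewrite lt_neqAle eq_sym sn.
have a0 := lt_le_trans sp sx; have b0 := lt_le_trans sp sy.
set a := mdist o x in sx a0 *; set b := mdist o y in sy b0 *.
pose l := mdist x y.
have l0 : 0 <= l := mdist_ge0 _ _.
have abl : `|a - b| <= l.
  have := metric_triangle o x y; have := metric_triangle o y x.
  by rewrite ler_norml [mdist y x]metric_sym /a /b /l; lra.
have lab : l <= a + b.
  by have := metric_triangle x o y; rewrite [mdist x o]metric_sym.
have [e eg] := hcat.1 x y.
pose O : hyperbolic_plane R := tri_o; pose X' := tri_x a; pose Y' := tri_y a0 b0 l0 abl lab.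
have gx : geodesic_segment (@hyperbolic_dist R) (hseg O X' a) O X'.
  apply: hseg_geodesic; rewrite ?ltW //; last exact: lorentz_tri_ox.
  by move=> h; have := a0; rewrite h ltxx.
have gy : geodesic_segment (@hyperbolic_dist R) (hseg O Y' b) O Y'.
  apply: hseg_geodesic; rewrite ?ltW //; last exact: lorentz_tri_oy.
  by move=> h; have := b0; rewrite h ltxx.
have gl : geodesic_segment (@hyperbolic_dist R) (hseg X' Y' l) X' Y'.
  apply: hseg_geodesic => //; last exact: lorentz_tri_xy.
  exact: tri_xy_eq.
have dx : hyperbolic_dist O X' = a.
  by apply: hyperbolic_dist_cosh; [exact: ltW|exact: lorentz_tri_ox].
have dy : hyperbolic_dist O Y' = b.
  by apply: hyperbolic_dist_cosh; [exact: ltW|exact: lorentz_tri_oy].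
have dl : hyperbolic_dist X' Y' = l.
  by apply: hyperbolic_dist_cosh => //; exact: lorentz_tri_xy.
have cE : forall t, c' (b - (b - t)) = c' t by move=> t; congr c'; ring.
apply: le_trans (tri_dist_le a0 b0 l0 abl lab s0 sx sy).
pose i0 : 'I_3 := @Ordinal 3 0 isT; pose i2 : 'I_3 := @Ordinal 3 2 isT.
suff : mdist (pick3 c e (fun t => c' (b - t)) i0 s)
    (pick3 c e (fun t => c' (b - t)) i2 (b - s)) <=
  hyperbolic_dist
    (pick3 (hseg O X' a) (hseg X' Y' l) (fun t => hseg O Y' b (b - t)) i0 s)
    (pick3 (hseg O X' a) (hseg X' Y' l) (fun t => hseg O Y' b (b - t)) i2 (b - s)).
  by rewrite /pick3 /= cE subKr.
apply: (@proj2 _ _ hcat (pick3 o x y) _ (pick3 O X' Y') _).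
- apply: split3 => //=; rewrite /pick3 /=.
  by apply: geodesic_segment_rev cg'; [exact: metric_sym|exact: mdist_ge0].
- apply: split3 => //=; rewrite /pick3 /=.
  by have := geodesic_segment_rev hyperbolic_distC _ gy; rewrite dy; apply; exact: ltW.
- apply: split3 => //=; rewrite /pick3 /=.
  by rewrite hyperbolic_distC dy metric_sym.
- by rewrite /= s0.
- by rewrite /= [mdist y o]metric_sym subr_ge0 sy gerBl.
Qed.

End Comparison.

(** * Gromov products and the chain inequality *)

Section GromovProduct.
Context {R : realType} {X : metricType R}.
Implicit Types (o x y z w : X) (s t : R) (c : R -> X).
Local Notation d := (@mdist R X).
Local Notation gp := (@gromov_product R X).

Lemma gpC o x y : gp o x y = gp o y x.
Proof. by rewrite /gromov_product [d y x]metric_sym [d o x + _]addrC. Qed.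

Lemma gp_ge0 o x y : 0 <= gp o x y.
Proof.
rewrite /gromov_product divr_ge0 // subr_ge0.
by have := metric_triangle x o y; rewrite [d x o]metric_sym.
Qed.

Lemma gp_le_l o x y : gp o x y <= d o x.
Proof.
rewrite /gromov_product ler_pdivrMr //.
by have := metric_triangle o x y; lra.
Qed.

Lemma gp_le_r o x y : gp o x y <= d o y.
Proof. by rewrite gpC gp_le_l. Qed.

Lemma gpxx o x : gp o x x = d o x.
Proof. by rewrite /gromov_product mdistxx; lra. Qed.

Lemma gp_ge o x y : d o x - d x y <= gp o x y.
Proof.
rewrite /gromov_product ler_pdivlMr //.
by have := metric_triangle o y x; rewrite [d y x]metric_sym; lra.
Qed.

Lemma gp_lip_r o x y z : gp o x y <= gp o x z + d y z.
Proof.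
rewrite /gromov_product; have := metric_triangle o z y; have := metric_triangle x y z.
by rewrite [d z y]metric_sym; lra.
Qed.

Lemma gp_lip_l o x y z : gp o x y <= gp o z y + d x z.
Proof. by rewrite ![gp o _ y]gpC gp_lip_r. Qed.

Lemma gp_lip_base o w x y : gp o x y <= gp w x y + d o w.
Proof.
rewrite /gromov_product; have := metric_triangle o w x; have := metric_triangle o w y.
lra.
Qed.

Lemma gp_extend o x y z : d o y + d y z = d o z -> gp o x y <= gp o x z.
Proof.
move=> h; rewrite /gromov_product; have := metric_triangle x y z; lra.
Qed.

Lemma gp_isometry (g : X -> X) o x y : Defs.isometry g ->
  gp (g o) (g x) (g y) = gp o x y.
Proof. by move=> [gd _]; rewrite /gromov_product !gd. Qed.

Lemma gp_flip o x y : gp o x y = d o x - gp x o y.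
Proof. by rewrite /gromov_product [d x o]metric_sym; field. Qed.

(** A lower bound for the product from points on the two geodesics that are
    close to each other: the detour through [a] and [b] is short. *)
Lemma gp_fellow o x y a b :
  d o a + d a x = d o x -> d o b + d b y = d o y -> 
  (d o a + d o b - d a b) / 2 <= gp o x y.
Proof.
move=> ha hb; rewrite /gromov_product.
have := metric_triangle x a y; have := metric_triangle a b y.
by rewrite [d x a]metric_sym; lra.
Qed.

Lemma segment_dist c x y s : geodesic_segment d c x y -> 0 <= s -> s <= d x y ->
  d x (c s) = s /\ d (c s) y = d x y - s.
Proof.
move=> [c0 c1 cd] s0 s1; split.
  rewrite -{1}c0 cd ?lexx ?mdist_ge0 ?s0 // sub0r normrN ger0_norm //.
by rewrite -{1}c1 cd ?lexx ?mdist_ge0 ?s0 // distrC ger0_norm // subr_ge0.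
Qed.

Lemma ray_segment c t : geodesic_ray c -> 0 <= t ->
  geodesic_segment d c (c 0) (c t).
Proof.
move=> rc t0; have dt : d (c 0) (c t) = t.
  by rewrite rc // sub0r normrN ger0_norm.
split=> //; first by rewrite dt.
by rewrite dt => u v /andP[u0 _] /andP[v0 _]; apply: rc.
Qed.

Lemma ray_dist0 c t : geodesic_ray c -> 0 <= t -> d (c 0) (c t) = t.
Proof. by move=> rc t0; rewrite rc // sub0r normrN ger0_norm. Qed.

Lemma ray_dist c s t : geodesic_ray c -> 0 <= s -> s <= t -> d (c s) (c t) = t - s.
Proof.
move=> rc s0 st; have t0 := le_trans s0 st.
by rewrite (rc _ _ s0 t0) distrC ger0_norm // subr_ge0.
Qed.

Lemma ray_gp_mono c x s t : geodesic_ray c -> 0 <= s -> s <= t ->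
  gp (c 0) x (c s) <= gp (c 0) x (c t).
Proof.
move=> rc s0 st; apply: gp_extend.
by rewrite !ray_dist0 ?ray_dist //; [lra|exact: le_trans st].
Qed.

End GromovProduct.

Section Hyperbolicity.
Context {R : realType} {X : metricType R}.
Hypothesis hcat : cat_minus_one X.
Implicit Types (o x y z w : X) (s t : R) (c : R -> X).
Local Notation d := (@mdist R X).
Local Notation gp := (@gromov_product R X).

Lemma segment_toP o x : geodesic_segment d (segment_to o x) o x.
Proof.
have [c hc] := hcat.1 o x.
exact: (@xgetI _ _ [set c | geodesic_segment d c o x] c hc).
Qed.

Lemma segments_contract o x y s : 0 <= s -> s <= d o x -> s <= d o y ->
  d (segment_to o x s) (segment_to o y s) <= expR (s - gp o x y).
Proof. by apply: geodesics_contract => //; exact: segment_toP. Qed.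

Lemma segments_fellow o x y s : 0 <= s -> s <= d o x -> s <= d o y ->
  s - d (segment_to o x s) (segment_to o y s) / 2 <= gp o x y.
Proof.
move=> s0 sx sy.
have [ax bx] := segment_dist (segment_toP o x) s0 sx.
have [ay by_] := segment_dist (segment_toP o y) s0 sy.
have := @gp_fellow _ _ o x y (segment_to o x s) (segment_to o y s).
rewrite ax bx ay by_ => /(_ ltac:(lra) ltac:(lra)); lra.
Qed.

(** Gromov hyperbolicity: cut the three geodesics at the height [min] of the two
    products on the left; consecutive points there are at distance at most 1. *)
Lemma four_point o x y z : Num.min (gp o x y) (gp o y z) - 1 <= gp o x z.
Proof.
set m := Num.min _ _.
have m0 : 0 <= m by rewrite le_min !gp_ge0.
have [mxy myz] : m <= gp o x y /\ m <= gp o y z by rewrite !ge_min !lexx orbT.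
have mx := le_trans mxy (gp_le_l o x y).
have my := le_trans mxy (gp_le_r o x y).
have mz := le_trans myz (gp_le_r o y z).
have e1 : expR (m - gp o x y) <= 1 by rewrite expR_le1 subr_le0.
have e2 : expR (m - gp o y z) <= 1 by rewrite expR_le1 subr_le0.
have := segments_contract m0 mx my; have := segments_contract m0 my mz.
have := segments_fellow m0 mx mz.
have := metric_triangle (segment_to o x m) (segment_to o y m) (segment_to o z m).
lra.
Qed.

(** The length of a chain for the visual quasimetric [exp (- (x, y)_o)] on [X]. *)
Fixpoint vis_length o x (p : seq X) : R :=
  if p is y :: q then expR (- gp o x y) + vis_length o y q else 0.

Lemma vis_length_ge0 o x p : 0 <= vis_length o x p.
Proof. by elim: p x => //= y p IH x; rewrite addr_ge0 ?expR_ge0. Qed.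

Lemma vis_length_cat o x p q :
  vis_length o x (p ++ q) = vis_length o x p + vis_length o (last x p) q.
Proof. by elim: p x => [|y p IH] x /=; rewrite ?add0r // IH addrA. Qed.

(** The chain inequality: the constant does not depend on the number of points.
    All the points of the chain are beyond the sphere of radius [s], where
    [expR (- s)] is the length of the chain, and the geodesics to consecutive
    points cut this sphere at points whose distances add up to at most 1. *)
Lemma vis_chain o x p : p != [::] ->
  expR (- gp o x (last x p)) <= 3 * vis_length o x p.
Proof.
move=> p0; set S := vis_length o x p.
have S0 : 0 < S.
  rewrite /S {S}; case: p p0 => //= y p _.
  by rewrite ltr_pwDl ?expR_gt0 ?vis_length_ge0.
have [S1|S1] := lerP 1 S.
  have : expR (- gp o x (last x p)) <= 1 by rewrite expR_le1 oppr_le0 gp_ge0.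
  by move=> h; apply: le_trans h _; lra.
pose s := - ln S.
have s0 : 0 <= s by rewrite /s oppr_ge0 ln_le0 // ltW.
have es : expR s * S = 1 by rewrite /s expRN lnK ?posrE // mulVf // gt_eqF.
have key : forall q y, vis_length o y q <= S -> q != [::] ->
    [/\ s <= d o y, s <= d o (last y q) &
     d (segment_to o y s) (segment_to o (last y q) s) <=
     expR s * vis_length o y q].
  elim=> // z q IH y /= qS _.
  have q0 := vis_length_ge0 o z q.
  have syz : s <= gp o y z.
    rewrite -(lerN2 (gp o y z)) /s opprK -ler_expR lnK ?posrE //; lra.
  have sy := le_trans syz (gp_le_l o y z); have sz := le_trans syz (gp_le_r o y z).
  have c1 := segments_contract s0 sy sz; rewrite expRD in c1.
  have e := expR_gt0 (- gp o y z).
  have [->/=|qn] := eqVneq q [::]; first by split => //; lra.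
  have [h1 h2 h3] := IH z ltac:(lra) qn.
  split => //; rewrite mulrDr.
  apply: le_trans (metric_triangle _ (segment_to o z s) _) _.
  exact: lerD.
have [h1 h2 h3] := key p x (lexx _) p0; rewrite -/S es in h3.
have := segments_fellow s0 h1 h2 => h4.
have : expR (- gp o x (last x p)) <= expR (1 / 2 - s) by rewrite ler_expR; lra.
move=> /le_trans; apply; rewrite expRD /s opprK lnK ?posrE // ler_pM2r //.
have := expR_ge1Dx (- (1 / 2) : R); have := expR_gt0 (1 / 2 : R).
have : expR (1 / 2 : R) * expR (- (1 / 2)) = 1 by rewrite expRxMexpNx_1.
move: (expR (1 / 2)) (expR (- (1 / 2))) => a b; nra.
Qed.

Lemma rays_contract c c' s t : geodesic_ray c -> geodesic_ray c' -> c 0 = c' 0 ->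
  0 <= s -> s <= t -> d (c s) (c' s) <= expR (s - gp (c 0) (c t) (c' t)).
Proof.
move=> rc rc' cc s0 st; have t0 := le_trans s0 st.
apply: geodesics_contract => //; first exact: ray_segment.
- by rewrite cc; exact: ray_segment.
- by rewrite ray_dist0.
- by rewrite cc ray_dist0.
Qed.

Lemma rays_fellow c c' s t : geodesic_ray c -> geodesic_ray c' -> c 0 = c' 0 ->
  0 <= s -> s <= t -> s - d (c s) (c' s) / 2 <= gp (c 0) (c t) (c' t).
Proof.
move=> rc rc' cc s0 st; have t0 := le_trans s0 st.
have := @gp_fellow _ _ (c 0) (c t) (c' t) (c s) (c' s).
rewrite {3 4}cc !ray_dist0 ?ray_dist // => /(_ ltac:(lra)).
rewrite cc !ray_dist0 ?ray_dist // => /(_ ltac:(lra)); lra.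
Qed.

Lemma ray_segment_contract c x s t : geodesic_ray c -> 0 <= s -> s <= t ->
  s <= d (c 0) x ->
  d (segment_to (c 0) x s) (c s) <= expR (s - gp (c 0) x (c t)).
Proof.
move=> rc s0 st sx; have t0 := le_trans s0 st.
apply: geodesics_contract => //; first exact: segment_toP.
- exact: ray_segment.
- by rewrite ray_dist0.
Qed.

(** Since the products are monotone in time, the contraction estimate at time [s]
    improves indefinitely. *)
Lemma rays_eq c c' : geodesic_ray c -> geodesic_ray c' -> c 0 = c' 0 ->
  (forall M, exists2 t, 0 <= t & M <= gp (c 0) (c t) (c' t)) ->
  forall s, 0 <= s -> c s = c' s.
Proof.
move=> rc rc' cc unb s s0; apply: mdist_positivity; apply/eqP.
rewrite eq_le mdist_ge0 andbT leNgt; apply/negP => dp.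
have [t t0 ht] := unb (Num.max s (s - ln (d (c s) (c' s)) + 1)).
have st : s <= t.
  apply: le_trans (_ : s <= gp (c 0) (c t) (c' t)) _.
    by apply: le_trans ht; rewrite le_max lexx.
  by apply: le_trans (gp_le_l _ _ _) _; rewrite ray_dist0.
have := rays_contract rc rc' cc s0 st; apply/negP; rewrite -ltNge.
rewrite -[ltRHS]lnK ?posrE // ltr_expR.
have : s - ln (d (c s) (c' s)) + 1 <= gp (c 0) (c t) (c' t).
  by apply: le_trans ht; rewrite le_max lexx orbT.
lra.
Qed.

Lemma asymptotic_rays_eq c c' : geodesic_ray c -> geodesic_ray c' -> c 0 = c' 0 ->
  asymptotic c c' -> forall s, 0 <= s -> c s = c' s.
Proof.
move=> rc rc' cc [K hK]; apply: rays_eq => // M.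
have K0 : 0 <= K by apply: le_trans (hK 0 (lexx _)); exact: mdist_ge0.
exists (Num.max 0 (M + K)); first by rewrite le_max lexx.
set t := Num.max _ _; have t0 : 0 <= t by rewrite le_max lexx.
have tM : M + K <= t by rewrite le_max lexx orbT.
apply: le_trans (rays_fellow rc rc' cc t0 (lexx t)).
have := hK t t0; lra.
Qed.

End Hyperbolicity.

(** * Ultralimits of geodesics and the boundary *)

Section Ultralimits.
Context {R : realType} {X : metricType R}.
Hypotheses (hproper : proper_space X) (hcat : cat_minus_one X).
Implicit Types (o x y z w : X) (s t e : R) (c : R -> X).
Local Notation d := (@mdist R X).
Local Notation gp := (@gromov_product R X).

Lemma mdist_small_eq x y : (forall e, 0 < e -> d x y < e) -> x = y.
Proof.
move=> h; apply: mdist_positivity; apply/eqP; rewrite eq_le mdist_ge0 andbT.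
by apply/ler_addgt0Pr => e e0; rewrite add0r ltW // h.
Qed.

Lemma ultralimit_point (I : Type) (U : set_system I) (f : I -> X) o r :
  UltraFilter U -> U [set i | d o (f i) <= r] ->
  exists x, forall e, 0 < e -> U [set i | d (f i) x < e].
Proof.
move=> UU Ur; have FF : ProperFilter (f @ U) by apply: fmap_proper_filter.
have [x [_ cx]] := @hproper o r _ FF Ur.
exists x => e e0; have [//|nU] := in_ultra_setVsetC [set i | d (f i) x < e] UU.
have fB : (f @ U) (~` [set y | d y x < e]) by [].
have nB : nbhs x [set y | d y x < e].
  by apply/nbhs_ballP; exists e => //= y; rewrite ballEmdist /= metric_sym.
by have [y [/= h1 h2]] := cx _ _ fB nB.
Qed.

(** Arzela-Ascoli along an ultrafilter: no subsequence has to be extracted, and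
    the limit curve inherits the metric relations of the curves. *)
Lemma ultralimit_ray (I : Type) (U : set_system I) (f : I -> R -> X) o :
  UltraFilter U -> (forall i, f i 0 = o) ->
  (forall T, U [set i | forall s t, 0 <= s -> s <= T -> 0 <= t -> t <= T ->
     d (f i s) (f i t) = `|s - t|]) ->
  exists c, [/\ geodesic_ray c, c 0 = o &
    forall s e, 0 <= s -> 0 < e -> U [set i | d (f i s) (c s) < e]].
Proof.
move=> UU f0 fU.
have ex s : exists x, 0 <= s -> forall e, 0 < e -> U [set i | d (f i s) x < e].
  have [s0|s0] := leP 0 s; last by exists o.
  have [|x hx] := @ultralimit_point I U (f ^~ s) o s UU; last by exists x.
  apply: filterS (fU s) => i /= /(_ 0 s (lexx _) s0 s0 (lexx _)).
  by rewrite f0 sub0r normrN ger0_norm // => ->.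
have [c hc] := choice ex; exists c; split; last by move=> s e s0; exact: hc.
- move=> s t s0 t0; apply/eqP; rewrite -subr_eq0 -normr_le0.
  apply/ler_addgt0Pr => e e0; rewrite add0r.
  have e20 : 0 < e / 2 by lra.
  have [i /= [[h1 h2] h3]] : [set i | (d (f i s) (c s) < e / 2 /\
      d (f i t) (c t) < e / 2) /\ d (f i s) (f i t) = `|s - t|] !=set0.
    apply: (@filter_ex _ U _); apply: filterI.
      by apply: filterI; exact: hc.
    apply: filterS (fU (Num.max s t)) => i /= h.
    by apply: h; rewrite ?le_max ?lexx ?orbT.
  rewrite -h3.
  have := metric_triangle (c s) (f i s) (c t); have := metric_triangle (f i s) (f i t) (c t).
  have := metric_triangle (f i s) (c s) (f i t); have := metric_triangle (c s) (c t) (f i t).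
  rewrite [d (c s) (f i s)]metric_sym [d (c t) (f i t)]metric_sym => *.
  by rewrite ler_norml; apply/andP; split; lra.
- apply: mdist_small_eq => e e0; have [i /=] := @filter_ex _ U _ _ (hc 0 (lexx _) e e0).
  by rewrite f0 metric_sym.
Qed.

Lemma segments_ultralimit (I : Type) (U : set_system I) (x : I -> X) o :
  UltraFilter U -> (forall T, U [set i | T <= d o (x i)]) ->
  exists c, [/\ geodesic_ray c, c 0 = o &
    forall s e, 0 <= s -> 0 < e -> U [set i | d (segment_to o (x i) s) (c s) < e]].
Proof.
move=> UU xU; apply: ultralimit_ray => [i|T].
  by have [] := segment_toP hcat o (x i).
apply: filterS (xU T) => i /= Ti s t s0 sT t0 tT.
have [_ _ ->] := segment_toP hcat o (x i) => //.
- by rewrite s0 (le_trans sT).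
- by rewrite t0 (le_trans tT).
Qed.

Lemma ultralimit_gp (I : Type) (U : set_system I) (x : I -> X) c :
  Filter U -> geodesic_ray c -> (forall T, U [set i | T <= d (c 0) (x i)]) ->
  (forall s e, 0 <= s -> 0 < e ->
    U [set i | d (segment_to (c 0) (x i) s) (c s) < e]) ->
  forall M, exists2 t, 0 <= t & U [set i | M <= gp (c 0) (x i) (c t)].
Proof.
move=> FU rc xU cU M; pose t := Num.max 0 (M + 1).
have t0 : 0 <= t by rewrite le_max lexx.
exists t => //; apply: filterS (filterI (xU t) (cU t 1 t0 ltr01)) => i /= [h1 h2].
have [ax bx] := segment_dist (segment_toP hcat (c 0) (x i)) t0 h1.
have := @gp_fellow _ _ (c 0) (x i) (c t) (segment_to (c 0) (x i) t) (c t).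
rewrite ax bx ray_dist0 // mdistxx => /(_ ltac:(lra) ltac:(lra)).
have : M + 1 <= t by rewrite le_max lexx orbT.
lra.
Qed.

End Ultralimits.

Section BoundaryPoints.
Context {R : realType} {X : metricType R}.
Hypotheses (hproper : proper_space X) (hcat : cat_minus_one X).
Implicit Types (o x y z w : X) (s t e : R) (c : R -> X) (xi eta : boundary X).
Local Notation d := (@mdist R X).
Local Notation gp := (@gromov_product R X).

Lemma asymptotic_sym c c' : asymptotic c c' -> asymptotic c' c.
Proof. by move=> [K h]; exists K => t t0; rewrite metric_sym h. Qed.

Lemma asymptotic_trans c c' c'' :
  asymptotic c c' -> asymptotic c' c'' -> asymptotic c c''.
Proof.
move=> [K h] [K' h']; exists (K + K') => t t0.
by apply: le_trans (metric_triangle _ (c' t) _) (lerD (h _ t0) (h' _ t0)).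
Qed.

Lemma asymptotic_refl c : asymptotic c c.
Proof. by exists 0 => t _; rewrite mdistxx. Qed.

(** The segments from [o] to the points of a ray that starts elsewhere
    converge to a ray in the same class. *)
Lemma asymptotic_ray_from o c : geodesic_ray c ->
  exists c', [/\ geodesic_ray c', c' 0 = o & asymptotic c c'].
Proof.
move=> rc; set D := d o (c 0).
have D0 : 0 <= D := mdist_ge0 _ _.
have [U [UU sU]] := ultraFilterLemma (@eventually_filter).
have near_ge (T : R) : U [set n | T <= n%:R].
  by apply: sU; exact: (nbhs_infty_ger T).
have far n : n%:R - D <= d o (c n%:R).
  have := metric_triangle (c 0) o (c n%:R).
  by rewrite ray_dist0 // [d (c 0) o]metric_sym -/D; lra.
have [T|c' [rc' c'0 hc']] :=
  @segments_ultralimit _ _ hproper hcat nat U (fun n => c n%:R) o UU.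
  by apply: filterS (near_ge (T + D)) => n /=; have := far n; lra.
exists c'; split=> //; exists (3 * D + 2) => s s0.
have [n /= [h1 h2]] : [set n | d (segment_to o (c n%:R) s) (c' s) < 1 /\
    s + D <= n%:R] !=set0.
  by apply: (@filter_ex _ U _); apply: filterI; [exact: hc'|exact: near_ge].
have sn : s <= n%:R by lra.
have n0 : 0 <= n%:R :> R by [].
have fn := far n.
have sx : s <= d o (c n%:R) by lra.
have [ax bx] := segment_dist (segment_toP hcat o (c n%:R)) s0 sx.
have up t : 0 <= t -> d o (c t) <= D + t.
  by move=> t0; have := metric_triangle o (c 0) (c t); rewrite ray_dist0.
have lo t : 0 <= t -> t - D <= d o (c t).
  move=> t0; have := metric_triangle (c 0) o (c t).
  by rewrite ray_dist0 // [d (c 0) o]metric_sym -/D; lra.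
suff : d (c s) (segment_to o (c n%:R) s) <= 3 * D + 1.
  by have := metric_triangle (c s) (segment_to o (c n%:R) s) (c' s); lra.
have [sD|Ds] := leP s D.
  have := metric_triangle (c s) o (segment_to o (c n%:R) s).
  by rewrite [d (c s) o]metric_sym ax; have := up s s0; lra.
have u0 : 0 <= s - D by lra.
have us : s - D <= d o (c s) by exact: lo.
have un : s - D <= d o (c n%:R) by lra.
have [ax' bx'] := segment_dist (segment_toP hcat o (c s)) u0 us.
have h := segments_contract hcat u0 us un.
have g : s - D <= gp o (c s) (c n%:R).
  by rewrite /gromov_product ray_dist //; have := lo s s0; lra.
have : expR (s - D - gp o (c s) (c n%:R)) <= 1 by rewrite expR_le1 subr_le0.
have [_ _ sd] := segment_toP hcat o (c n%:R).
have : d (segment_to o (c n%:R) (s - D)) (segment_to o (c n%:R) s) = D.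
  rewrite sd ?u0 ?s0 ?un ?sx // distrC ger0_norm; lra.
have := metric_triangle (c s) (segment_to o (c s) (s - D)) (segment_to o (c n%:R) s).
have := metric_triangle (segment_to o (c s) (s - D))
  (segment_to o (c n%:R) (s - D)) (segment_to o (c n%:R) s).
rewrite [d (c s) (segment_to o (c s) _)]metric_sym bx'.
by have := up s s0; lra.
Qed.

Lemma boundary_asymptotic xi c c' : val xi c -> val xi c' ->
  [/\ geodesic_ray c, geodesic_ray c' & asymptotic c c'].
Proof.
case: xi => S /= /set_mem [c0 rc0 ->] [rc ac] [rc' ac']; split=> //.
by apply: asymptotic_trans ac'; apply: asymptotic_sym.
Qed.

(** A boundary point is the set of its rays, so it is determined by any of them. *)
Lemma boundary_eq xi eta c c' : val xi c -> val eta c' -> asymptotic c c' ->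
  xi = eta.
Proof.
case: xi => S hS; case: eta => S' hS' /= Sc Sc' cc'.
apply: eq_exist; move: hS hS' Sc Sc'.
move=> /set_mem [c0 rc0 ->] /set_mem [c1 rc1 ->] [rc ac] [rc' ac'].
apply/seteqP; split=> b [rb ab]; split=> //.
- apply: asymptotic_trans ac' _; apply: asymptotic_trans (asymptotic_sym cc') _.
  by apply: asymptotic_trans (asymptotic_sym ac) ab.
- apply: asymptotic_trans ac _; apply: asymptotic_trans cc' _.
  by apply: asymptotic_trans (asymptotic_sym ac') ab.
Qed.

Lemma ray_to_mem o xi : val xi (ray_to o xi) /\ ray_to o xi 0 = o.
Proof.
have [c [xc c0]] : exists c, val xi c /\ c 0 = o.
  case: xi => S /= /set_mem [c0 rc0 ->].
  by have [c [rc co ac]] := asymptotic_ray_from o rc0; exists c.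
exact: (@xgetI _ _ [set c : R -> X | val xi c /\ c 0 = o] c (conj xc c0)).
Qed.

Lemma ray_to0 o xi : ray_to o xi 0 = o.
Proof. by have [] := ray_to_mem o xi. Qed.

Lemma ray_to_ray o xi : geodesic_ray (ray_to o xi).
Proof. by have [h _] := ray_to_mem o xi; have [] := boundary_asymptotic h h. Qed.

Lemma ray_to_dist o xi t : 0 <= t -> d o (ray_to o xi t) = t.
Proof. by move=> t0; rewrite -{1}(ray_to0 o xi) ray_dist0 //; exact: ray_to_ray. Qed.

Lemma ray_class o c : geodesic_ray c -> c 0 = o ->
  exists xi, forall s, 0 <= s -> ray_to o xi s = c s.
Proof.
move=> rc co.
have hS : [set c' | geodesic_ray c' /\ asymptotic c c'] \in
  [set S : set (R -> X) | exists2 c, geodesic_ray c &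
     S = [set c' | geodesic_ray c' /\ asymptotic c c']].
  by apply: mem_set; exists c.
pose xi : boundary X := @exist (set (R -> X)) (fun S => S \in
  [set S : set (R -> X) | exists2 c, geodesic_ray c &
     S = [set c' | geodesic_ray c' /\ asymptotic c c']]) _ hS; exists xi => s s0.
have xc : val xi c by split=> //; exact: asymptotic_refl.
have [h h0] := ray_to_mem o xi; have [r1 r2 a] := boundary_asymptotic h xc.
by apply: (asymptotic_rays_eq hcat) => //; rewrite h0 co.
Qed.

Lemma ray_to_gp_mono o x xi s t : 0 <= s -> s <= t ->
  gp o x (ray_to o xi s) <= gp o x (ray_to o xi t).
Proof.
move=> s0 st; have := ray_gp_mono x (ray_to_ray o xi) s0 st.
by rewrite ray_to0.
Qed.

Lemma ray_to_gp_mono2 o xi eta s t : 0 <= s -> s <= t ->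
  gp o (ray_to o xi s) (ray_to o eta s) <= gp o (ray_to o xi t) (ray_to o eta t).
Proof.
move=> s0 st; apply: le_trans (ray_to_gp_mono _ _ _ s0 st) _.
by rewrite ![gp o _ (ray_to o eta t)]gpC; exact: ray_to_gp_mono.
Qed.

Lemma boundary_neq_gp_bounded o xi eta : xi <> eta ->
  exists M, forall t, 0 <= t -> gp o (ray_to o xi t) (ray_to o eta t) <= M.
Proof.
move=> ne; apply: contrapT => h; apply: ne.
have [h1 h10] := ray_to_mem o xi; have [h2 h20] := ray_to_mem o eta.
apply: (boundary_eq h1 h2); exists 0 => t t0.
rewrite le_eqVlt; apply/orP; left; apply/eqP; rewrite -(mdistxx (ray_to o eta t)).
congr d; apply: (rays_eq hcat) => //; rewrite ?h10 //; try exact: ray_to_ray.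
move=> M; apply: contrapT => h'; apply: h; exists M => s s0.
by rewrite leNgt; apply/negP => hs; apply: h'; exists s => //; exact: ltW.
Qed.

(** The product of two rays is monotone in time, hence converges to its
    supremum as soon as it is bounded. *)
Lemma boundary_gp_cvg o xi eta : xi <> eta ->
  gp o (ray_to o xi t) (ray_to o eta t) @[t --> +oo] -->
    sup [set gp o (ray_to o xi t) (ray_to o eta t) | t in [set t | 0 <= t]].
Proof.
move=> ne; have [M hM] := boundary_neq_gp_bounded o ne.
set S := [set _ | t in _].
have hS : has_sup S.
  split; first by exists (gp o (ray_to o xi 0) (ray_to o eta 0)); exists 0 => /=.
  by exists M => _ [t t0 <-]; exact: hM.
apply/cvgrPdist_le => e e0.
have [_ [t0 /= t00 <-] ht0] := sup_adherent e0 hS.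
near=> t; have t0t : t0 <= t by near: t; apply: nbhs_pinfty_ge; exact: num_real.
have tp : 0 <= t := le_trans t00 t0t.
have := ray_to_gp_mono2 o xi eta t00 t0t.
have : gp o (ray_to o xi t) (ray_to o eta t) <= sup S.
  by apply: (sup_upper_bound hS); exists t.
by rewrite ler_norml => ? ?; apply/andP; split; lra.
Unshelve. all: by end_near. Qed.

Lemma gp_le_boundary_gp o xi eta t : xi <> eta -> 0 <= t ->
  gp o (ray_to o xi t) (ray_to o eta t) <= boundary_gromov_product o xi eta.
Proof.
move=> ne t0; rewrite /boundary_gromov_product (cvg_lim _ (boundary_gp_cvg ne)) //.
have [M hM] := boundary_neq_gp_bounded o ne.
apply: sup_upper_bound; last by exists t.
split; first by exists (gp o (ray_to o xi 0) (ray_to o eta 0)); exists 0 => /=.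
by exists M => _ [s s0 <-]; exact: hM.
Qed.

Lemma boundary_gp_le o xi eta M : xi <> eta ->
  (forall t, 0 <= t -> gp o (ray_to o xi t) (ray_to o eta t) <= M) ->
  boundary_gromov_product o xi eta <= M.
Proof.
move=> ne hM; rewrite /boundary_gromov_product (cvg_lim _ (boundary_gp_cvg ne)) //.
apply: ge_sup; last by move=> _ [s s0 <-]; exact: hM.
by exists (gp o (ray_to o xi 0) (ray_to o eta 0)); exists 0 => /=.
Qed.

Lemma visual_dist_le o xi eta t : 0 <= t ->
  visual_dist o xi eta <= expR (- gp o (ray_to o xi t) (ray_to o eta t)).
Proof.
move=> t0; rewrite /visual_dist; case: eqP => [_|ne]; first exact: expR_ge0.
by rewrite ler_expR lerN2 gp_le_boundary_gp.
Qed.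

Lemma visual_dist_ge o xi eta M :
  (forall t, 0 <= t -> gp o (ray_to o xi t) (ray_to o eta t) <= M) ->
  expR (- M) <= visual_dist o xi eta.
Proof.
move=> hM; rewrite /visual_dist; case: eqP => [e|ne].
  have M0 : 0 <= M + 1.
    by have := hM 0 (lexx _); have := gp_ge0 o (ray_to o xi 0) (ray_to o eta 0); lra.
  by have := hM (M + 1) M0; rewrite e gpxx ray_to_dist //; lra.
by rewrite ler_expR lerN2 boundary_gp_le.
Qed.

Lemma visual_dist_ge0 o xi eta : 0 <= visual_dist o xi eta.
Proof. by rewrite /visual_dist; case: ifP => // _; exact: expR_ge0. Qed.

(** The contraction estimate in the limit: [rays_contract] holds for all later
    times, and the products there increase to the boundary product. *)
Lemma ray_to_lipschitz o xi eta s : 0 <= s ->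
  d (ray_to o xi s) (ray_to o eta s) <= expR s * visual_dist o xi eta.
Proof.
move=> s0; rewrite /visual_dist; case: eqP => [->|ne].
  by rewrite mdistxx mulr0.
rewrite -expRD; have := mdist_ge0 (ray_to o xi s) (ray_to o eta s).
rewrite le_eqVlt => /orP[/eqP <-|dp]; first exact: expR_ge0.
rewrite -[leLHS]lnK ?posrE // ler_expR.
suff : boundary_gromov_product o xi eta <= s - ln (d (ray_to o xi s) (ray_to o eta s)).
  by lra.
apply: boundary_gp_le => // t t0.
have sT : s <= Num.max s t by rewrite le_max lexx.
have tT : t <= Num.max s t by rewrite le_max lexx orbT.
apply: le_trans (ray_to_gp_mono2 o xi eta t0 tT) _.
have := rays_contract hcat (ray_to_ray o xi) (ray_to_ray o eta) _ s0 sT.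
rewrite !ray_to0 => /(_ erefl).
by rewrite -[X in X <= _ -> _]lnK ?posrE // ler_expR; lra.
Qed.

End BoundaryPoints.

(** * The cone topology on the limit set *)

Lemma nbhs_initial (S : choiceType) (T : topologicalType) (h : S -> T) (x : S) U :
  nbhs (x : initial_topology h) U <-> exists2 W, nbhs (h x) W & h @^-1` W `<=` U.
Proof.
split.
  rewrite nbhsE => -[B [[W oW <-] Wx] BU]; exists W => //.
  by exists W.
by move=> [W nW WU]; apply: filterS WU _; exact: (@initial_continuous _ _ h x).
Qed.

Section InitialTopology.
Context {R : realType} {I : Type} {X : metricType R} {S : choiceType}.
Variable f : S -> prod_topology (fun _ : I => X).

Lemma cvg_initial_prod (F : set_system S) (x : S) : Filter F ->
  (forall i e, 0 < e -> F [set z | mdist (f z i) (f x i) < e]) ->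
  F --> (x : initial_topology f).
Proof.
move=> FF hF U /(@nbhs_initial _ _ f) [W nW WU]; apply: filterS WU _.
suff : (f @ F) --> (f x : prod_topology (fun _ : I => X)) by apply.
apply/cvg_sup => i V /(@nbhs_initial _ _ (fun h : prod_topology (fun _ : I => X) => h i)).
move=> [W0 /nbhs_ballP[e /= e0 eW] WV].
have := hF i e e0; apply: (@filterS _ F) => z /= zi; apply: WV => /=; apply: eW.
by rewrite ballEmdist /= metric_sym.
Qed.

Lemma initial_prod_nbhs (x : S) i e : 0 < e ->
  nbhs (x : initial_topology f) [set z | mdist (f z i) (f x i) < e].
Proof.
move=> e0; apply/(@nbhs_initial _ _ f).
exists [set h | mdist (h i) (f x i) < e] => //.
have /cvg_sup/(_ i) : nbhs (f x) --> (f x : prod_topology (fun _ : I => X)).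
  exact: cvg_id.
apply; apply/(@nbhs_initial _ _ (fun h : prod_topology (fun _ : I => X) => h i)).
exists [set y | mdist y (f x i) < e] => //.
by apply/nbhs_ballP; exists e => //= y; rewrite ballEmdist /= metric_sym.
Qed.

End InitialTopology.

Section LimitSpace.
Context {R : realType} {X : metricType R}.
Hypotheses (hproper : proper_space X) (hcat : cat_minus_one X).
Variables (o : X) (G : set (X -> X)).
Implicit Types (x y : X) (s t e : R) (c : R -> X) (xi eta : boundary X).
Local Notation d := (@mdist R X).
Local Notation gp := (@gromov_product R X).

Lemma bordification_nbhs_proj (z : bordification o) s e : 0 <= s -> 0 < e ->
  nbhs z [set z' : bordification o | d (ball_proj o s z') (ball_proj o s z) < e].
Proof.
move=> s0 e0.
exact: (@initial_prod_nbhs R {nonneg R} X (X + boundary X)%type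
  (fun p r => ball_proj o r%:num p) z (NngNum s0) e e0).
Qed.

(** Basic neighbourhoods of the cone topology control all radii up to [T] at
    once: they form a filter base that converges in the initial topology. *)
Lemma bordification_nbhs_basis (z : bordification o) U : nbhs z U ->
  exists T e, [/\ 0 <= T, 0 < e & forall z', (forall s, 0 <= s -> s <= T ->
    d (ball_proj o s z') (ball_proj o s z) < e) -> U z'].
Proof.
pose B (p : R * R) : set (bordification o) := [set z' | forall s, 0 <= s ->
  s <= p.1 -> d (ball_proj o s z') (ball_proj o s z) < p.2].
pose F := filter_from [set p : R * R | 0 <= p.1 /\ 0 < p.2] B.
have FF : Filter F.
  apply: filter_from_filter; first by exists (0, 1); split => /=.
  move=> [T e] [T' e'] [/= T0 e0] [/= T'0 e'0].
  exists (Num.max T T', Num.min e e'); first by split; rewrite ?le_max ?T0 // lt_min e0.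
  by move=> z' h; split=> s s0 /= sT; have := h s s0;
    rewrite /= lt_min le_max sT ?orbT => /(_ isT) /andP[].
have cF : F --> z.
  apply: (@cvg_initial_prod R {nonneg R} X (X + boundary X)%type
    (fun p r => ball_proj o r%:num p)) => s e e0.
  exists (s%:num, e); first by split => /=.
  by move=> z'; apply => /=.
by move=> /cF [[T e] [/= T0 e0] BU]; exists T, e; split=> // z' h; apply: BU.
Qed.

Lemma rays_close xi eta s t : 0 <= s -> s <= t ->
  d (ray_to o xi t) (ray_to o eta t) < 1 ->
  d (ray_to o xi s) (ray_to o eta s) <= expR (s - t + 1 / 2).
Proof.
move=> s0 st h; have t0 := le_trans s0 st.
have rx := ray_to_ray hproper hcat o xi; have re := ray_to_ray hproper hcat o eta.
have x0 := ray_to0 hproper hcat o xi; have e0 := ray_to0 hproper hcat o eta.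
have := rays_fellow rx re _ t0 (lexx t); have := rays_contract hcat rx re _ s0 st.
rewrite !x0 e0 => /(_ erefl) h1 /(_ erefl) h2; apply: le_trans h1 _.
by rewrite ler_expR; lra.
Qed.

Lemma expR_small e : 0 < e -> exists M : R, forall t, t <= - M -> expR t < e.
Proof.
move=> e0; exists (1 - ln e) => t h; rewrite -[ltRHS]lnK ?posrE // ltr_expR; lra.
Qed.

(** From topology to products: an orbit point whose projection to a large ball is
    close to the ray has a large product with it, and conversely a large product
    makes all projections to smaller balls exponentially close. *)
Lemma limit_setP xi : limit_set o G xi <->
  forall M, exists g t, [/\ G g, 0 <= t & M <= gp o (g o) (ray_to o xi t)].
Proof.
split.
  move=> lx M; pose s := Num.max 0 (M + 1).
  have s0 : 0 <= s by rewrite le_max lexx.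
  have sM : M + 1 <= s by rewrite le_max lexx orbT.
  have [y [_ [g Gg <-] /=]] := lx _ (bordification_nbhs_proj (inr xi) s0 ltr01).
  set m := Num.min s _ => h; exists g, s; split=> //.
  have m0 : 0 <= m by rewrite le_min s0 mdist_ge0.
  have mg : m <= d o (g o) by rewrite ge_min lexx orbT.
  have [ax bx] := segment_dist (segment_toP hcat o (g o)) m0 mg.
  have := @gp_fellow _ _ o (g o) (ray_to o xi s) (segment_to o (g o) m) (ray_to o xi s).
  rewrite ax bx ray_to_dist // mdistxx => /(_ ltac:(lra) ltac:(lra)).
  have := metric_triangle o (segment_to o (g o) m) (ray_to o xi s).
  rewrite ax ray_to_dist //; lra.
move=> h U /bordification_nbhs_basis [T [e [T0 e0 BU]]].
have [M hM] := expR_small e0.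
have [g [t [Gg t0 ht]]] := h (Num.max T (T + M)).
exists (inl (g o)); split; [by []|by exists g|].
have hT : T <= gp o (g o) (ray_to o xi t) by apply: le_trans ht; rewrite le_max lexx.
have hTM : T + M <= gp o (g o) (ray_to o xi t).
  by apply: le_trans ht; rewrite le_max lexx orbT.
have Tg := le_trans hT (gp_le_l _ _ _).
have Tt := le_trans hT (gp_le_r _ _ _); rewrite ray_to_dist // in Tt.
apply: BU => s s0 sT /=; have sg := le_trans sT Tg; have st := le_trans sT Tt.
rewrite (min_l sg).
have := ray_segment_contract hcat (ray_to_ray hproper hcat o xi) s0 st.
rewrite ray_to0 // => /(_ _ sg) /le_lt_trans; apply; apply: hM; lra.
Qed.

(** Being at distance less than 1 at every time is enough: closeness at time
    [s] forces a product of about [s] with the limit ray. *)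
Lemma limit_set_closed c : geodesic_ray c -> c 0 = o ->
  (forall s, 0 <= s -> exists2 xi, limit_set o G xi & d (ray_to o xi s) (c s) < 1) ->
  exists2 xi, limit_set o G xi & forall s, 0 <= s -> ray_to o xi s = c s.
Proof.
move=> rc co h; have [xi hxi] := ray_class hproper hcat rc co.
exists xi => //; apply/limit_setP => M.
pose s := Num.max 0 (M + 2).
have s0 : 0 <= s by rewrite le_max lexx.
have sM : M + 2 <= s by rewrite le_max lexx orbT.
have [eta /limit_setP leta de] := h s s0.
have [g [t [Gg t0 ht]]] := leta (M + 1).
exists g, (Num.max s t).
have sT : s <= Num.max s t by rewrite le_max lexx.
have tT : t <= Num.max s t by rewrite le_max lexx orbT.
move: (Num.max s t) sT tT => T sT tT; have T0 := le_trans s0 sT.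
split=> //.
have h1 := le_trans ht (ray_to_gp_mono hproper hcat o (g o) eta t0 tT).
have h2 : s - 1 / 2 <= gp o (ray_to o eta T) (ray_to o xi T).
  have rx := ray_to_ray hproper hcat o xi; have re := ray_to_ray hproper hcat o eta.
  have := rays_fellow re rx _ s0 sT.
  rewrite !ray_to0 // (hxi s) // => /(_ erefl); lra.
have := four_point hcat o (g o) (ray_to o eta T) (ray_to o xi T).
rewrite lerBlDr ge_min => /orP[]; lra.
Qed.

Local Notation Lambda := (limit_space o G).

Lemma limit_space_bd (z : Lambda) : exists2 xi, limit_set o G xi &
  val z = inr xi :> bordification o.
Proof. by case: z => z /= /set_mem [xi lxi <-]; exists xi. Qed.

Definition limit_space_point xi (h : limit_set o G xi) : Lambda :=
  @exist (bordification o)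
    (fun z => z \in [set (inr xi : bordification o) | xi in limit_set o G])
    (inr xi) (mem_set (ex_intro2 _ _ xi h erefl)).

Lemma limit_space_close (z z' : Lambda) s t : 0 <= s -> s <= t ->
  d (ball_proj o t (val z)) (ball_proj o t (val z')) < 1 ->
  d (ball_proj o s (val z)) (ball_proj o s (val z')) <= expR (s - t + 1 / 2).
Proof.
have [xi lxi ->] := limit_space_bd z; have [xi' lxi' ->] := limit_space_bd z'.
exact: rays_close.
Qed.

Lemma nat_above (M : R) : exists n : nat, M <= n%:R.
Proof.
exists (Num.bound `|M|); apply: le_trans (ler_norm M) (ltW _).
by apply: archi_boundP.
Qed.

(** Closeness at one large integer time controls all smaller times by
    contraction, so the cone topology has a countable neighbourhood base at each
    limit point. *)
Lemma limit_space_nbhsP (z : Lambda) (U : set Lambda) : nbhs z U <->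
  exists n : nat, forall z' : Lambda,
    d (ball_proj o n%:R (val z')) (ball_proj o n%:R (val z)) < 1 -> U z'.
Proof.
split.
  move=> /(@nbhs_initial _ _ (fun z : Lambda => val z)) [W].
  move=> /bordification_nbhs_basis [T [e [T0 e0 BU]]] WU.
  have [M hM] := expR_small e0.
  have [n hn] := nat_above (Num.max T (T + M + 1)).
  have hT : T <= n%:R by apply: le_trans hn; rewrite le_max lexx.
  have hTM : T + M + 1 <= n%:R by apply: le_trans hn; rewrite le_max lexx orbT.
  exists n => z' dz; apply: WU => /=; apply: BU => s s0 sT.
  apply: le_lt_trans (limit_space_close s0 (le_trans sT hT) dz) _.
  apply: hM; lra.
move=> [n hn]; apply/(@nbhs_initial _ _ (fun z : Lambda => val z)).
exists [set z' : bordification o |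
   d (ball_proj o n%:R z') (ball_proj o n%:R (val z)) < 1].
  exact: bordification_nbhs_proj.
by move=> z' /= /hn.
Qed.

(** The limit space with the topology that it inherits from its rays observed
    at integer times. This is again the cone topology, but a countable product
    of metric spaces carries a pseudometric. *)
Definition ray_space (z0 : Lambda) : Type :=
  initial_topology (fun (z : Lambda) =>
    (fun n : nat => ball_proj o n%:R (val z)) : prod_topology (fun _ : nat => X)).

HB.instance Definition _ (z0 : Lambda) := PseudoMetric.on (ray_space z0).
HB.instance Definition _ (z0 : Lambda) := isPointed.Build (ray_space z0) z0.

Lemma ray_space_nbhs (z0 z : Lambda) : nbhs (z : ray_space z0) = nbhs z.
Proof.
apply/seteqP; split=> U.
  pose B (n : nat) : set Lambda := [set z' |
    d (ball_proj o n%:R (val z')) (ball_proj o n%:R (val z)) < 1].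
  have cF : nbhs z --> (z : ray_space z0).
    apply: (@cvg_initial_prod _ _ _ _
      (fun (z : Lambda) (n : nat) => ball_proj o n%:R (val z))) => n e e0.
    apply/limit_space_nbhsP.
    have [M hM] := expR_small e0.
    have [m hm] := nat_above (Num.max n%:R (n%:R + M + 1)).
    have hT : n%:R <= m%:R :> R by apply: le_trans hm; rewrite le_max lexx.
    have hTM : n%:R + M + 1 <= m%:R by apply: le_trans hm; rewrite le_max lexx orbT.
    exists m => z' dz /=.
    apply: le_lt_trans (limit_space_close (ler0n R n) hT dz) _.
    apply: hM; lra.
  exact: cF.
move=> /limit_space_nbhsP [n hn].
have := @initial_prod_nbhs _ _ _ _
   (fun (z : Lambda) (n : nat) => ball_proj o n%:R (val z)) z n _ ltr01.
by apply: (@filterS _ _ (@nbhs_filter (ray_space z0) z)) => z' /= /hn.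
Qed.

End LimitSpace.

(** * Recognizing a Cantor set *)

Section LimitSpaceCantor.
Context {R : realType} {X : metricType R}.
Hypotheses (hproper : proper_space X) (hcat : cat_minus_one X).
Variables (o : X) (G : set (X -> X)).
Implicit Types (x y : X) (s t e : R) (c : R -> X) (xi eta : boundary X).
Local Notation d := (@mdist R X).
Local Notation gp := (@gromov_product R X).
Local Notation Lambda := (limit_space o G).
Local Notation ray z := (fun s => ball_proj o s (val (z : Lambda))).

Lemma limit_space_compact : compact [set: Lambda].
Proof.
rewrite compact_ultra => F UF _.
have [||c [rc co hc]] := @ultralimit_ray _ _ hproper Lambda F (fun z => ray z) o UF.
- move=> z; have [xi lxi ->] := limit_space_bd z; exact: ray_to0.
- move=> T; apply: filterE => z /= s t s0 _ t0 _.
  by have [xi lxi ->] := limit_space_bd z; apply: ray_to_ray.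
have [s s0|xi lxi hxi] := @limit_set_closed _ _ hproper hcat o G c rc co.
  have [z /= hz] := @filter_ex _ F _ _ (hc s 1 s0 ltr01).
  by have [xi lxi zx] := limit_space_bd z; exists xi => //; move: hz; rewrite zx.
exists (limit_space_point lxi); split=> // U /(limit_space_nbhsP hproper hcat) [n hn].
have := hc n%:R 1 (ler0n R n) ltr01; apply: (@filterS _ F) => z /= dz.
by apply: hn; rewrite /= hxi.
Qed.

Lemma limit_space_inj (z z' : Lambda) :
  (forall n : nat, ball_proj o n%:R (val z) = ball_proj o n%:R (val z')) -> z = z'.
Proof.
have [xi lxi zx] := limit_space_bd z; have [eta leta ze] := limit_space_bd z'.
rewrite zx ze => h; apply: val_inj; rewrite zx ze; congr inr.
apply: contrapT => /(boundary_neq_gp_bounded hproper hcat o) [M hM].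
have [n hn] := nat_above (M + 1).
have := hM n%:R (ler0n R n); have := h n => /= ->.
by rewrite gpxx ray_to_dist //; lra.
Qed.

Lemma limit_space_hausdorff : hausdorff_space Lambda.
Proof.
move=> z z' cz; apply: limit_space_inj => n; apply: mdist_small_eq => e e0.
have nb (w : Lambda) : nbhs w [set w' : Lambda |
    d (ball_proj o n%:R (val w')) (ball_proj o n%:R (val w)) < e / 2].
  apply/(@nbhs_initial _ _ (fun z : Lambda => val z)).
  exists [set w' : bordification o |
    d (ball_proj o n%:R w') (ball_proj o n%:R (val w)) < e / 2] => //.
  by apply: bordification_nbhs_proj => //; lra.
have [w [/= h1 h2]] := cz _ _ (nb z) (nb z').
have := metric_triangle (ball_proj o n%:R (val z)) (ball_proj o n%:R (val w))
  (ball_proj o n%:R (val z')).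
by rewrite [d _ (ball_proj o n%:R (val w))]metric_sym; lra.
Qed.

Lemma nbhs_dist_continuous x s (z : Lambda) e : 0 <= s -> 0 < e ->
  nbhs z [set w : Lambda | `|d x (ball_proj o s (val w)) - d x (ball_proj o s (val z))| < e].
Proof.
move=> s0 e0; apply/(@nbhs_initial _ _ (fun z : Lambda => val z)).
exists [set w' : bordification o |
    d (ball_proj o s w') (ball_proj o s (val z)) < e].
  exact: bordification_nbhs_proj.
move=> w /= h; rewrite ltr_norml.
have := metric_triangle x (ball_proj o s (val z)) (ball_proj o s (val w)).
have := metric_triangle x (ball_proj o s (val w)) (ball_proj o s (val z)).
by rewrite [d (ball_proj o s (val z)) _]metric_sym => *; apply/andP; split; lra.
Qed.

(** The sphere of the third hypothesis cuts the limit set into two clopen pieces,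
    so that the topological characterization of the Cantor space applies. *)
Lemma limit_space_cantor :
  (exists xi, limit_set o G xi) ->
  (forall xi, limit_set o G xi -> forall n : nat, exists eta,
    [/\ limit_set o G eta, eta <> xi & d (ray_to o eta n%:R) (ray_to o xi n%:R) < 1]) ->
  (forall xi eta, limit_set o G xi -> limit_set o G eta -> xi <> eta ->
    exists s r, [/\ 0 <= s, 0 < r, r < d (ray_to o xi s) (ray_to o eta s) &
      forall zeta, limit_set o G zeta -> d (ray_to o xi s) (ray_to o zeta s) <> r]) ->
  homeomorphic Lambda cantor_space.
Proof.
move=> [xi0 lxi0] hperf hsep; pose z0 : Lambda := limit_space_point lxi0.
pose E := ray_space z0.
have nE (z : Lambda) : nbhs (z : E) = nbhs z := ray_space_nbhs hproper hcat z0 z.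
have cE : cantor_like E.
  split.
  - split; first exact: closedT.
    apply/seteqP; split=> // z _ U.
    rewrite nE => /(limit_space_nbhsP hproper hcat) [n hn].
    have [xi lxi zx] := limit_space_bd z.
    have [eta [leta ne de]] := hperf xi lxi n.
    exists (limit_space_point leta : Lambda); split=> //.
      apply/eqP => h; apply: ne.
      by have := congr1 val h; rewrite /= zx => -[].
    by apply: hn; rewrite zx.
  - rewrite compact_ultra => F UF FT.
    have := limit_space_compact; rewrite compact_ultra => /(_ F UF FT) [z [_ hz]].
    by exists z; split=> // U; rewrite nE => /hz.
  - move=> z z' cz; apply: limit_space_hausdorff => A B hA hB.
    by apply: cz; rewrite nE.
  - move=> z z' /eqP zz.
    have [xi lxi zx] := limit_space_bd z; have [eta leta ze] := limit_space_bd z'.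
    have xe : xi <> eta by move=> h; apply: zz; apply: val_inj; rewrite zx ze h.
    have [s [r [s0 r0 rd hr]]] := hsep _ _ lxi leta xe.
    pose f (w : Lambda) := d (ray_to o xi s) (ball_proj o s (val w)).
    have fr w : f w <> r by rewrite /f; have [zeta lz ->] := limit_space_bd w; exact: hr.
    have fc (w : Lambda) e : 0 < e -> nbhs (w : E) [set w' | `|f w' - f w| < e].
      by move=> e0; rewrite nE; exact: nbhs_dist_continuous.
    exists [set w | f w < r]; split; first last.
    + by rewrite /= /f ze /=; lra.
    + by rewrite /= /f zx /= mdistxx.
    split.
    + rewrite openE => w /= fw; rewrite /interior.
      have p : 0 < r - f w by lra.
      by apply: (@filterS _ _ (@nbhs_filter E w) _ _ _ (fc w _ p)) => w' /=; rewrite ltr_norml => /andP[]; lra.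
    + rewrite -openC openE => w /= fw; rewrite /interior.
      have {}fw : r < f w.
        by rewrite lt_neqAle; apply/andP; split;
          [apply/eqP => h; exact: (fr w)|rewrite leNgt; apply/negP].
      have p : 0 < f w - r by lra.
      by apply: (@filterS _ _ (@nbhs_filter E w) _ _ _ (fc w _ p)) => w' /=; rewrite ltr_norml => /andP[]; lra.
have [f [cf clf]] := @homeomorphism_cantor_like R E cE.
have fK : cancel f f^-1%FUN by move=> b; apply: funK; exact: in_setT.
have Kf : cancel f^-1%FUN f by move=> z; apply: invK; exact: in_setT.
have cinv : continuous (f^-1%FUN : E -> cantor_space).
  apply/continuous_closedP => A cA.
  rewrite (_ : _ @^-1` A = f @` A); first exact: clf.
  apply/seteqP; split=> [z Az|_ [b Ab <-]]; last by rewrite /preimage /= fK.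
  by exists (f^-1%FUN z).
exists (f^-1%FUN : Lambda -> cantor_space), (f : cantor_space -> Lambda); split.
- exact: Kf.
- exact: fK.
- move=> z U hU; rewrite -nE; exact: cinv.
- by move=> b U; rewrite -nE => /cf.
Qed.

End LimitSpaceCantor.

(** * Sums over the group *)

Section Sums.
Context {R : realType} {T : choiceType}.
Implicit Types (A B : set T) (a : T -> R) (s : seq T).

Lemma sum_le_esum A a s : (forall x, 0 <= a x) -> uniq s ->
  (forall x, x \in s -> A x) -> ((\sum_(x <- s) a x)%:E <= \esum_(x in A) (a x)%:E)%E.
Proof.
move=> a0 us sA; apply: esum_ge; exists [set` s].
  by split; [exact: finite_seq|move=> x /= /sA].
by rewrite -sumEFin fsbig_seq //= fsbig_finite.
Qed.

Lemma esum_le_sum A a (M : \bar R) :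
  (forall s, uniq s -> (forall x, x \in s -> A x) -> ((\sum_(x <- s) a x)%:E <= M)%E) ->
  (\esum_(x in A) (a x)%:E <= M)%E.
Proof.
move=> h; apply: ub_ereal_sup => _ [B [finB BA] <-].
rewrite fsbig_finite //= sumEFin; apply: h; first exact: fset_uniq.
by move=> x; rewrite in_fset_set // => /set_mem/BA.
Qed.

Lemma esum_subset A B a : (forall x, 0 <= a x) -> A `<=` B ->
  (\esum_(x in A) (a x)%:E <= \esum_(x in B) (a x)%:E)%E.
Proof.
by move=> a0 AB; apply: esum_le_sum => s us sA; apply: sum_le_esum => // x /sA/AB.
Qed.

Lemma esum_finite_level A a e : (forall x, 0 <= a x) -> 0 < e ->
  (\esum_(x in A) (a x)%:E < +oo)%E -> finite_set (A `&` [set x | e <= a x]).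
Proof.
move=> a0 e0 fin; apply: contrapT => inf.
have [M hM] : exists M : R, (\esum_(x in A) (a x)%:E <= M%:E)%E.
  exists (fine (\esum_(x in A) (a x)%:E)); rewrite fineK // ge0_fin_numE //.
  by apply: esum_ge0 => x _; rewrite lee_fin.
have [n hn] := nat_above (M / e + 1).
have [F FA Fn] := infinite_set_fset n inf.
have := sum_le_esum (A := A) a0 (fset_uniq F) _.
have FA' x : x \in (F : seq T) -> A x /\ e <= a x by move=> xF; have := FA x xF.
move=> /(_ (fun x xF => (FA' x xF).1)) /le_trans/(_ hM); rewrite lee_fin.
apply/negP; rewrite -ltNge.
apply: (@lt_le_trans _ _ (\sum_(x <- F) e)).
  rewrite big_const_seq count_predT iter_addr_0 -mulr_natr.
  have : n%:R <= (size F)%:R :> R by rewrite ler_nat.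
  have : M / e + 1 <= (size F)%:R by apply: le_trans hn _; rewrite ler_nat.
  move=> h _; have : M / e < (size F)%:R by lra.
  by rewrite ltr_pdivrMr // mulrC.
by rewrite big_seq [leRHS]big_seq; apply: ler_sum => x /FA' [].
Qed.

Lemma esum_tail A a e : (forall x, 0 <= a x) -> 0 < e ->
  (\esum_(x in A) (a x)%:E < +oo)%E ->
  exists s0 : seq T, (\esum_(x in A `\` [set` s0]) (a x)%:E <= e%:E)%E.
Proof.
move=> a0 e0 fin.
have fn : \esum_(x in A) (a x)%:E \is a fin_num.
  by rewrite ge0_fin_numE //; apply: esum_ge0 => x _; rewrite lee_fin.
have [_ [B [finB BA] <-] hB] := ub_ereal_sup_adherent e0 fn.
exists (fset_set B); apply: esum_le_sum => s us sA.
rewrite fsbig_finite //= sumEFin in hB.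
have : ((\sum_(x <- s ++ fset_set B) a x)%:E <= \esum_(x in A) (a x)%:E)%E.
  apply: sum_le_esum => //.
    rewrite cat_uniq us fset_uniq andbT /=; apply/hasPn => x xB.
    by apply/negP => /sA [_]; apply.
  move=> x; rewrite mem_cat => /orP[/sA[]//|]; rewrite in_fset_set // => /set_mem.
  exact: BA.
rewrite big_cat /= EFinD => h.
rewrite -/(esum A (fun x => (a x)%:E)) -(fineK fn) -EFinD lte_fin in hB.
rewrite -(fineK fn) -EFinD lee_fin in h; rewrite lee_fin; lra.
Qed.

End Sums.

Section Group.
Context {R : realType} {X : metricType R}.
Variables (o : X) (G : set (X -> X)).
Hypothesis hG : isometry_group G.
Implicit Types (g h : X -> X) (x y : X).
Local Notation d := (@mdist R X).
Local Notation gp := (@gromov_product R X).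

Lemma group_isometry g : G g -> Defs.isometry g.
Proof. by have [h _ _ _] := hG; exact: h. Qed.

Lemma group_mdist g x y : G g -> d (g x) (g y) = d x y.
Proof. by move=> /group_isometry [h _]. Qed.

Lemma group_gp g w x y : G g -> gp (g w) (g x) (g y) = gp w x y.
Proof. by move=> /group_isometry; exact: gp_isometry. Qed.

Lemma group_id : G id.
Proof. by have [_ h _ _] := hG. Qed.

Lemma group_comp g h : G g -> G h -> G (g \o h).
Proof. by have [_ _ H _] := hG; exact: H. Qed.

Lemma group_inv g : G g -> exists h, [/\ G h, g \o h = id & h \o g = id].
Proof.
have [_ _ _ H] := hG; move=> /H [h Gh [gh hg]]; exists h; split=> //.
- by apply/funext => x /=; rewrite hg.
- by apply/funext => x /=; rewrite gh.
Qed.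

Lemma mdist_inv g h : G g -> g \o h = id -> d o (h o) = d o (g o).
Proof.
move=> Gg gh; rewrite -(group_mdist o (h o) Gg).
by rewrite -[g (h o)]/((g \o h) o) gh metric_sym.
Qed.

(** The group acts properly: this is how convergence of the series enters apart
    from the size of its tails. *)
Lemma poincare_finite_ball s (M : R) : 0 < s -> (poincare_series o G s < +oo)%E ->
  finite_set (G `&` [set g | d o (g o) <= M]).
Proof.
move=> s0 fin.
have := esum_finite_level (A := G) (a := fun g => expR (- s * d o (g o)))
  (e := expR (- s * M)) (fun g => expR_ge0 _) (expR_gt0 _) fin.
apply: sub_finite_set => g [Gg /= h]; split=> //=.
by rewrite ler_expR !mulNr lerN2 ler_pM2l.
Qed.

End Group.

(** * Components of the Cayley graph *)

Section CayleyGraph.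
Context {R : realType} {X : metricType R}.
Variables (o : X) (G : set (X -> X)).
Hypotheses (hG : isometry_group G) (fgG : finitely_generated G).
Implicit Types (g h : X -> X) (x y : X).
Local Notation d := (@mdist R X).

(** Symmetry makes the Cayley graph undirected. *)
Lemma symmetric_generators : exists S : set (X -> X), [/\ finite_set S, S `<=` G,
  (forall s, S s -> exists s', [/\ S s', s \o s' = id & s' \o s = id]) &
  forall H, isometry_group H -> S `<=` H -> G `<=` H].
Proof.
have [S [finS SG genS]] := fgG.
have inv g : exists h, G g -> [/\ G h, g \o h = id & h \o g = id].
  have [Gg|nGg] := pselect (G g); last by exists id.
  by have [h hh] := group_inv hG Gg; exists h.
have [iv hiv] := choice inv; exists (S `|` iv @` S); split.
- by rewrite finite_setU; split => //; exact: finite_image.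
- by move=> g [/SG//|[h /SG Gh <-]]; have [] := hiv h Gh.
- move=> s [Ss|[h Sh <-]].
  + by exists (iv s); have [_ h1 h2] := hiv s (SG _ Ss); split=> //; right; exists s.
  + by exists h; have [_ h1 h2] := hiv h (SG _ Sh); split=> //; left.
- by move=> H hH SH; apply: genS => // s Ss; apply: SH; left.
Qed.

Variable S : set (X -> X).
Hypotheses (SG : S `<=` G)
  (Sinv : forall s, S s -> exists s', [/\ S s', s \o s' = id & s' \o s = id])
  (Sgen : forall H, isometry_group H -> S `<=` H -> G `<=` H).

Definition cayley : rel (X -> X) := [rel g h | `[< exists2 s, S s & h = g \o s >]].

Lemma cayley_sym g h : cayley g h = cayley h g.
Proof.
have imp a b : cayley a b -> cayley b a.
  move=> /asboolP [s Ss ->]; apply/asboolP.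
  have [s' [Ss' ss' _]] := Sinv Ss; exists s' => //.
  by rewrite -[(a \o s) \o s']/(a \o (s \o s')) ss'.
by apply/idP/idP; exact: imp.
Qed.

Lemma cayley_left k g h : cayley g h -> cayley (k \o g) (k \o h).
Proof. by move=> /asboolP [s Ss ->]; apply/asboolP; exists s. Qed.

Lemma cayley_path_left k g p :
  path cayley g p -> path cayley (k \o g) [seq k \o h | h <- p].
Proof.
by elim: p g => //= h p IH g /andP[gh hp]; rewrite cayley_left //= IH.
Qed.

Lemma cayley_path_rev g p : path cayley g p ->
  path cayley (last g p) (rev (belast g p)).
Proof.
by rewrite rev_path; apply: sub_path => x y; rewrite /= cayley_sym.
Qed.

(** The elements that are reached from the identity form a group, because left
    translations preserve the edges. *)
Lemma cayley_connected g : G g -> exists2 p, path cayley id p & last id p = g.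
Proof.
pose H := [set g | G g /\ exists2 p, path cayley id p & last id p = g].
suff : G `<=` H by move=> h /h [].
apply: Sgen; last first.
  move=> s Ss; split; first exact: SG.
  by exists [:: s] => //=; rewrite andbT; apply/asboolP; exists s.
split.
- by move=> h [Gh _]; exact: (group_isometry hG).
- by split; [exact: (group_id hG)|exists [::]].
- move=> a b [Ga [p hp pa]] [Gb [q hq qb]]; split; first exact: (group_comp hG).
  exists (p ++ [seq a \o h | h <- q]).
    by rewrite cat_path hp pa /=; exact: (@cayley_path_left a id).
  by rewrite last_cat pa -[X in last X]/(a \o id) last_map qb.
- move=> a [Ga [p hp pa]]; have [b [Gb ab ba]] := group_inv hG Ga.
  exists b; last by split => x; [exact: (congr1 (@^~ x) ba)|exact: (congr1 (@^~ x) ab)].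
  split=> //; exists [seq b \o h | h <- rev (belast id p)].
    by have := cayley_path_left b (cayley_path_rev hp); rewrite pa ba.
  have := last_map (fun h => b \o h) (rev (belast id p)) a; rewrite ba => ->.
  have -> : last a (rev (belast id p)) = id by rewrite -pa;
    case: (p) => //= c q; rewrite rev_cons last_rcons.
  by [].
Qed.

Section Complement.
Variable F : set (X -> X).

(** Membership in [G] is recorded on both ends so that components consist of
    group elements. *)
Definition cayley_out : rel (X -> X) :=
  [rel g h | [&& cayley g h, ~~ `[< F g >], ~~ `[< F h >], `[< G g >] & `[< G h >]]].

Definition out_conn g h := exists2 p, path cayley_out g p & last g p = h.

Lemma cayley_out_sym g h : cayley_out g h = cayley_out h g.
Proof.
have := cayley_sym g h; rewrite /cayley_out /cayley /= => ->.
by case: `[< exists2 s, _ & _ >] => //=; case: (`[< F g >]); case: (`[< F h >]); case: (`[< G g >]); case: (`[< G h >]).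
Qed.

Lemma out_conn_refl g : out_conn g g. Proof. by exists [::]. Qed.

Lemma out_conn_trans g h k : out_conn g h -> out_conn h k -> out_conn g k.
Proof.
move=> [p hp ph] [q hq qk]; exists (p ++ q); first by rewrite cat_path hp ph.
by rewrite last_cat ph.
Qed.

Lemma out_conn_sym g h : out_conn g h -> out_conn h g.
Proof.
move=> [p hp <-]; exists (rev (belast g p)).
  by rewrite rev_path; apply: sub_path hp => x y; rewrite -cayley_out_sym.
by case: (p) => //= c q; rewrite rev_cons last_rcons.
Qed.

Lemma path_out_conn g p h : path cayley_out g p -> h \in p -> out_conn g h.
Proof.
move=> hp /splitPr hs; case: hs hp => p1 p2; rewrite cat_path /= => /and3P[h1 h2 _].
exists (rcons p1 h); last by rewrite last_rcons.
by rewrite rcons_path h1.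
Qed.

Lemma out_conn_mem g h : out_conn g h -> G g -> ~ F g -> G h /\ ~ F h.
Proof.
move=> [p hp <-]; case: (lastP p) hp => // q y; rewrite rcons_path last_rcons.
by move=> /andP[_ /and5P[_ _ /asboolPn Fy _ /asboolP Gy]].
Qed.

(** Look at the last exit from [F] of a path from the identity to [g]. Hence only
    finitely many components occur when [F] and [S] are finite. *)
Lemma reach_outer_boundary g : F id -> G g -> ~ F g -> exists f s,
  [/\ F f, S s, G (f \o s), ~ F (f \o s) & out_conn (f \o s) g].
Proof.
move=> Fid Gg; have [p hp <-] := cayley_connected Gg.
have main (x : X -> X) q : G x -> path cayley x q -> ~ F (last x q) ->
    (~ F x /\ out_conn x (last x q)) \/ exists f s,
    [/\ F f, S s, G (f \o s), ~ F (f \o s) & out_conn (f \o s) (last x q)].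
  elim: q x => [|y q IH] x Gx /=; first by left; split=> //; exact: out_conn_refl.
  move=> /andP[/asboolP [s Ss ye] hq] nF.
  have Gy : G y by rewrite ye; apply: (group_comp hG) => //; exact: SG.
  have [[nFy cy]|] := IH y Gy hq nF; last by right.
  have [Fx|nFx] := pselect (F x).
    by right; exists x, s; rewrite -ye.
  left; split=> //; apply: out_conn_trans cy; exists [:: y] => //=.
  by rewrite andbT; apply/and5P; split; try (exact/asboolP); try exact/asboolPn;
    apply/asboolP; exists s.
by move=> nF; have [[]|//] := main id p (group_id hG) hp nF.
Qed.

End Complement.

End CayleyGraph.

(** * Vanishing of the Hausdorff measure *)

Section PowerSubadditivity.
Context {R : realType}.
Implicit Types (a b : R).

(** Each of the ratios [a / (a + b)] and [b / (a + b)] is at most 1, hence at most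
    its power of exponent [alpha], and they add up to 1. *)
Lemma powR_subadd a b (alpha : R) : 0 <= a -> 0 <= b -> 0 < alpha -> alpha <= 1 ->
  (a + b) `^ alpha <= a `^ alpha + b `^ alpha.
Proof.
move=> a0 b0 al0 al1; have [ab|ab] := eqVneq (a + b) 0.
  by rewrite ab powR0 ?gt_eqF // addr_ge0 ?powR_ge0.
have s0 : 0 < a + b by rewrite lt_neqAle eq_sym ab addr_ge0.
have key c : 0 <= c -> c <= a + b -> c / (a + b) * (a + b) `^ alpha <= c `^ alpha.
  move=> c0 cs; have [->|cn] := eqVneq c 0.
    by rewrite !mul0r powR_ge0.
  have cp : 0 < c by rewrite lt_neqAle eq_sym cn.
  have -> : c `^ alpha = (c / (a + b)) `^ alpha * (a + b) `^ alpha.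
    by rewrite -powRM ?divfK // ?divr_ge0 // ltW.
  rewrite ler_wpM2r ?powR_ge0 //; apply: ger1_powR => //.
  by rewrite divr_gt0 //= ler_pdivrMr // mul1r.
have ha := key a a0 ltac:(lra); have hb := key b b0 ltac:(lra).
apply: le_trans (lerD ha hb); rewrite -mulrDl -mulrDl divff ?gt_eqF // mul1r.
exact: lexx.
Qed.

Lemma powR_sum_le (I : Type) (s : seq I) (a : I -> R) (alpha : R) :
  (forall i, 0 <= a i) -> 0 < alpha -> alpha <= 1 ->
  (\sum_(i <- s) a i) `^ alpha <= \sum_(i <- s) a i `^ alpha.
Proof.
move=> a0 al0 al1; elim: s => [|i s IH]; first by rewrite !big_nil powR0 ?gt_eqF.
rewrite !big_cons; apply: le_trans (powR_subadd _ _ al0 al1) _ => //.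
  by apply: sumr_ge0.
by rewrite lerD2l.
Qed.

End PowerSubadditivity.

Section OrbitChains.
Context {R : realType} {X : metricType R}.
Hypotheses (hproper : proper_space X) (hcat : cat_minus_one X).
Variables (o : X) (G : set (X -> X)).
Hypothesis hG : isometry_group G.
Implicit Types (g h : X -> X) (x y : X) (xi eta : boundary X) (A : set (X -> X)).
Local Notation d := (@mdist R X).
Local Notation gp := (@gromov_product R X).

(** [limit_setP] for a part [A] of the orbit. *)
Definition clusters_at A xi :=
  forall M, exists g t, [/\ A g, 0 <= t & M <= gp o (g o) (ray_to o xi t)].

Variables (S : set (X -> X)) (K : R).
Hypotheses (SK : forall s, S s -> d o (s o) <= K) (K0 : 0 <= K).

Lemma orbit_path_vis_length g p : path (cayley S) g p -> G g ->
  (forall h, h \in p -> G h) ->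
  vis_length o (g o) [seq h o | h <- p] <=
  expR K * \sum_(h <- g :: p) expR (- d o (h o)).
Proof.
elim: p g => [|h p IH] g /=.
  by move=> _ _ _; rewrite big_seq1 mulr_ge0 ?expR_ge0.
move=> /andP[/asboolP [s Ss hE] hp] Gg Gp.
rewrite big_cons mulrDr; apply: lerD; last first.
  by apply: IH => //; [apply: Gp; rewrite mem_head|move=> k kp; apply: Gp; rewrite inE kp orbT].
rewrite -expRD ler_expR.
have := gp_ge o (g o) (h o); rewrite hE /= (group_mdist hG) //.
have := SK Ss; lra.
Qed.

Lemma visual_dist_chain xi eta g p t : 0 <= t ->
  visual_dist o xi eta <= 3 * (expR (- gp o (g o) (ray_to o xi t)) +
   vis_length o (g o) [seq h o | h <- p] +
   expR (- gp o (last g p o) (ray_to o eta t))).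
Proof.
move=> t0; apply: le_trans (visual_dist_le hproper hcat o xi eta t0) _.
pose q := g o :: rcons [seq h o | h <- p] (ray_to o eta t).
have := @vis_chain _ _ hcat o (ray_to o xi t) q isT.
rewrite /q /= last_rcons => /le_trans; apply.
rewrite ler_pM2l // -cats1 vis_length_cat /= addr0 addrA.
by rewrite gpC (last_map (fun h => h o)).
Qed.

(** Two limit points of a connected part [A] of the orbit are joined by a chain:
    the first point of a path in [A] is close to [xi], the last one is close to
    [eta], and the path is injective, so its length is a partial sum over [A]. *)
Lemma cluster_set_diam A (alpha : R) (E : R) xi eta :
  A `<=` G -> 0 < alpha -> alpha <= 1 ->
  (forall g h, A g -> A h -> exists p, [/\ path (cayley S) g p, last g p = h,
     uniq (g :: p) & forall k, k \in p -> A k]) ->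
  (\esum_(g in A) (expR (- alpha * d o (g o)))%:E <= E%:E)%E ->
  clusters_at A xi -> clusters_at A eta ->
  visual_dist o xi eta `^ alpha <= 3 * expR K * E.
Proof.
move=> AG al0 al1 Aconn hE Axi Aeta; apply/ler_addgt0Pr => e e0.
have eps0 : 0 < e `^ alpha^-1 / 6 by rewrite divr_gt0 ?powR_gt0.
pose M := - ln (e `^ alpha^-1 / 6).
have [g [t [Ag t0 gt]]] := Axi M; have [h [t' [Ah t'0 ht]]] := Aeta M.
have [p [gp_ gh up pA]] := Aconn g h Ag Ah.
have T0 : 0 <= Num.max t t' by rewrite le_max t0.
have gT := le_trans gt (ray_to_gp_mono hproper hcat o (g o) xi t0
  (ltac:(by rewrite le_max lexx) : t <= Num.max t t')).
have hT := le_trans ht (ray_to_gp_mono hproper hcat o (h o) eta t'0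
  (ltac:(by rewrite le_max lexx orbT) : t' <= Num.max t t')).
move: (Num.max t t') T0 gT hT => T T0 gT hT.
have := visual_dist_chain xi eta g p T0; rewrite gh => hv.
have hl := orbit_path_vis_length gp_ (AG _ Ag) (fun k kp => AG _ (pA k kp)).
have eM : expR (- M) = e `^ alpha^-1 / 6 by rewrite /M opprK lnK.
have e1 : expR (- gp o (g o) (ray_to o xi T)) <= e `^ alpha^-1 / 6.
  by rewrite -eM ler_expR lerN2.
have e2 : expR (- gp o (h o) (ray_to o eta T)) <= e `^ alpha^-1 / 6.
  by rewrite -eM ler_expR lerN2.
set Sg := \sum_(k <- g :: p) _ in hl.
have Sg0 : 0 <= Sg by apply: sumr_ge0 => k _; exact: expR_ge0.
have hv' : visual_dist o xi eta <= e `^ alpha^-1 + 3 * expR K * Sg.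
  rewrite -mulrA; lra.
have c0 : 0 <= 3 * expR K by rewrite mulr_ge0 ?expR_ge0.
have c1 : 1 <= 3 * expR K by have := K0; have := expR_ge1Dx K; lra.
apply: (@le_trans _ _ ((e `^ alpha^-1 + 3 * expR K * Sg) `^ alpha)).
  apply: ge0_ler_powR => //; first exact: ltW.
    by rewrite nnegrE visual_dist_ge0.
  by rewrite nnegrE addr_ge0 ?powR_ge0 ?mulr_ge0.
apply: le_trans (powR_subadd _ _ al0 al1) _; [exact: powR_ge0|exact: mulr_ge0|].
rewrite -powRrM mulVf ?gt_eqF // (powRr1 (ltW e0)) addrC lerD2r.
rewrite powRM // ler_pM ?powR_ge0 //; first exact: ler1_powR c1 al1.
apply: le_trans (powR_sum_le _ _ al0 al1) _; first by move=> k; exact: expR_ge0.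
rewrite -lee_fin; apply: le_trans hE.
rewrite (eq_bigr (fun k => expR (- alpha * d o (k o)))); last first.
  by move=> k _; rewrite -expRM mulrC mulrN mulNr.
apply: sum_le_esum => // k.
by rewrite inE => /orP[/eqP ->//|]; exact: pA.
Qed.

End OrbitChains.

Section Diameter.
Context {R : realType} {T : Type}.
Variable (D : T -> T -> R).

Lemma diameter_ge0 (U : set T) : (0 <= diameter D U)%E.
Proof. by apply: ereal_sup_ubound; left. Qed.

Lemma le_diameter (U : set T) x y : U x -> U y -> ((D x y)%:E <= diameter D U)%E.
Proof. by move=> Ux Uy; apply: ereal_sup_ubound; right; exists (x, y). Qed.

Lemma poweR_le_powR (x : \bar R) (b r : R) : 0 <= r -> (0 <= x)%E -> (x <= b%:E)%E ->
  (poweR x r <= (b `^ r)%:E)%E.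
Proof.
move=> r0; case: x => [x| |] //; rewrite !lee_fin => x0 xb.
by rewrite ge0_ler_powR // nnegrE // (le_trans x0).
Qed.

End Diameter.

Lemma finite_set_bounded (R : realType) (T : choiceType) (A : set T) (f : T -> R) :
  finite_set A -> exists2 M : R, 0 <= M & forall x, A x -> f x <= M.
Proof.
move=> /finite_seqP [s ->]; elim: s => [|y s [M M0 hM]]; first by exists 0.
exists (Num.max M (f y)); first by rewrite le_max M0.
move=> x; rewrite /= inE => /orP[/eqP ->|/hM hx]; rewrite le_max ?lexx ?orbT //.
by rewrite hx.
Qed.

Section HausdorffUpper.
Context {R : realType} {X : metricType R}.
Hypotheses (hproper : proper_space X) (hcat : cat_minus_one X).
Variables (o : X) (G : set (X -> X)).
Hypotheses (hG : isometry_group G) (fgG : finitely_generated G).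
Variable alpha : R.
Hypotheses (al0 : 0 < alpha) (al1 : alpha <= 1).
Hypothesis hP : (poincare_series o G alpha < +oo)%E.
Implicit Types (g h : X -> X) (x y : X) (xi eta : boundary X) (A : set (X -> X)).
Local Notation d := (@mdist R X).
Local Notation gp := (@gromov_product R X).

Lemma hausdorff_premeasure_ge0 a eps (Y : set (boundary X)) :
  (0 <= hausdorff_premeasure (visual_dist o) a eps Y)%E.
Proof.
apply/ereal_infP => _ [U _ <-]; apply: nneseries_ge0 => n _ _.
exact: poweR_ge0.
Qed.

(** The ball [F] contains the finite set off which the series is small. Its
    outer boundary is enumerated by [V]; [A j] is the component of the [j]-th
    point, or empty if that component has occurred before, so that the sums over
    the [A j] add up to at most the tail of the series. *)
Lemma limit_set_premeasure eps : 0 < eps ->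
  hausdorff_premeasure (visual_dist o) alpha eps (limit_set o G) = 0%E.
Proof.
move=> eps0; apply/eqP; rewrite eq_le hausdorff_premeasure_ge0 andbT.
apply/lee_addgt0Pr => e e0; rewrite add0e.
have [S [finS SG Sinv Sgen]] := symmetric_generators hG fgG.
have [K K0 SK] := finite_set_bounded (fun s => d o (s o)) finS.
pose C := 3 * expR K.
have C0 : 0 < C by rewrite mulr_gt0 ?expR_gt0.
pose a g := expR (- alpha * d o (g o)).
have a0 g : 0 <= a g := expR_ge0 _.
pose e' := Num.min (e / C) (eps `^ alpha / C).
have e'0 : 0 < e' by rewrite lt_min !divr_gt0 ?powR_gt0.
have [s0 hs0] := esum_tail a0 e'0 hP.
have [M M0 hM] := finite_set_bounded (fun g => d o (g o)) (finite_seq s0).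
pose F := G `&` [set g | d o (g o) <= M].
have finF : finite_set F := poincare_finite_ball M al0 hP.
have Fid : F id by split; [exact: (group_id hG)|rewrite /= mdistxx].
have finV : finite_set [set f \o s | f in F & s in S] by apply: finite_image2.
have [V hV] := (finite_seqP _).1 finV.
pose oc := out_conn G S F.
pose B j := [set g | [/\ G g, ~ F g, (j < size V)%N & oc (nth id V j) g]].
pose A := seqDU B.
have AB j g : A j g -> B j g by move=> [].
have AG j : A j `<=` G by move=> g /AB [].
have Atail j : A j `<=` G `\` [set` s0].
  move=> g /AB [Gg nFg _ _]; split=> // gs; apply: nFg; split=> //.
  exact: hM.
have Aconn j g h : A j g -> A j h -> exists p, [/\ path (cayley S) g p,
    last g p = h, uniq (g :: p) & forall k, k \in p -> A j k].
  move=> Ag Ah; have [_ _ _ cg] := AB _ _ Ag; have [_ _ _ ch] := AB _ _ Ah.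
  have [p pp ph] := out_conn_trans (out_conn_sym Sinv cg) ch.
  case/shortenP: pp ph => q pq uq _ ph; exists q; split => //.
    by apply: sub_path pq => x y /and3P[].
  move=> k kq; have ck := path_out_conn pq kq.
  have [Gg nFg jV _] := AB _ _ Ag.
  have [Gk nFk] := out_conn_mem ck Gg nFg.
  split; first by split=> //; apply: out_conn_trans cg ck.
  rewrite -bigcup_mkord => -[i /= ij [_ _ iV ik]].
  have [_] := Ag; rewrite -bigcup_mkord; apply; exists i => //.
  by split=> //; apply: out_conn_trans ik (out_conn_sym Sinv ck).
pose U j := clusters_at o (A j).
pose E j := \esum_(g in A j) (a g)%:E.
have Efin j : E j \is a fin_num.
  rewrite ge0_fin_numE; last by apply: esum_ge0 => g _; rewrite lee_fin.
  by apply: le_lt_trans hP; exact: esum_subset.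
have Ee j : fine (E j) <= e'.
  rewrite -lee_fin fineK //; apply: le_trans hs0; exact: esum_subset.
have E0 j : 0 <= fine (E j) by apply: fine_ge0; apply: esum_ge0 => g _; rewrite lee_fin.
have diamU j : (diameter (visual_dist o) (U j) <= ((C * fine (E j)) `^ alpha^-1)%:E)%E.
  apply: ub_ereal_sup => _ [->|[[xi eta] [/= Uxi Ueta] <-]].
    by rewrite lee_fin powR_ge0.
  have := cluster_set_diam hproper hcat hG SK K0 (AG j) al0 al1 (Aconn j) _ Uxi Ueta.
  move=> /(_ (fine (E j))) H; rewrite lee_fin.
  have {}H : visual_dist o xi eta `^ alpha <= C * fine (E j) by apply: H; rewrite fineK.
  have v0 := visual_dist_ge0 o xi eta.
  rewrite -[leLHS]powRr1 // -(divff (lt0r_neq0 al0)) powRrM.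
  apply: ge0_ler_powR => //; first by rewrite invr_ge0 ltW.
    by rewrite nnegrE powR_ge0.
  by rewrite nnegrE mulr_ge0 // ltW.
have powU j : (poweR (diameter (visual_dist o) (U j)) alpha <= C%:E * E j)%E.
  apply: le_trans (poweR_le_powR (ltW al0) (diameter_ge0 _ _) (diamU j)) _.
  rewrite -powRrM mulVf ?gt_eqF // powRr1 ?mulr_ge0 // ?(ltW C0) //.
  by rewrite EFinM fineK.
apply: (@le_trans _ _ (\sum_(0 <= j <oo) poweR (diameter (visual_dist o) (U j)) alpha)%E).
  apply: ereal_inf_lbound; exists U => //; split.
  - move=> xi /(limit_setP hproper hcat) lxi; apply: contrapT => nU.
    have ex j : exists Mj : R, forall g t, A j g -> 0 <= t -> gp o (g o) (ray_to o xi t) < Mj.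
      apply: contrapT => h; apply: nU; exists j => // M'.
      apply: contrapT => h'; apply: h; exists M' => g t Ag t0.
      by rewrite ltNge; apply/negP => h''; apply: h'; exists g, t.
    have [Mj hMj] := choice ex.
    have [M' hM'] : exists M' : R, forall j, (j < size V)%N -> Mj j <= M'.
      elim: (size V) => [|n [M' hM']]; first by exists 0.
      exists (Num.max M' (Mj n)) => j; rewrite ltnS leq_eqVlt => /orP[/eqP ->|/hM' hh].
        by rewrite le_max lexx orbT.
      by rewrite le_max hh.
    have [g [t [Gg t0 gt]]] := lxi (Num.max M' (M + 1)).
    have gM' : M' <= gp o (g o) (ray_to o xi t) by apply: le_trans gt; rewrite le_max lexx.
    have gM : M + 1 <= d o (g o).
      by apply: le_trans (gp_le_l _ _ _); apply: le_trans gt; rewrite le_max lexx orbT.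
    have nFg : ~ F g by move=> [_ /=]; lra.
    have [f [s [Ff Ss Gfs nFfs cfs]]] := reach_outer_boundary hG SG Sinv Sgen Fid Gg nFg.
    have fsV : f \o s \in V.
      have : [set f \o s | f in F & s in S] (f \o s) by exists f => //; exists s.
      by rewrite hV.
    have : (\bigcup_j B j) g.
      exists (index (f \o s) V) => //; split=> //; rewrite ?index_mem //.
      by rewrite nth_index.
    rewrite seqDU_bigcup_eq => -[j _ Ag].
    have [_ _ jV _] := AB _ _ Ag.
    by have := hMj j g t Ag t0; have := hM' j jV; lra.
  - move=> j; apply: le_trans (diamU j) _; rewrite lee_fin.
    have -> : eps = (eps `^ alpha) `^ alpha^-1.
      by rewrite -powRrM divff ?gt_eqF // powRr1 // ltW.
    apply: ge0_ler_powR; first by rewrite invr_ge0 ltW.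
    - by rewrite nnegrE mulr_ge0 // ltW.
    - by rewrite nnegrE powR_ge0.
    rewrite mulrC -ler_pdivlMr //; apply: le_trans (Ee j) _.
    by rewrite ge_min lexx orbT.
apply: (@le_trans _ _ (\sum_(0 <= j <oo) (C%:E * E j))%E).
  by apply: lee_nneseries => j *; [exact: poweR_ge0|exact: powU].
rewrite nneseriesZl; last by move=> j _; apply: esum_ge0 => g _; rewrite lee_fin.
rewrite -(nneseries_sum_bigcup (trivIset_seqDU B)); last by move=> g; rewrite lee_fin.
apply: (@le_trans _ _ (C%:E * e'%:E)%E).
  rewrite lee_pmul2l //; apply: le_trans hs0; apply: esum_subset => //.
  by move=> g [j _ /Atail].
rewrite -EFinM lee_fin mulrC -ler_pdivlMr //.
by rewrite ge_min lexx.
Qed.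

Lemma limit_set_hausdorff_measure :
  hausdorff_measure (visual_dist o) alpha (limit_set o G) = 0%E.
Proof.
apply: cvg_lim => //; apply: cvg_near_cst.
near=> eps; apply: limit_set_premeasure; near: eps; exact: nbhs_right_gt.
Unshelve. all: by end_near. Qed.

End HausdorffUpper.

(** * Spheres that avoid the limit set, convergence of orbits *)

Section AvoidedSpheres.
Context {R : realType} {X : metricType R}.
Hypotheses (hproper : proper_space X) (hcat : cat_minus_one X).
Variables (o : X).
Implicit Types (x y : X) (xi eta zeta : boundary X).
Local Notation d := (@mdist R X).
Local Notation gp := (@gromov_product R X).

(** A real function that is Lipschitz for the visual metric maps a set of
    vanishing one-dimensional measure to a Lebesgue null set, which cannot
    contain an interval. *)
Lemma avoided_distance (E : set (boundary X)) xi s (D : R) : 0 <= s -> 0 < D ->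
  hausdorff_premeasure (visual_dist o) 1 1 E = 0%E ->
  exists r, [/\ 0 < r, r < D &
    forall zeta, E zeta -> d (ray_to o xi s) (ray_to o zeta s) <> r].
Proof.
move=> s0 D0 hE; apply: contrapT => hno.
pose f zeta := d (ray_to o xi s) (ray_to o zeta s).
have sub : [set` `]0, D[] `<=` f @` E.
  move=> r; rewrite /= in_itv /= => /andP[r0 rD]; apply: contrapT => nf.
  by apply: hno; exists r; split=> // zeta Ez fz; apply: nf; exists zeta.
have e0 : 0 < D * expR (- s) / 4 by rewrite divr_gt0 // mulr_gt0 ?expR_gt0.
have [_ [U [EU dU] <-] hU] : exists2 y, [set (\sum_(0 <= j <oo)
    poweR (diameter (visual_dist o) (U j)) 1)%E |
    U in [set U : nat -> set (boundary X) | E `<=` \bigcup_j U j /\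
      forall j, (diameter (visual_dist o) (U j) <= 1%:E)%E]] y &
    (y < (D * expR (- s) / 4)%:E)%E.
  by apply: ereal_inf_lt; rewrite -/(hausdorff_premeasure _ _ _ _) hE lte_fin.
pose del j := fine (diameter (visual_dist o) (U j)).
have delE j : diameter (visual_dist o) (U j) = (del j)%:E.
  rewrite fineK // ge0_fin_numE; last exact: diameter_ge0.
  by apply: le_lt_trans (dU j) _; exact: ltry.
have del0 j : 0 <= del j by rewrite -lee_fin -delE diameter_ge0.
have rad0 j : 0 <= expR s * del j by rewrite mulr_ge0 ?expR_ge0.
have ex j : exists zeta, U j !=set0 -> U j zeta.
  have [[z Uz]|n] := pselect (U j !=set0); first by exists z.
  by exists xi.
have [z hz] := choice ex.
pose I j : set R := [set` `[f (z j) - expR s * del j, f (z j) + expR s * del j]].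
have subI : [set` `]0, D[] `<=` \bigcup_j I j.
  move=> r /sub [zeta Ez <-]; have [j _ Uj] := EU _ Ez; exists j => //.
  have Uz : U j (z j) by apply: hz; exists zeta.
  have : visual_dist o (z j) zeta <= del j.
    by rewrite -lee_fin -delE; exact: le_diameter.
  have := ray_to_lipschitz hproper hcat o (z j) zeta s0.
  move=> h1 h2; have {h1} h1 : d (ray_to o (z j) s) (ray_to o zeta s) <= expR s * del j.
    by apply: le_trans h1 _; rewrite ler_pM2l ?expR_gt0.
  have := metric_triangle (ray_to o xi s) (ray_to o (z j) s) (ray_to o zeta s).
  have := metric_triangle (ray_to o xi s) (ray_to o zeta s) (ray_to o (z j) s).
  rewrite [d (ray_to o zeta s) (ray_to o (z j) s)]metric_sym => h3 h4.
  by rewrite /I /= in_itv /= /f; apply/andP; split; lra.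
have : (lebesgue_measure ([set` `]0%R, D[] : set R) <=
    \sum_(0 <= j <oo) lebesgue_measure (I j))%E.
  by apply: measure_sigma_subadditive => // j; exact: measurable_itv.
rewrite lebesgue_measure_itv /= lte_fin D0 oppr0 adde0.
apply/negP; rewrite -ltNge.
have -> : (\sum_(0 <= j <oo) lebesgue_measure (I j) =
    \sum_(0 <= j <oo) ((2 * expR s)%:E * poweR (diameter (visual_dist o) (U j)) 1))%E.
  apply: eq_eseriesr => j _; rewrite poweRe1 ?diameter_ge0 // delE -EFinM.
  rewrite /I (lebesgue_measure_itv (`[_, _] : interval R)) /= lte_fin.
  case: ifPn => [_|]; first by rewrite -EFinB; congr EFin; ring.
  by rewrite -leNgt => h; congr EFin; have := rad0 j; lra.
rewrite nneseriesZl; last by move=> j _; exact: poweR_ge0.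
apply: (@lt_trans _ _ ((2 * expR s)%:E * (D * expR (- s) / 4)%:E)%E).
  by rewrite lte_pmul2l // lte_fin mulr_gt0 ?expR_gt0.
rewrite -EFinM lte_fin; have := expRxMexpNx_1 s.
move: (expR s) (expR (- s)) => a b ab.
rewrite (_ : 2 * a * (D * b / 4) = D / 2 * (a * b)); last by field.
by rewrite ab; lra.
Qed.

Lemma boundary_neq_ray xi eta : xi <> eta ->
  exists2 s, 0 <= s & 0 < d (ray_to o xi s) (ray_to o eta s).
Proof.
move=> /(boundary_neq_gp_bounded hproper hcat o) [M hM].
have M0 : 0 <= Num.max 0 (M + 1) by rewrite le_max lexx.
have MM : M + 1 <= Num.max 0 (M + 1) by rewrite le_max lexx orbT.
exists (Num.max 0 (M + 1)) => //; rewrite mdist_gt0; apply/eqP => e.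
have := hM _ M0; rewrite e gpxx ray_to_dist //; lra.
Qed.

End AvoidedSpheres.

Section Convergence.
Context {R : realType} {X : metricType R}.
Hypotheses (hproper : proper_space X) (hcat : cat_minus_one X).
Variables (o : X) (G : set (X -> X)).
Implicit Types (x y : X) (xi eta zeta : boundary X) (t M C : R).
Local Notation d := (@mdist R X).
Local Notation gp := (@gromov_product R X).

(** Convergence of [x] to the boundary point [xi] along [U]. *)
Definition tends (I : Type) (U : set_system I) (x : I -> X) xi :=
  forall M, exists2 t0, 0 <= t0 &
    forall t, t0 <= t -> U [set i | M <= gp o (x i) (ray_to o xi t)].

(** Products of nearby points are products of the limits up to bounded errors,
    by two applications of [four_point]; similarly for the next lemmas. *)
Lemma tends_gp_le (I : Type) (U : set_system I) (x y : I -> X) xi eta C :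
  Filter U -> tends U x xi -> tends U y eta ->
  (forall t, 0 <= t -> gp o (ray_to o xi t) (ray_to o eta t) <= C) ->
  U [set i | gp o (x i) (y i) <= C + 2].
Proof.
move=> FU hx hy hC.
have [t0 t00 ht0] := hx (C + 2); have [t1 t10 ht1] := hy (C + 3).
have h0 : t0 <= Num.max t0 t1 by rewrite le_max lexx.
have h1 : t1 <= Num.max t0 t1 by rewrite le_max lexx orbT.
have h4 := hC _ (le_trans t00 h0).
pose t := Num.max t0 t1; rewrite -/t in h0 h1 h4.
apply: (@filterS _ U FU _ _ _ (filterI (ht0 _ h0) (ht1 _ h1))) => i /= [h2 h3].
rewrite leNgt; apply/negP => h5.
have := four_point hcat o (ray_to o xi t) (x i) (ray_to o eta t).
have := four_point hcat o (x i) (y i) (ray_to o eta t).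
rewrite gpC in h2; rewrite !lerBlDr !ge_min => /orP[] ? /orP[] ?; lra.
Qed.

Lemma tends_point_le (I : Type) (U : set_system I) (x : I -> X) xi y C :
  Filter U -> tends U x xi -> 
  (forall t, 0 <= t -> gp o y (ray_to o xi t) <= C) ->
  U [set i | gp o y (x i) <= C + 1].
Proof.
move=> FU hx hC; have [t t0 ht] := hx (C + 2).
apply: (@filterS _ U FU _ _ _ (ht t (lexx _))) => i /= h; have := hC t t0.
have := four_point hcat o y (x i) (ray_to o xi t).
by rewrite lerBlDr ge_min => /orP[]; lra.
Qed.

Lemma tends_point_ge (I : Type) (U : set_system I) (x : I -> X) xi y M :
  ProperFilter U -> tends U x xi -> U [set i | M <= gp o y (x i)] ->
  exists2 t0, 0 <= t0 & forall t, t0 <= t -> M - 1 <= gp o y (ray_to o xi t).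
Proof.
move=> FU hx hM; have [t0 t00 ht] := hx M; exists t0 => // t t0t.
have [i /= [h1 h2]] := filter_ex (filterI hM (ht t t0t)).
have := four_point hcat o y (x i) (ray_to o xi t).
by apply: le_trans; rewrite lerB // le_min h1 h2.
Qed.

Lemma tends_gp_ge (I : Type) (U : set_system I) (x y : I -> X) xi M :
  Filter U -> tends U x xi -> tends U y xi -> U [set i | M <= gp o (x i) (y i)].
Proof.
move=> FU hx hy; have [t0 _ ht0] := hx (M + 1); have [t1 _ ht1] := hy (M + 1).
have h0 : t0 <= Num.max t0 t1 by rewrite le_max lexx.
have h1 : t1 <= Num.max t0 t1 by rewrite le_max lexx orbT.
apply: (@filterS _ U FU _ _ _ (filterI (ht0 _ h0) (ht1 _ h1))) => i /= [h2 h3].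
have := four_point hcat o (x i) (ray_to o xi (Num.max t0 t1)) (y i).
rewrite gpC in h3.
by rewrite lerBlDr ge_min => /orP[]; lra.
Qed.

Lemma tends_far (I : Type) (U : set_system I) (x : I -> X) xi M :
  Filter U -> tends U x xi -> U [set i | M <= d o (x i)].
Proof.
move=> FU hx; have [t _ ht] := hx M.
by apply: (@filterS _ U FU _ _ _ (ht t (lexx _))) => i /= h; apply: le_trans h (gp_le_l _ _ _).
Qed.

(** Compactness of the bordification, for the orbit. *)
Lemma orbit_ultralimit (I : Type) (U : set_system I) (g : I -> X -> X) :
  UltraFilter U -> (forall i, G (g i)) -> (forall M, U [set i | M <= d o (g i o)]) ->
  exists2 xi, limit_set o G xi & tends U (fun i => g i o) xi.
Proof.
move=> UU Gg gU.
have [c [rc co hc]] := @segments_ultralimit _ _ hproper hcat I U (fun i => g i o) o UU gU.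
have [xi hxi] := ray_class hproper hcat rc co.
have PU : ProperFilter U by exact: ultra_proper.
have FU : Filter U by exact: filter_filter.
have key : tends U (fun i => g i o) xi.
  move=> M; have := @ultralimit_gp _ _ hcat I U (fun i => g i o) c FU rc.
  rewrite co => /(_ gU hc M) [t t0 ht].
  exists t => // t' tt'; apply: (@filterS _ U FU _ _ _ ht) => i /=; rewrite -(hxi t) // => h.
  apply: le_trans h _; exact: ray_to_gp_mono.
exists xi => //; apply/(limit_setP hproper hcat) => M.
have [t t0 ht] := key M; have [i hi] := filter_ex (ht t (lexx _)).
by exists (g i), t; split.
Qed.

Lemma limit_set_sequence xi : limit_set o G xi ->
  exists g : nat -> X -> X, (forall n, G (g n)) /\
    forall U : set_system nat, Filter U -> eventually `<=` U ->
      tends U (fun n => g n o) xi.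
Proof.
move=> /(limit_setP hproper hcat) lxi.
have ex n : exists g, G g /\ exists2 t, 0 <= t & n%:R <= gp o (g o) (ray_to o xi t).
  by have [g [t [Gg t0 gt]]] := lxi n%:R; exists g; split=> //; exists t.
have [g hg] := choice ex; exists g; split=> [n|U FU sU M]; first by have [] := hg n.
exists (Num.max 0 (M + 2)); first by rewrite le_max lexx.
move=> t ht; have t0 : 0 <= t by apply: le_trans ht; rewrite le_max lexx.
have Mt : M + 2 <= t by apply: le_trans ht; rewrite le_max lexx orbT.
have : U [set n | M + 2 <= n%:R] by apply: sU; exact: (nbhs_infty_ger (M + 2)).
apply: (@filterS _ U FU) => n /= Mn; have [_ [t' t'0 ht']] := hg n.
have [tt'|t't] := leP t' t.
  apply: le_trans (ray_to_gp_mono hproper hcat o (g n o) xi t'0 tt').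
  by apply: le_trans ht'; lra.
have e : gp o (ray_to o xi t') (ray_to o xi t) = t.
  rewrite /gromov_product [d (ray_to o xi t') _]metric_sym.
  rewrite !ray_to_dist // (ray_dist (ray_to_ray hproper hcat o xi) t0 (ltW t't)).
  by field.
have := four_point hcat o (g n o) (ray_to o xi t') (ray_to o xi t).
rewrite e lerBlDr ge_min => /orP[]; lra.
Qed.

End Convergence.

(** * Perfectness of the limit set *)

Section Perfectness.
Context {R : realType} {X : metricType R}.
Hypotheses (hproper : proper_space X) (hcat : cat_minus_one X).
Variables (o : X) (G : set (X -> X)).
Hypothesis hG : isometry_group G.
Implicit Types (x y : X) (xi eta zeta : boundary X) (t M C : R) (g h : X -> X).
Local Notation d := (@mdist R X).
Local Notation gp := (@gromov_product R X).

Lemma group_gp_orbit g h y : G g -> g \o h = id ->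
  gp o (g y) (g o) = d o (g o) - gp o y (h o).
Proof.
move=> Gg gh; rewrite -[in RHS](group_gp hG o y (h o) Gg) -[g (h o)]/((g \o h) o) gh /=.
by rewrite gpC [in RHS]gpC gp_flip.
Qed.

Lemma group_gp_shift g x y : G g -> gp o (g x) (g y) <= gp o x y + d o (g o).
Proof.
by move=> Gg; rewrite -(group_gp hG o x y Gg); exact: gp_lip_base.
Qed.

Lemma gp_near_le y zeta eta C t :
  (forall t, 0 <= t -> gp o (ray_to o zeta t) (ray_to o eta t) <= C) ->
  0 <= t -> C + 2 <= gp o y (ray_to o eta t) ->
  forall s, 0 <= s -> gp o y (ray_to o zeta s) <= C + 1.
Proof.
move=> hC t0 hy s s0.
have sT : s <= Num.max s t by rewrite le_max lexx.
have tT : t <= Num.max s t by rewrite le_max lexx orbT.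
apply: le_trans (ray_to_gp_mono hproper hcat o y zeta s0 sT) _.
have h1 := le_trans hy (ray_to_gp_mono hproper hcat o y eta t0 tT).
have h2 := hC _ (le_trans s0 sT).
have := four_point hcat o (ray_to o zeta (Num.max s t)) y (ray_to o eta (Num.max s t)).
by rewrite [gp o _ y]gpC lerBlDr ge_min => /orP[]; lra.
Qed.

Lemma limit_space_close_gp xi eta (n t : R) : 0 <= n -> n <= t ->
  n + 1 <= gp o (ray_to o xi t) (ray_to o eta t) ->
  d (ray_to o xi n) (ray_to o eta n) < 1.
Proof.
move=> n0 nt h.
have := rays_contract hcat (ray_to_ray hproper hcat o xi)
  (ray_to_ray hproper hcat o eta) _ n0 nt.
rewrite !ray_to0 // => /(_ erefl) /le_lt_trans; apply.
by rewrite expR_lt1; lra.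
Qed.

(** North-south dynamics without a group action on the boundary: pushing a
    sequence that converges to [zeta] by [g] brings its limit close to [g o],
    provided that [zeta] is far from the repelling direction [h o]. *)
Lemma pushed_limit U g h zeta (k : nat -> X -> X) C :
  UltraFilter U -> G g -> g \o h = id -> (forall j, G (k j)) ->
  tends o U (fun j => k j o) zeta ->
  (forall s, 0 <= s -> gp o (h o) (ray_to o zeta s) <= C) ->
  exists xi, [/\ limit_set o G xi, tends o U (fun j => g (k j o)) xi &
    exists2 t0, 0 <= t0 & forall t, t0 <= t ->
      d o (g o) - C - 2 <= gp o (g o) (ray_to o xi t)].
Proof.
move=> UU Gg gh Gk hk hC.
have PU : ProperFilter U by exact: ultra_proper.
have FU : Filter U by exact: filter_filter.
have [j||xi lxi txi] :=
  @orbit_ultralimit _ _ hproper hcat o G nat U (fun j => g \o k j) UU.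
- exact: (group_comp hG).
- move=> M; apply: (@filterS _ U FU _ _ _ (tends_far (M + d o (g o)) FU hk)) => j /=.
  have := metric_triangle (g o) o (g (k j o)).
  by rewrite (group_mdist hG) // [d (g o) o]metric_sym; lra.
exists xi; split=> //.
have near : U [set j | d o (g o) - (C + 1) <= gp o (g o) (g (k j o))].
  apply: (@filterS _ U FU _ _ _ (tends_point_le hcat FU hk hC)) => j /=.
  by rewrite [gp o (g o) _]gpC (group_gp_orbit _ Gg gh) gpC; lra.
have [t0 t00 ht] := tends_point_ge hcat PU txi near.
by exists t0 => // t /ht; lra.
Qed.

Hypothesis three : exists a b c, [/\ limit_set o G a, limit_set o G b,
  limit_set o G c & [/\ a <> b, b <> c & a <> c]].

Lemma two_limit_points eta : exists zeta1 zeta2,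
  [/\ limit_set o G zeta1, limit_set o G zeta2, zeta1 <> eta, zeta2 <> eta &
      zeta1 <> zeta2].
Proof.
have [a [b [c [la lb lc [ab bc ac]]]]] := three.
have [ae|ae] := pselect (a = eta).
  by exists b, c; split=> //; rewrite -ae => /esym.
have [be|be] := pselect (b = eta).
  by exists a, c; split=> //; rewrite -be => /esym.
by exists a, b.
Qed.

(** If [g i o] converges to [xi] and the points [h i o] of the inverses converge
    to [eta], then [g i] pushes any two limit points other than [eta] to two
    different limit points near [xi], one of which is not [xi]. *)
Lemma limit_set_perfect xi : limit_set o G xi -> forall n : nat, exists eta,
  [/\ limit_set o G eta, eta <> xi &
      d (ray_to o eta n%:R) (ray_to o xi n%:R) < 1].
Proof.
move=> lxi n.
have [U [UU sU]] := ultraFilterLemma (@eventually_filter).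
have PU : ProperFilter U by exact: ultra_proper.
have FU : Filter U by exact: filter_filter.
have [g [Gg /(_ U FU sU) tg]] := limit_set_sequence hproper hcat lxi.
have [h hh] := choice (fun i => group_inv hG (Gg i)).
have far M : U [set i | M <= d o (g i o)] := tends_far M FU tg.
have [i||eta leta teta] := @orbit_ultralimit _ _ hproper hcat o G nat U h UU.
- by have [] := hh i.
- move=> M; apply: (@filterS _ U FU _ _ _ (far M)) => i /=.
  by have [Gh gh _] := hh i; rewrite (mdist_inv o hG (Gg i) gh).
have [z1 [z2 [l1 l2 n1 n2 n12]]] := two_limit_points eta.
have [C1 hC1] := boundary_neq_gp_bounded hproper hcat o n1.
have [C2 hC2] := boundary_neq_gp_bounded hproper hcat o n2.
have [C3 hC3] := boundary_neq_gp_bounded hproper hcat o n12.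
pose C := Num.max 0 (Num.max C1 C2).
have C1C : C1 <= C by rewrite !le_max lexx orbT.
have C2C : C2 <= C by rewrite !le_max lexx !orbT.
have [k1 [G1 /(_ U FU sU) t1]] := limit_set_sequence hproper hcat l1.
have [k2 [G2 /(_ U FU sU) t2]] := limit_set_sequence hproper hcat l2.
have [t_eta te0 hte] := teta (C + 2).
have [t_xi tx0 htx] := tg (n%:R + 2).
have [m /= [[m1 m2] m3]] := filter_ex (filterI (filterI (hte _ (lexx _)) (htx _ (lexx _)))
  (far (n%:R + 2 + C + 3))).
have [Ghm gh hg] := hh m.
have c1 : forall s, 0 <= s -> gp o (h m o) (ray_to o z1 s) <= C + 1.
  by apply: gp_near_le te0 m1 => t t0; apply: le_trans (hC1 t t0) C1C.
have c2 : forall s, 0 <= s -> gp o (h m o) (ray_to o z2 s) <= C + 1.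
  by apply: gp_near_le te0 m1 => t t0; apply: le_trans (hC2 t t0) C2C.
have [x1 [lx1 tx1 hx1]] := pushed_limit UU (Gg m) gh G1 t1 c1.
have [x2 [lx2 tx2 hx2]] := pushed_limit UU (Gg m) gh G2 t2 c2.
have close (x : boundary X) : (exists2 t0, 0 <= t0 & forall t, t0 <= t ->
      d o (g m o) - (C + 1) - 2 <= gp o (g m o) (ray_to o x t)) ->
    d (ray_to o x n%:R) (ray_to o xi n%:R) < 1.
  move=> [t0 t00 ht].
  pose t := Num.max t0 (Num.max t_xi n%:R).
  have h0 : t0 <= t by rewrite le_max lexx.
  have h1 : t_xi <= t by rewrite !le_max lexx orbT.
  have h2 : n%:R <= t by rewrite !le_max lexx !orbT.
  apply: (limit_space_close_gp (ler0n R n) h2).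
  have a1 := ht _ h0.
  have a2 := le_trans m2 (ray_to_gp_mono hproper hcat o (g m o) xi tx0 h1).
  have := four_point hcat o (ray_to o x t) (g m o) (ray_to o xi t).
  by rewrite [gp o _ (g m o)]gpC lerBlDr ge_min => /orP[]; lra.
have [e1|e1] := pselect (x1 = xi); last by exists x1; split=> //; exact: close.
exists x2; split=> //; last exact: close.
move=> e2; rewrite e1 in tx1; rewrite e2 in tx2.
have A := tends_gp_ge hcat (d o (g m o) + C3 + 3) FU tx1 tx2.
have B := tends_gp_le hcat FU t1 t2 hC3.
have [j /= [j1 j2]] := filter_ex (filterI A B).
by have := group_gp_shift (k1 j o) (k2 j o) (Gg m); lra.
Qed.

End Perfectness.

(** * Broken geodesics and Busemann functions *)

Section LocalToGlobal.
Context {R : realType} {X : metricType R}.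
Hypothesis hcat : cat_minus_one X.
Implicit Types (p : nat -> X) (C L : R).
Local Notation d := (@mdist R X).
Local Notation gp := (@gromov_product R X).

(** A broken geodesic with long pieces and angles bounded away from zero. *)
Definition local_quasigeodesic C L (n : nat) p :=
  (forall i, (i < n)%N -> L <= d (p i) (p i.+1)) /\
  (forall i, (i.+1 < n)%N -> gp (p i.+1) (p i) (p i.+2) <= C).

(** The angle at [p k] between the start and the next point stays bounded: the
    start and [p (k - 1)] are seen from [p k] in the same direction. *)
Lemma local_quasigeodesic_step C L n p k : local_quasigeodesic C L n p ->
  0 <= C -> 2 * C + 4 <= L -> (k < n)%N -> gp (p k) (p 0%N) (p k.+1) <= C + 1.
Proof.
move=> [hL hC] C0 CL; elim: k => [_|k IH kn].
  by apply: le_trans (gp_le_l _ _ _) _; rewrite mdistxx; lra.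
have := IH (ltn_trans (ltnSn k) kn); have := hC k kn; have := hL k (ltn_trans (ltnSn k) kn).
have := four_point hcat (p k.+1) (p k) (p 0%N) (p k.+2).
have := gp_flip (p k.+1) (p k) (p 0%N).
rewrite [d (p k.+1) (p k)]metric_sym [gp (p k) (p k.+1) (p 0%N)]gpC.
by rewrite lerBlDr ge_min => ? /orP[] *; lra.
Qed.

Lemma local_quasigeodesic_rev C L n p : local_quasigeodesic C L n p ->
  local_quasigeodesic C L n (fun i => p (n - i)%N).
Proof.
move=> [hL hC]; split=> i ni.
  have -> : (n - i = (n - i.+1).+1)%N by lia.
  by rewrite metric_sym; apply: hL; lia.
have -> : (n - i.+1 = (n - i.+2).+1)%N by lia.
have -> : (n - i = (n - i.+2).+2)%N by lia.
by rewrite gpC; apply: hC; lia.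
Qed.

(** The angle at [p k] between the start and the end, by applying the previous
    lemma in both directions. *)
Lemma local_quasigeodesic_product C L n p k m : local_quasigeodesic C L n p ->
  0 <= C -> 2 * C + 4 <= L -> (k <= m)%N -> (m <= n)%N ->
  gp (p k) (p 0%N) (p m) <= C + 2.
Proof.
move=> hp C0 CL km mn.
have hm : local_quasigeodesic C L m p.
  by case: hp => h1 h2; split=> i im; [apply: h1|apply: h2]; exact: leq_trans im mn.
move: km; rewrite leq_eqVlt => /orP[/eqP ->|km].
  by apply: le_trans (gp_le_r _ _ _) _; rewrite mdistxx; lra.
case: k km => [|k] km.
  by apply: le_trans (gp_le_l _ _ _) _; rewrite mdistxx; lra.
have := local_quasigeodesic_step (local_quasigeodesic_rev hm) C0 CL
  (ltac:(lia) : (m - k.+1 < m)%N).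
rewrite subn0 subKn; last exact: ltnW.
have -> : (m - (m - k.+1).+1 = k)%N by lia.
have := local_quasigeodesic_step hm C0 CL (ltn_trans (ltnSn k) km).
have := hm.1 k (ltn_trans (ltnSn k) km).
have := gp_flip (p k.+1) (p k) (p 0%N).
have := four_point hcat (p k.+1) (p k) (p 0%N) (p m).
rewrite [d (p k.+1) (p k)]metric_sym [gp (p k) (p k.+1) (p 0%N)]gpC.
rewrite [gp (p k.+1) (p m) (p k)]gpC.
by rewrite lerBlDr ge_min => /orP[] *; lra.
Qed.

Lemma local_quasigeodesic_growth C L n p k : local_quasigeodesic C L n p ->
  0 <= C -> 2 * C + 4 <= L -> (k < n)%N ->
  d (p 0%N) (p k) + (L - 2 * C - 2) <= d (p 0%N) (p k.+1).
Proof.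
move=> hp C0 CL kn; have := local_quasigeodesic_step hp C0 CL kn.
have := hp.1 k kn; rewrite /gromov_product [d (p k) (p 0%N)]metric_sym.
by rewrite ler_pdivrMr //; lra.
Qed.

Lemma local_quasigeodesic_far C L n p k : local_quasigeodesic C L n p ->
  0 <= C -> 2 * C + 4 <= L -> (k <= n)%N -> k%:R <= d (p 0%N) (p k).
Proof.
move=> hp C0 CL; elim: k => [_|k IH kn]; first by exact: mdist_ge0.
have := local_quasigeodesic_growth hp C0 CL kn; have := IH (ltnW kn).
by rewrite -natr1; lra.
Qed.

Lemma local_quasigeodesic_fellow C L n p k m : local_quasigeodesic C L n p ->
  0 <= C -> 2 * C + 4 <= L -> (k <= m)%N -> (m <= n)%N ->
  d (p 0%N) (p k) - (C + 2) <= gp (p 0%N) (p k) (p m).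
Proof.
move=> hp C0 CL km mn; have := local_quasigeodesic_product hp C0 CL km mn.
by rewrite [gp (p 0%N) _ _]gp_flip; lra.
Qed.

End LocalToGlobal.

Section Busemann.
Context {R : realType} {X : metricType R}.
Hypotheses (hproper : proper_space X) (hcat : cat_minus_one X).
Implicit Types (x y : X) (s t T : R) (c : R -> X) (k : X -> X).
Local Notation d := (@mdist R X).
Local Notation gp := (@gromov_product R X).

(** The map [t |-> d (x, c t) - t] is nonincreasing, so this infimum is the usual
    limit. *)
Definition busemann c x : R := inf [set d x (c t) - t | t in [set t | 0 <= t]].

Variable c : R -> X.
Hypothesis rc : geodesic_ray c.
Local Notation o := (c 0).
Local Notation b := (busemann c).

Lemma busemann_mono x s t : 0 <= s -> s <= t -> d x (c t) - t <= d x (c s) - s.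
Proof.
by move=> s0 st; have := metric_triangle x (c s) (c t); rewrite (ray_dist rc s0 st); lra.
Qed.

Lemma busemann_lower x t : 0 <= t -> - d o x <= d x (c t) - t.
Proof.
by move=> t0; have := metric_triangle o x (c t); rewrite (ray_dist0 rc t0); lra.
Qed.

Lemma busemann_has_inf x : has_inf [set d x (c t) - t | t in [set t | 0 <= t]].
Proof.
split; first by exists (d x (c 0) - 0); exists 0 => /=.
by exists (- d o x) => _ [t t0 <-]; exact: busemann_lower.
Qed.

Lemma busemann_le x t : 0 <= t -> b x <= d x (c t) - t.
Proof. by move=> t0; apply: (ge_inf (busemann_has_inf x).2); exists t. Qed.

Lemma busemann_ge x C : (forall t, 0 <= t -> C <= d x (c t) - t) -> C <= b x.
Proof.
move=> h; apply: lb_le_inf; first exact: (busemann_has_inf x).1.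
by move=> _ [t t0 <-]; exact: h.
Qed.

Lemma busemann_near x : exists2 T0, 0 <= T0 &
  forall T, T0 <= T -> d x (c T) - T <= b x + 1.
Proof.
have [_ [t /= t0 <-] ht] := inf_adherent ltr01 (busemann_has_inf x).
exists t => // T tT; apply: ltW; apply: le_lt_trans ht.
exact: busemann_mono.
Qed.

Lemma busemann_abs x : - d o x <= b x <= d o x.
Proof.
apply/andP; split; first by apply: busemann_ge => t; exact: busemann_lower.
by apply: le_trans (busemann_le x (lexx 0)) _; rewrite subr0 metric_sym.
Qed.

Lemma busemann_origin : -1 <= b o <= 0.
Proof.
have := busemann_abs o; rewrite mdistxx oppr0; lra.
Qed.

Lemma busemann_ray t : 0 <= t -> b (c t) <= - t.
Proof. by move=> t0; have := busemann_le (c t) t0; rewrite mdistxx; lra. Qed.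

Lemma busemann_gp x C : (forall t, 0 <= t -> gp o x (c t) <= C) -> d o x - 2 * C <= b x.
Proof.
move=> h; apply: busemann_ge => t t0; have := h t t0.
by rewrite /gromov_product (ray_dist0 rc t0); lra.
Qed.

(** The product of [x] with remote points of the ray tends to
    [(d o x - b x) / 2], and up to this height the segment to [x] follows the ray. *)
Lemma busemann_near_ray x : exists s, [/\ 0 <= s, (d o x - b x - 1) / 2 <= s,
  s <= (d o x - b x) / 2, d x (c s) <= (d o x + b x + 1) / 2 + 1 &
  forall T0, exists2 T, T0 <= T & s <= gp o x (c T)].
Proof.
have [T T0 hT] := busemann_near x; have h1 := hT T (lexx _).
have h2 := busemann_le x T0.
pose s := gp o x (c T).
have sE : s = (d o x + T - d x (c T)) / 2 by rewrite /s /gromov_product (ray_dist0 rc T0).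
have s0 : 0 <= s := gp_ge0 _ _ _.
have sT : s <= T by have := gp_le_r o x (c T); rewrite (ray_dist0 rc T0).
have sx : s <= d o x := gp_le_l _ _ _.
exists s; split; rewrite ?s0 //; rewrite ?sE; try lra.
  have := ray_segment_contract hcat rc s0 sT sx; rewrite -/s subrr expR0.
  have [_ h3] := segment_dist (segment_toP hcat o x) s0 sx.
  have := metric_triangle x (segment_to o x s) (c s).
  rewrite -sE [d x (segment_to o x s)]metric_sym h3; lra.
move=> T1; exists (Num.max T T1); first by rewrite le_max lexx orbT.
by rewrite -sE; apply: ray_gp_mono => //; rewrite le_max lexx.
Qed.

Definition fixes_end k := exists K, forall t, 0 <= t -> d (k (c t)) (c t) <= K.

Lemma gp_far_eq w x y z : d w x + 2 <= gp w y z -> gp w x y <= gp w x z + 1.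
Proof.
move=> h; have := four_point hcat w x y z; have := gp_le_l w x z.
by rewrite lerBlDr ge_min => ? /orP[]; have := gp_le_l w x y; lra.
Qed.

(** The differences of Busemann values are determined by the end of the ray up to
    bounded errors, so an isometry that fixes the end acts on them by a
    translation. *)
Lemma busemann_quasi_invariant k x y : Defs.isometry k -> fixes_end k ->
  `|b (k x) - b (k y) - (b x - b y)| <= 4.
Proof.
move=> ik [K hK].
have [T1 T10 h1] := busemann_near x; have [T2 T20 h2] := busemann_near y.
have [T3 T30 h3] := busemann_near (k x); have [T4 T40 h4] := busemann_near (k y).
pose T5 := d (k x) (k y) + 2 + d o (k y) + `|K|.
pose T := Num.max (Num.max T1 T2) (Num.max (Num.max T3 T4) T5).
have l1 : T1 <= T by rewrite !le_max lexx.
have l2 : T2 <= T by rewrite !le_max lexx !orbT.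
have l3 : T3 <= T by rewrite !le_max lexx !orbT.
have l4 : T4 <= T by rewrite !le_max lexx !orbT.
have l5 : T5 <= T by rewrite !le_max lexx !orbT.
have T0 := le_trans T10 l1.
have {}h1 := h1 T l1; have {}h2 := h2 T l2; have {}h3 := h3 T l3; have {}h4 := h4 T l4.
have h1' := busemann_le x T0; have h2' := busemann_le y T0.
have h3' := busemann_le (k x) T0; have h4' := busemann_le (k y) T0.
have far : d (k y) (k x) + 2 <= gp (k y) (c T) (k (c T)).
  have := gp_ge (k y) (c T) (k (c T)); have := hK T T0; have := ler_norm K.
  have := metric_triangle o (k y) (c T); rewrite (ray_dist0 rc T0).
  rewrite [d (c T) _]metric_sym [d (k y) (k x)]metric_sym.
  by move: l5; rewrite /T5; lra.
have a1 := gp_far_eq far; rewrite [gp _ (c T) _]gpC in far.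
have a2 := gp_far_eq far.
have e : gp (k y) (k x) (k (c T)) = gp y x (c T) by exact: gp_isometry.
rewrite e in a1 a2.
move: a1 a2; rewrite /gromov_product ik.1 => a1 a2.
by rewrite ler_norml; apply/andP; split; lra.
Qed.

(** Far out on the ray, an isometry that fixes its end translates along the ray,
    by an amount that can be read off from the Busemann function. *)
Lemma fixes_end_displacement k B : Defs.isometry k -> fixes_end k -> 
  `|b (k o)| <= B -> exists2 t0, 0 <= t0 &
  forall t, t0 <= t -> d (k (c t)) (c t) <= B + 16.
Proof.
move=> ik fk hB; have [K hK] := fk.
exists (2 * d o (k o) + 3); first by have := mdist_ge0 o (k o); lra.
move=> t ht; have ko := mdist_ge0 o (k o); have t0 : 0 <= t by lra.
set y := k (c t).
have yko : d y (k o) = t by rewrite /y ik.1 metric_sym (ray_dist0 rc t0).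
have yo : t - d o (k o) <= d o y.
  by have := metric_triangle (k o) o y; rewrite [d (k o) y]metric_sym yko [d (k o) o]metric_sym; lra.
(* the ray [k o c] passes through [y], and its end is the end of [c] *)
pose T := t + d o y + `|K| + 4.
have yp := mdist_ge0 o y; have Kp := normr_ge0 K; have Kl := ler_norm K.
have tT : t <= T by rewrite /T; lra.
have T0 : 0 <= T by lra.
have z : gp y (k o) (k (c T)) = 0.
  rewrite /y gp_isometry // /gromov_product [d (c t) o]metric_sym.
  by rewrite !(ray_dist0 rc) // (ray_dist rc t0 tT); field.
have w : 3 <= gp y (c T) (k (c T)).
  have := gp_ge y (c T) (k (c T)); have := hK T T0.
  have := metric_triangle o y (c T); rewrite (ray_dist0 rc T0) [d (c T) _]metric_sym.
  by rewrite /T; lra.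
have w1 : gp y (k o) (c T) <= 1.
  have := four_point hcat y (k o) (c T) (k (c T)).
  by rewrite z lerBlDr ge_min => /orP[]; lra.
have w2 : gp y o (c T) <= 2.
  have g := gp_ge y (k o) o; rewrite yko [d (k o) o]metric_sym in g.
  have := four_point hcat y (k o) o (c T).
  by rewrite lerBlDr ge_min => /orP[]; lra.
have by1 : b y <= - d o y + 4.
  have := busemann_le y T0; move: w2.
  by rewrite /gromov_product [d y o]metric_sym (ray_dist0 rc T0); lra.
have [s [s0 s1 s2 s3 _]] := busemann_near_ray y.
have /andP[by2 _] := busemann_abs y.
have := busemann_quasi_invariant o (c t) ik fk; rewrite -/y.
have /andP[bo1 bo2] := busemann_origin; have c1 := busemann_ray t0.
have /andP[c2 _] := busemann_abs (c t); rewrite (ray_dist0 rc t0) in c2.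
move: hB; rewrite !ler_norml => /andP[B1 B2] /andP[q1 q2].
have := metric_triangle y (c s) (c t).
have : d (c s) (c t) <= B + 11.
  rewrite (rc s0 t0) ler_norml; apply/andP; split; lra.
lra.
Qed.

End Busemann.

(** * No fixed point at infinity *)

Section NoFixedEnd.
Context {R : realType} {X : metricType R}.
Hypotheses (hproper : proper_space X) (hcat : cat_minus_one X).
Variables (o : X) (G : set (X -> X)).
Hypothesis hG : isometry_group G.
Hypothesis finG : forall M, finite_set (G `&` [set g | mdist o (g o) <= M]).
Implicit Types (x y : X) (xi eta zeta : boundary X) (s t T M C : R) (g h k : X -> X).
Local Notation d := (@mdist R X).
Local Notation gp := (@gromov_product R X).

Section FixedEnd.
Variable xi : boundary X.
Local Notation c := (ray_to o xi).
Local Notation b := (busemann c).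
Hypothesis fixG : forall k, G k -> fixes_end c k.

Let rc : geodesic_ray c. Proof. exact: ray_to_ray. Qed.
Let co : c 0 = o. Proof. exact: ray_to0. Qed.

Lemma fixed_busemann k x y : G k -> `|b (k x) - b (k y) - (b x - b y)| <= 4.
Proof.
move=> Gk; apply: busemann_quasi_invariant => //; last exact: fixG.
exact: (group_isometry hG).
Qed.

Lemma fixed_busemann_origin : -1 <= b o <= 0.
Proof. by have := busemann_origin rc; rewrite co. Qed.

(** Elements of the orbit that converge to another limit point run away from
    [xi] at full speed, so their inverses follow the ray of [xi]. *)
Lemma escaping_busemann zeta : zeta <> xi -> limit_set o G zeta ->
  exists2 C, 0 <= C & forall M, exists g, [/\ G g, M <= d o (g o),
    d o (g o) - C <= b (g o) & exists2 t, 0 <= t & M <= gp o (g o) (ray_to o zeta t)].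
Proof.
move=> ne /(limit_setP hproper hcat) lz.
have [C hC] := boundary_neq_gp_bounded hproper hcat o ne.
pose C' := 2 * (`|C| + 1).
have Cp := normr_ge0 C; have Cl := ler_norm C.
exists C'; first by rewrite /C'; lra.
move=> M; have [g [t [Gg t0 ht]]] := lz (Num.max M (`|C| + 2)).
have h1 : M <= gp o (g o) (ray_to o zeta t) by apply: le_trans ht; rewrite le_max lexx.
have h2 : `|C| + 2 <= gp o (g o) (ray_to o zeta t).
  by apply: le_trans ht; rewrite le_max lexx orbT.
exists g; split=> //; last by exists t.
  by apply: le_trans h1 (gp_le_l _ _ _).
have near : forall s, 0 <= s -> gp o (g o) (c s) <= `|C| + 1.
  apply: (gp_near_le hproper hcat) t0 h2 => s s0; rewrite gpC.
  exact: le_trans (hC s s0) Cl.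
by have := busemann_gp rc (x := g o) (C := `|C| + 1); rewrite co => /(_ near).
Qed.

Lemma inverse_busemann g h : G g -> G h -> g \o h = id -> h \o g = id ->
  b (h o) <= - b (g o) + 4.
Proof.
move=> Gg Gh gh hg; have := fixed_busemann (g o) o Gh.
rewrite -[h (g o)]/((h \o g) o) hg /= ler_norml => /andP[].
have /andP[] := fixed_busemann_origin; lra.
Qed.

(** Conjugating by an element that comes close to a remote point of the ray
    turns elements of bounded Busemann value into elements of bounded
    displacement; there are finitely many of these. *)
Lemma busemann_level_finite zeta B : zeta <> xi -> limit_set o G zeta ->
  finite_set (G `&` [set g | `|b (g o)| <= B]).
Proof.
move=> ne lz; have [C C0 hC] := escaping_busemann ne lz.
pose L := B + 16 + 2 * (C + 10).
have /finite_seqP [q hq] := finG L.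
apply: contrapT => inf.
have [F FA Fn] := infinite_set_fset (size q).+1 inf.
have [T [T0 hT]] : exists T, 0 <= T /\ forall g, g \in (F : seq (X -> X)) ->
    forall t, T <= t -> d (g (c t)) (c t) <= B + 16.
  have : forall g, g \in (F : seq (X -> X)) -> G g /\ `|b (g o)| <= B.
    by move=> g gF; exact: (FA g gF).
  elim: (F : seq _) => [|g s IH] hs; first by exists 0; split=> // g; rewrite in_nil.
  have [g1 g2] := hs g (mem_head _ _).
  have [T1 [T10 h1]] := IH (fun k ks => hs k (@mem_behead _ (g :: s) k ks)).
  have := @fixes_end_displacement _ _ hcat _ rc g B (group_isometry hG g1) (fixG g1).
  rewrite co => /(_ g2) [T2 T20 h2].
  have m1 : T1 <= Num.max T1 T2 by rewrite le_max lexx.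
  have m2 : T2 <= Num.max T1 T2 by rewrite le_max lexx orbT.
  exists (Num.max T1 T2); split; first exact: le_trans T10 m1.
  move=> k; rewrite inE => /orP[/eqP ->|ks] t ht; first by apply: h2; exact: le_trans m2 ht.
  by apply: (h1 k ks); exact: le_trans m1 ht.
have [h [Gh hM hb _]] := hC (T + C + 6).
have [u [Gu hu uh]] := group_inv hG Gh.
have ub := inverse_busemann Gh Gu hu uh.
have ul := mdist_inv o hG Gh hu.
have [s [s0 s1 s2 s3 _]] := busemann_near_ray hcat rc (u o).
rewrite co ul in s1 s2 s3.
have sT : T <= s by lra.
have us : d (u o) (c s) <= C + 10 by lra.
pose conj g := h \o g \o u.
have conj_inj : injective conj.
  move=> g1 g2 e; apply/funext => x.
  have := congr1 (fun f => u (f (h x))) e; rewrite /conj /=.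
  rewrite -[u (h x)]/((u \o h) x) uh /=.
  by rewrite -[u (h _)]/((u \o h) _) uh -[u (h (g2 x))]/((u \o h) _) uh.
have sub : {subset [seq conj g | g <- F] <= q}.
  move=> _ /mapP [g gF ->].
  have [Gg gB] : G g /\ `|b (g o)| <= B by have := FA g gF.
  suff : (G `&` [set g | d o (g o) <= L]) (conj g) by rewrite hq.
  split; first by apply: (group_comp hG) => //; exact: (group_comp hG).
  rewrite /= /conj /=.
  have -> : o = h (u o) by rewrite -[RHS]/((h \o u) o) hu.
  rewrite -[u (h (u o))]/((u \o h) (u o)) uh /= (group_mdist hG) //.
  have gs := hT g gF s sT.
  have := metric_triangle (u o) (c s) (g (u o)); have := metric_triangle (c s) (g (c s)) (g (u o)).
  rewrite (group_mdist hG _ _ Gg) [d (c s) (g (c s))]metric_sym [d (c s) (u o)]metric_sym /L.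
  lra.
have := uniq_leq_size (_ : uniq [seq conj g | g <- F]) sub.
rewrite size_map (map_inj_uniq conj_inj) fset_uniq => /(_ isT).
by rewrite leqNgt Fn.
Qed.

End FixedEnd.

Hypothesis three : exists a b c, [/\ limit_set o G a, limit_set o G b,
  limit_set o G c & [/\ a <> b, b <> c & a <> c]].

(** A discrete group that fixes a boundary point has at most one other limit
    point: if [h] moves away from the fixed point then the elements that do not
    approach it stay at bounded distance from the powers of [h], since the
    Busemann function is, up to bounded errors, a homomorphism with finite fibres. *)
Lemma no_fixed_end xi : exists2 k, G k & ~ fixes_end (ray_to o xi) k.
Proof.
apply: contrapT => hno.
have fixG k : G k -> fixes_end (ray_to o xi) k.
  by move=> Gk; apply: contrapT => nf; apply: hno; exists k.
pose c := ray_to o xi; pose b := busemann c.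
have rc : geodesic_ray c by exact: ray_to_ray.
have co : c 0 = o by exact: ray_to0.
have [z1 [z2 [l1 l2 n1 n2 n12]]] := two_limit_points three xi.
have [C1 C10 h1] := escaping_busemann n1 l1.
have [C2 C20 h2] := escaping_busemann n2 l2.
have [C3 hC3] := boundary_neq_gp_bounded hproper hcat o n12.
have /andP[bo1 bo2] := fixed_busemann_origin xi; rewrite -/c -/b in bo1 bo2.
have [h [Gh hl hb _]] := h1 (5 * C1 + 30).
rewrite -/c -/b in hb.
have [u [Gu hu uh]] := group_inv hG Gh.
have ub := inverse_busemann fixG Gh Gu hu uh; rewrite -/c -/b in ub.
have ul := mdist_inv o hG Gh hu.
(* the axis of [h]: its two half-orbits start in different directions *)
pose CA := (C1 + 10).
have angle : gp o (u o) (h o) <= CA.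
  have [s [s0 s1 s2 s3 /(_ 0) [T T0 sT]]] := busemann_near_ray hcat rc (u o).
  rewrite co ul in s1 sT; rewrite -/b in s1.
  have hT : gp o (h o) (c T) <= (C1 + 1) / 2.
    have := busemann_le rc (h o) T0; rewrite -/b.
    rewrite /gromov_product (ray_to_dist hproper hcat o xi T0) => ?; lra.
  have := four_point hcat o (h o) (u o) (c T).
  by rewrite [gp o (h o) (u o)]gpC lerBlDr ge_min /CA => /orP[]; lra.
have GI n : G (iter n h).
  elim: n => [|n IH]; first exact: (group_id hG).
  by have := group_comp hG Gh IH.
pose p n := iter n h o.
have pS n : p n.+1 = iter n h (h o) by rewrite /p iterSr.
have qg n : local_quasigeodesic CA (d o (h o)) n p.
  split=> i _; first by rewrite pS /p (group_mdist hG).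
  have e0 : p i = iter i.+1 h (u o).
    by rewrite iterSr -[h (u o)]/((h \o u) o) hu.
  have e2 : p i.+2 = iter i.+1 h (h o) by rewrite pS.
  by rewrite e0 e2 (group_gp hG).
have CA0 : 0 <= CA by rewrite /CA; lra.
have CAL : 2 * CA + 4 <= d o (h o) by rewrite /CA; lra.
have /andP[_ bh] := busemann_abs rc (h o); rewrite -/b co in bh.
have stepb n : b (p n) + 1 <= b (p n.+1) <= b (p n) + d o (h o) + 5.
  have := fixed_busemann fixG (h o) o (GI n); rewrite -pS -/(p n) -/c -/b.
  by rewrite ler_norml => /andP[? ?]; apply/andP; split; lra.
have bgrow n : n%:R - 1 <= b (p n).
  elim: n => [|n IH]; first by rewrite /p /=; lra.
  by have /andP[? _] := stepb n; rewrite -natr1; lra.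
(* the powers of [h] are cobounded in the half of the group that leaves [xi] *)
have [D hD] : exists D, forall g, G g -> 0 <= b (g o) -> exists n, d (g o) (p n) <= D.
  have fin := busemann_level_finite fixG (d o (h o) + 10) n1 l1.
  have [D D0 hD] := finite_set_bounded (fun g => d o (g o)) fin.
  exists D => g Gg bg.
  have exn : exists n, b (g o) < b (p n).
    have [n hn] := nat_above (b (g o) + 2); exists n.
    by have := bgrow n; lra.
  case: (ex_minnP exn) => -[|n] hn hmin.
    by exfalso; have : b (p 0%N) <= 0 := bo2; lra.
  have {}hmin : b (p n) <= b (g o).
    by rewrite leNgt; apply/negP => /hmin; rewrite ltnn.
  have /andP[_ sb] := stepb n.
  exists n; have [v [Gv hv vh]] := group_inv hG (GI n).
  pose w := v \o g.
  have Gw : G w by exact: (group_comp hG).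
  have wg : iter n h (w o) = g o by rewrite -[LHS]/((iter n h \o v) (g o)) hv.
  rewrite -wg /p (group_mdist hG) // metric_sym; apply: hD; split=> //=.
  have := fixed_busemann fixG (w o) o (GI n); rewrite wg -/(p n) -/c -/b.
  by rewrite !ler_norml => /andP[? ?]; apply/andP; split; lra.
pose M := 3 * `|D| + CA + `|C3| + C1 + C2 + 20.
have Dl := ler_norm D; have Dp := normr_ge0 D.
have C3l := ler_norm C3; have C3p := normr_ge0 C3.
have [g1 [Gg1 m1 b1 [t1 t10 gt1]]] := h1 M; have [g2 [Gg2 m2 b2 [t2 t20 gt2]]] := h2 M.
have [i1 hi1] := hD g1 Gg1 (ltac:(rewrite -/c -/b in b1 *; rewrite /M in m1; lra)).
have [i2 hi2] := hD g2 Gg2 (ltac:(rewrite -/c -/b in b2 *; rewrite /M in m2; lra)).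
have far : gp o (g1 o) (g2 o) <= `|C3| + 2.
  pose T := Num.max t1 t2.
  have lt1 : t1 <= T by rewrite le_max lexx.
  have lt2 : t2 <= T by rewrite le_max lexx orbT.
  have a1 := le_trans gt1 (ray_to_gp_mono hproper hcat o (g1 o) z1 t10 lt1).
  have a2 := le_trans gt2 (ray_to_gp_mono hproper hcat o (g2 o) z2 t20 lt2).
  have a3 := hC3 T (le_trans t10 lt1).
  have f1 := four_point hcat o (ray_to o z1 T) (g1 o) (ray_to o z2 T).
  have f2 := four_point hcat o (g1 o) (g2 o) (ray_to o z2 T).
  rewrite [gp o _ (g1 o)]gpC in f1.
  have MC : `|C3| + 4 <= M by rewrite /M; lra.
  clear - f1 f2 a1 a2 a3 MC C3l.
  by move: f1 f2; rewrite !lerBlDr !ge_min => /orP[?|?] /orP[?|?]; lra.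
have lo1 : M - `|D| <= d o (p i1) by have := metric_triangle o (p i1) (g1 o);
  rewrite [d (p i1) _]metric_sym; lra.
have lo2 : M - `|D| <= d o (p i2) by have := metric_triangle o (p i2) (g2 o);
  rewrite [d (p i2) _]metric_sym; lra.
have close : M - `|D| - CA - 2 <= gp o (p i1) (p i2).
  have [le|/ltnW le] := leqP i1 i2.
    by have := local_quasigeodesic_fellow hcat (qg i2) CA0 CAL le (leqnn _); rewrite /p /=; lra.
  by have := local_quasigeodesic_fellow hcat (qg i1) CA0 CAL le (leqnn _);
    rewrite [gp _ (p i2) _]gpC /p /=; lra.
have := gp_lip_l o (p i1) (p i2) (g1 o); have := gp_lip_r o (g1 o) (p i2) (g2 o).
rewrite [d (p i1) _]metric_sym [d (p i2) _]metric_sym; rewrite /M in close; lra.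
Qed.

(** An unbounded product would mean that [k] maps [xi] to [eta]. *)
Lemma separating_element xi eta : exists2 k, G k & exists C, forall t, 0 <= t ->
  gp o (k (ray_to o xi t)) (ray_to o eta t) <= C.
Proof.
have [<-|ne] := pselect (xi = eta); last first.
  by exists id; [exact: (group_id hG)|exact: boundary_neq_gp_bounded].
have [k Gk nk] := no_fixed_end xi; exists k => //; apply: contrapT => unb; apply: nk.
pose c := ray_to o xi.
have rc : geodesic_ray c by exact: ray_to_ray.
have rk : geodesic_ray (k \o c).
  by move=> s t s0 t0 /=; rewrite (group_mdist hG _ _ Gk); exact: rc.
have [c' [rc' c'o [K hK]]] := asymptotic_ray_from hproper hcat o rk.
have cc' : c' 0 = c 0 by rewrite c'o /c ray_to0.
have e : forall s, 0 <= s -> c' s = c s.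
  apply: (rays_eq hcat) => // M; apply: contrapT => h; apply: unb; exists (M + K) => t t0.
  rewrite leNgt; apply/negP => ht; apply: h; exists t => //; rewrite c'o.
  have := gp_lip_l o (k (c t)) (c t) (c' t); have := hK t t0; rewrite /= -/c in ht *; lra.
by exists K => t t0; have := hK t t0; rewrite (e t t0).
Qed.

End NoFixedEnd.

(** * Greedy choice of a branch in a tree *)

Section GreedyBranch.
Context {R : realType}.
Variables (N : nat).
Hypothesis N0 : (0 < N)%N.
Variables (V : nat -> set (nat -> 'I_N)) (k : nat -> nat).
Hypothesis agree : forall j x y, V j x -> V j y -> forall i, (i < k j)%N -> x i = y i.
Let w j : R := (N%:R ^+ k j)^-1.
Hypothesis small : (\sum_(0 <= j <oo) (w j)%:E < 1%:E)%E.

Let Np : (0 < N%:R :> R). Proof. by rewrite ltr0n. Qed.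
Let w0 j : 0 <= w j. Proof. by rewrite invr_ge0 exprn_ge0. Qed.

(* the set [V j] is charged its weight if it meets the cylinder of level [n] around [x] *)
Let hits n (x : nat -> 'I_N) j : R :=
  if `[< exists2 y, V j y & forall i, (i < n)%N -> y i = x i >] then w j else 0.
Let mass n x := (\sum_(0 <= j <oo) (hits n x j)%:E)%E.
Let upd n a (x : nat -> 'I_N) : nat -> 'I_N := fun i => if i == n then a else x i.

Let hits_ge0 n x j : 0 <= hits n x j.
Proof. by rewrite /hits; case: ifP. Qed.

Let hits_le_mass n x j : ((hits n x j)%:E <= mass n x)%E.
Proof.
rewrite /mass (nneseries_split 0 j.+1); last by move=> *; rewrite lee_fin.
rewrite add0n big_nat_recr //= -[leLHS]adde0 leeD //; last first.
  by apply: nneseries_ge0 => *; rewrite lee_fin.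
by rewrite -[leLHS]add0e leeD // sume_ge0 // => *; rewrite lee_fin.
Qed.

Let hits_split n x j : (mass n x < ((N%:R ^+ n)^-1)%:E)%E ->
  \sum_(a < N) hits n.+1 (upd n a x) j <= hits n x j.
Proof.
move=> hm; rewrite {2}/hits; case: asboolP => [[y Vy yx]|nh]; last first.
  rewrite big1 // => a _; rewrite /hits; case: asboolP => // -[y Vy yx]; exfalso.
  apply: nh; exists y => // i ni; rewrite yx; last exact: ltnW.
  by rewrite /upd ltn_eqF.
have nk : (n < k j)%N.
  rewrite ltnNge; apply/negP => kn; move: hm; apply/negP; rewrite -leNgt.
  apply: le_trans (hits_le_mass n x j); rewrite lee_fin /hits.
  case: asboolP => [_|[]]; last by exists y.
  by rewrite /w lef_pV2 ?posrE ?exprn_gt0 // ler_weXn2l // ler1n.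
rewrite (bigD1 (y n)) //= big1 ?addr0.
  by rewrite /hits; case: ifP => _ //.
move=> a an; rewrite /hits; case: asboolP => // -[z Vz zx].
move: an; rewrite (agree Vy Vz nk) zx // /upd eqxx.
by rewrite eqxx.
Qed.

Let mass_step n x : (mass n x < ((N%:R ^+ n)^-1)%:E)%E ->
  exists a, (mass n.+1 (upd n a x) < ((N%:R ^+ n.+1)^-1)%:E)%E.
Proof.
move=> hm; apply: contrapT => h; have := hm; apply/negP; rewrite -leNgt.
apply: (@le_trans _ _ (\sum_(a < N) mass n.+1 (upd n a x))%E).
  apply: (@le_trans _ _ (\sum_(a < N) ((N%:R ^+ n.+1)^-1)%:E)%E); last first.
    apply: lee_sum => a _; rewrite leNgt; apply/negP => ha; apply: h.
    by exists a.
  rewrite sumEFin lee_fin sumr_const card_ord.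
  have -> : (N%:R ^+ n.+1)^-1 *+ N = N%:R * (N%:R ^+ n.+1)^-1 :> R.
    by rewrite mulr_natl.
  by rewrite exprS invfM mulrA divff ?mul1r // gt_eqF.
rewrite /mass -nneseries_sum; last by move=> *; rewrite lee_fin.
apply: lee_nneseries => j *; first by apply: sume_ge0 => *; rewrite lee_fin.
by rewrite sumEFin lee_fin hits_split.
Qed.

(** Among the [N] extensions of a word choose one into which at most the average
    weight falls. The weight in the cylinder of level [n] stays below [N ^ - n], while
    a set that contains the branch would contribute at least that much. *)
Lemma greedy_branch : exists x, forall j, ~ V j x.
Proof.
have [a0] : exists a : 'I_N, True by exists (Ordinal N0).
move=> _; pose st n x := (mass n x < ((N%:R ^+ n)^-1)%:E)%E.
have step n x : exists a, st n x -> st n.+1 (upd n a x).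
  have [h|h] := pselect (st n x); last by exists a0.
  by have [a ha] := mass_step h; exists a.
have [ch hch] := choice (fun p : nat * (nat -> 'I_N) => step p.1 p.2).
pose f := fix f n := if n is m.+1 then upd m (ch (m, f m)) (f m) else (fun=> a0).
have fst_ n : st n (f n).
  elim: n => [|n IH]; last exact: (hch (n, f n)).
  rewrite /st expr0 invr1; apply: le_lt_trans small.
  apply: lee_nneseries => j *; first by rewrite lee_fin.
  by rewrite lee_fin /hits; case: ifP.
pose x n := f n.+1 n.
have fx n i : (i < n)%N -> f n i = x i.
  elim: n => // n IH; rewrite ltnS leq_eqVlt => /orP[/eqP ->|im] //.
  by rewrite /= /upd ltn_eqF // IH.
exists x => j Vx; have := fst_ (k j); apply/negP; rewrite -leNgt.
apply: le_trans (hits_le_mass (k j) (f (k j)) j); rewrite lee_fin /hits.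
case: asboolP => // -[]; exists x => // i ij.
by rewrite fx.
Qed.

End GreedyBranch.

(** * Free semigroups and the lower bound for the dimension *)

Section CoverBound.
Context {R : realType}.

(** A set of diameter [del] is charged to the last level [k] at which the
    cylinders of the tree are farther apart than [del]; the summand [e] pays for
    sets of diameter 0, which have no last level. *)
Lemma charge_level (N : nat) (s m del e : R) : 0 < s -> 0 < m ->
  expR (s * m) <= N%:R -> 0 <= del -> del < expR (- 2) -> 0 < e ->
  exists k : nat, del < expR (- (k%:R * m) - 2) /\
    (N%:R ^+ k)^-1 <= expR (s * (m + 2)) * del `^ s + e.
Proof.
move=> s0 m0 hN del0 del2 e0.
have Np : 0 < N%:R :> R by apply: lt_le_trans hN; exact: expR_gt0.
have pow j : (N%:R ^+ j)^-1 <= expR (- (s * m) * j%:R).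
  rewrite mulNr expRN lef_pV2 ?posrE ?exprn_gt0 ?expR_gt0 // expRM_natr.
  by rewrite lerXn2r // ?nnegrE ?expR_ge0 // ltW.
have sm : 0 < s * m by exact: mulr_gt0.
have [de|dn] := eqVneq del 0.
  have [k hk] := nat_above (- ln e / (s * m)).
  exists k; rewrite de expR_gt0; split=> //.
  rewrite powR0 ?gt_eqF // mulr0 add0r; apply: le_trans (pow k) _.
  rewrite -[leRHS]lnK ?posrE // ler_expR mulNr.
  by move: hk; rewrite ler_pdivrMr //; lra.
have dp : 0 < del by rewrite lt_neqAle eq_sym dn.
have exk : exists k : nat, expR (- (k%:R * m) - 2) <= del.
  have [k hk] := nat_above (- ln del / m); exists k.
  rewrite -[leRHS]lnK ?posrE // ler_expR.
  by move: hk; rewrite ler_pdivrMr //; lra.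
case: (ex_minnP exk) => -[|k] hk hmin.
  by move: hk; rewrite mul0r oppr0 add0r leNgt del2.
exists k; split.
  by rewrite ltNge; apply/negP => /hmin; rewrite ltnn.
apply: le_trans (pow k) _; rewrite -[leLHS]addr0; apply: lerD; last exact: ltW.
have -> : expR (- (s * m) * k%:R) = expR (s * (m + 2)) * expR (- (k.+1%:R * m) - 2) `^ s.
  by rewrite -expRM -expRD -natr1; congr expR; ring.
rewrite ler_pM2l ?expR_gt0 //; apply: ge0_ler_powR => //.
- exact: ltW.
- by rewrite nnegrE expR_ge0.
Qed.

End CoverBound.

Section FreeSemigroup.
Context {R : realType} {X : metricType R}.
Hypotheses (hproper : proper_space X) (hcat : cat_minus_one X).
Variables (o : X) (G : set (X -> X)).
Hypothesis hG : isometry_group G.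
Implicit Types (xi eta zeta : boundary X).
Local Notation d := (@mdist R X).
Local Notation gp := (@gromov_product R X).

Lemma tends_boundary_le (I : Type) (U : set_system I) (x y : I -> X) xi eta C :
  ProperFilter U -> tends o U x xi -> tends o U y eta ->
  U [set i | gp o (x i) (y i) <= C] ->
  forall t, 0 <= t -> gp o (ray_to o xi t) (ray_to o eta t) <= C + 2.
Proof.
move=> PU hx hy hC t t0.
have [t1 t10 h1] := hx (C + 3); have [t2 t20 h2] := hy (C + 3).
pose T := Num.max t (Num.max t1 t2).
have l0 : t <= T by rewrite le_max lexx.
have l1 : t1 <= T by rewrite !le_max lexx orbT.
have l2 : t2 <= T by rewrite !le_max lexx !orbT.
have [i /= [[i1 i2] i3]] := filter_ex (filterI (filterI (h1 T l1) (h2 T l2)) hC).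
apply: le_trans (ray_to_gp_mono2 hproper hcat o xi eta t0 l0) _.
rewrite leNgt; apply/negP => h.
have := four_point hcat o (x i) (ray_to o xi T) (ray_to o eta T).
have := four_point hcat o (x i) (ray_to o eta T) (y i).
rewrite gpC in i2; clear - i1 i2 i3 h.
by rewrite !lerBlDr !ge_min => /orP[?|?] /orP[?|?]; lra.
Qed.

(* generators of nearly equal length, [n] to [m], without backtracking ([turn])
   and with well separated directions ([apart]) *)
Variables (N : nat) (bs : 'I_N -> X -> X) (n C m : R).
Hypotheses (Gb : forall a, G (bs a)) (C0 : 0 <= C) (Cn : 2 * C + 4 <= n).
Hypothesis lo : forall a, n <= d o (bs a o).
Hypothesis hi : forall a, d o (bs a o) <= m.
Hypothesis turn : forall a a' u, G u -> bs a \o u = id ->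
  gp o (u o) (bs a' o) <= C.
Hypothesis apart : forall a a', a != a' -> gp o (bs a o) (bs a' o) < n - C - 4.

Fixpoint branch (x : nat -> 'I_N) (k : nat) : X -> X :=
  if k is k'.+1 then branch x k' \o bs (x k') else id.

Lemma branch_group x k : G (branch x k).
Proof. by elim: k => [|k IH] /=; [exact: (group_id hG)|exact: (group_comp hG)]. Qed.

Lemma branch_shift x k i :
  branch x (k + i) = branch x k \o branch (fun j => x (k + j)%N) i.
Proof. by elim: i => [|i IH]; rewrite ?addn0 // addnS /= IH. Qed.

Lemma branch_eq x y k : (forall i, (i < k)%N -> x i = y i) -> branch x k = branch y k.
Proof.
elim: k => // k IH h /=; rewrite IH; first by rewrite h.
by move=> i ik; apply: h; exact: ltnW.
Qed.

Lemma branch_length x k : d o (branch x k o) <= k%:R * m.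
Proof.
elim: k => [|k IH] /=; first by rewrite mdistxx mul0r.
have := metric_triangle o (branch x k o) (branch x k (bs (x k) o)).
rewrite (group_mdist hG _ _ (branch_group x k)) -natr1; have := hi (x k).
by move: IH; lra.
Qed.

Lemma branch_quasigeodesic x k :
  local_quasigeodesic C n k (fun i => branch x i o).
Proof.
split=> i _ /=; first by rewrite (group_mdist hG _ _ (branch_group x i)).
have [u [Gu bu _]] := group_inv hG (Gb (x i)).
have := group_gp hG o (u o) (bs (x i.+1) o) (branch_group x i.+1) => /=.
rewrite -[bs (x i) (u o)]/((bs (x i) \o u) o) bu /= => ->.
exact: turn Gu bu.
Qed.

(** Each branch stays near its first point, as seen from [o]. *)
Lemma branch_first_letter x y i : x 0%N != y 0%N ->
  gp o (branch x i o) (branch y i o) <= m.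
Proof.
have nm : n <= m by exact: le_trans (lo (x 0%N)) (hi (x 0%N)).
have nC := Cn; have Cp := C0.
case: i => [_|i xy]; first by rewrite gpxx /= mdistxx; lra.
have fx : d o (bs (x 0%N) o) - (C + 2) <= gp o (bs (x 0%N) o) (branch x i.+1 o) :=
  local_quasigeodesic_fellow hcat (branch_quasigeodesic x i.+1) C0 Cn
  (isT : (1 <= i.+1)%N) (leqnn _).
have fy : d o (bs (y 0%N) o) - (C + 2) <= gp o (bs (y 0%N) o) (branch y i.+1 o) :=
  local_quasigeodesic_fellow hcat (branch_quasigeodesic y i.+1) C0 Cn
  (isT : (1 <= i.+1)%N) (leqnn _).
have ax := lo (x 0%N); have ay := lo (y 0%N); have ap := apart xy.
move: fx fy; move: (branch x i.+1 o) (branch y i.+1 o) => px py fx fy.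
rewrite leNgt; apply/negP => h.
have f1 := four_point hcat o (bs (x 0%N) o) px py.
have f2 := four_point hcat o (bs (x 0%N) o) py (bs (y 0%N) o).
rewrite gpC in fy; clear - ax ay ap nm nC Cp fx fy h f1 f2.
by move: f1 f2; rewrite !lerBlDr !ge_min => /orP[?|?] /orP[?|?]; lra.
Qed.

Lemma branch_separation x y k i : (forall j, (j < k)%N -> x j = y j) -> x k != y k ->
  (k <= i)%N -> gp o (branch x i o) (branch y i o) <= k.+1%:R * m.
Proof.
move=> xy xk ki; rewrite -(subnKC ki) !branch_shift -(branch_eq xy) /=.
have := group_gp_shift o hG (branch (fun j => x (k + j)%N) (i - k) o)
  (branch (fun j => y (k + j)%N) (i - k) o) (branch_group x k).
have := @branch_first_letter (fun j => x (k + j)%N) (fun j => y (k + j)%N) (i - k).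
rewrite !addn0 => /(_ xk); have := branch_length x k; rewrite -natr1; lra.
Qed.

(** End points of branches that part at level [k] are at distance at least
    [expR (- (k + 1) * m - 2)], so that each set of a cover only contains end points
    with a common prefix; if the cover is cheap, [greedy_branch] finds a branch
    whose end point it misses. *)
Lemma semigroup_premeasure s : 0 < s -> (0 < N)%N -> expR (s * m) <= N%:R ->
  hausdorff_premeasure (visual_dist o) s 1 (limit_set o G) <> 0%E.
Proof.
move=> s0 N0 hN hE.
have [U [UU sU]] := ultraFilterLemma (@eventually_filter).
have PU : ProperFilter U by exact: ultra_proper.
have FU : Filter U by exact: filter_filter.
have m0 : 0 < m.
  by have := le_trans (lo (Ordinal N0)) (hi (Ordinal N0)); have := C0; have := Cn; lra.
have lim x : exists xi, limit_set o G xi /\ tends o U (fun i => branch x i o) xi.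
  have [i|M|xi] := @orbit_ultralimit _ _ hproper hcat o G nat U (branch x) UU.
  - exact: branch_group.
  - have : U [set i | M <= i%:R] by apply: sU; exact: (nbhs_infty_ger M).
    apply: (@filterS _ U FU) => i /= Mi; apply: le_trans Mi _.
    exact: (local_quasigeodesic_far hcat (branch_quasigeodesic x i) C0 Cn (leqnn _)).
  - by exists xi.
have [pt hpt] := choice lim.
have sep x y k : (forall j, (j < k)%N -> x j = y j) -> x k != y k ->
    expR (- (k.+1%:R * m) - 2) <= visual_dist o (pt x) (pt y).
  move=> xy xk; rewrite -opprD; apply: (visual_dist_ge hproper hcat).
  apply: tends_boundary_le (hpt x).2 (hpt y).2 _.
  have : U [set i | (k <= i)%N] by apply: sU; exact: nbhs_infty_ge.
  by apply: (@filterS _ U FU) => i; exact: branch_separation.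
pose B := expR (s * (m + 2)).
have B0 : 0 < B by exact: expR_gt0.
have q0 : 0 < 1 / (4 * B) by rewrite divr_gt0 // mulr_gt0.
have [_ [W [EW dW] <-] hW] : exists2 y, [set (\sum_(0 <= j <oo)
    poweR (diameter (visual_dist o) (W j)) s)%E |
    W in [set W : nat -> set (boundary X) | limit_set o G `<=` \bigcup_j W j /\
      forall j, (diameter (visual_dist o) (W j) <= 1%:E)%E]] y &
    (y < (1 / (4 * B))%:E)%E.
  by apply: ereal_inf_lt; rewrite -/(hausdorff_premeasure _ _ _ _) hE lte_fin.
pose del j := fine (diameter (visual_dist o) (W j)).
have delE j : diameter (visual_dist o) (W j) = (del j)%:E.
  rewrite fineK // ge0_fin_numE; last exact: diameter_ge0.
  by apply: le_lt_trans (dW j) _; exact: ltry.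
have del0 j : 0 <= del j by rewrite -lee_fin -delE diameter_ge0.
have hW' : (\sum_(0 <= j <oo) (del j `^ s)%:E < (1 / (4 * B))%:E)%E.
  by apply: le_lt_trans hW; apply: lee_nneseries => j *;
    rewrite ?lee_fin ?powR_ge0 // delE.
have dels j : del j `^ s < 1 / (4 * B).
  rewrite -lte_fin; apply: le_lt_trans hW'.
  rewrite (nneseries_split 0 j.+1); last by move=> *; rewrite lee_fin powR_ge0.
  rewrite add0n big_nat_recr //= -[leLHS]adde0 leeD //; last first.
    by apply: nneseries_ge0 => *; rewrite lee_fin powR_ge0.
  by rewrite -[leLHS]add0e leeD // sume_ge0 // => *; rewrite lee_fin powR_ge0.
have del2 j : del j < expR (- 2).
  rewrite ltNge; apply/negP => h.
  have h1 : expR (- 2) `^ s <= del j `^ s.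
    by apply: ge0_ler_powR => //; [exact: ltW|rewrite nnegrE expR_ge0|rewrite nnegrE].
  have := dels j; apply/negP; rewrite -leNgt; apply: le_trans h1.
  rewrite -expRM ler_pdivrMr ?mulr_gt0 // mulrCA -expRD.
  have -> : -2 * s + s * (m + 2) = s * m by ring.
  by have := expR_ge1Dx (s * m); have := mulr_gt0 s0 m0; lra.
have ek j : exists k : nat, del j < expR (- (k%:R * m) - 2) /\
    (N%:R ^+ k)^-1 <= B * del j `^ s + (1 / 4) / (2 ^ j.+1)%:R.
  by apply: charge_level => //; rewrite divr_gt0 // ltr0n expn_gt0.
have [k hk] := choice ek.
pose V j := [set x | W j (pt x)].
have [||x hx] := @greedy_branch R N N0 V k.
- move=> j x y Vx Vy i ik; apply/eqP; apply: contrapT => /negP ne.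
  have exi : exists i, x i != y i by exists i.
  case: (ex_minnP exi) => l hl lmin.
  have li : (l < k j)%N by apply: leq_ltn_trans ik; exact: lmin.
  have xy l' : (l' < l)%N -> x l' = y l'.
    move=> ll; apply/eqP; rewrite -[_ == _]negbK; apply/negP => /lmin.
    by rewrite leqNgt ll.
  have := sep x y l xy hl; apply/negP; rewrite -ltNge.
  apply: (@le_lt_trans _ _ (del j)).
    by rewrite -lee_fin -delE; exact: le_diameter.
  apply: lt_le_trans (hk j).1 _; rewrite ler_expR lerB // lerN2 ler_pM2r //.
  by rewrite ler_nat.
- apply: (@le_lt_trans _ _ (\sum_(0 <= j <oo) ((B * del j `^ s)%:E +
    ((1 / 4) / (2 ^ j.+1)%:R)%:E))%E).
    apply: lee_nneseries => j *; first by rewrite lee_fin invr_ge0 exprn_ge0.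
    by rewrite -EFinD lee_fin; have [] := hk j.
  apply: le_lt_trans (epsilon_trick _ _ _) _ => //.
    by move=> j; rewrite lee_fin mulr_ge0 ?powR_ge0 // ltW.
  have -> : (\sum_(0 <= i <oo) (B * del i `^ s)%:E =
      B%:E * \sum_(0 <= i <oo) (del i `^ s)%:E)%E.
    by rewrite -nneseriesZl // => *; rewrite lee_fin powR_ge0.
  apply: (@le_lt_trans _ _ ((B * (1 / (4 * B)))%:E + (1 / 4)%:E)%E).
    by rewrite leeD2r // EFinM lee_pmul2l // ltW.
  rewrite -EFinD lte_fin (_ : B * (1 / (4 * B)) = 1 / 4); first lra.
  by field; rewrite gt_eqF.
- by have [j _ Wj] := EW (pt x) (hpt x).1; exact: (hx j).
Qed.

End FreeSemigroup.

(** * Semigroups in a group with divergent series *)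

Section SemigroupInGroup.
Context {R : realType} {X : metricType R}.
Hypotheses (hproper : proper_space X) (hcat : cat_minus_one X).
Variables (o : X) (G : set (X -> X)).
Hypothesis hG : isometry_group G.
Hypothesis finG : forall M, finite_set (G `&` [set g | mdist o (g o) <= M]).
Implicit Types (g h k : X -> X) (xi eta zeta : boundary X).
Local Notation d := (@mdist R X).
Local Notation gp := (@gromov_product R X).

Lemma group_gp_unshift k x y : G k -> gp o x y <= gp o (k x) (k y) + d o (k o).
Proof.
move=> Gk; rewrite -(group_gp hG o x y Gk) [d o (k o)]metric_sym.
exact: gp_lip_base.
Qed.

(** Greedy selection: an element excludes only the elements in a ball of
    radius [L] around it, which is a translate of a part of [q]. *)
Lemma separated_subset (L : R) (q : seq (X -> X)) : 0 <= L ->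
  (forall g, G g -> d o (g o) <= L -> g \in q) ->
  forall l : seq (X -> X), uniq l -> (forall g, g \in l -> G g) ->
  exists l', [/\ uniq l', {subset l' <= l}, (size l <= size q * size l')%N &
    forall g h, g \in l' -> h \in l' -> g <> h -> L < d (g o) (h o)].
Proof.
move=> L0 hq l; have [n] := ubnP (size l); elim: n l => // n IH [|g l] //=.
  by move=> _ _ _; exists [::]; split=> //; rewrite muln0.
rewrite ltnS => ln /andP[gl ul] hG'.
have Gg : G g by apply: hG'; exact: mem_head.
have [u [Gu gu ug]] := group_inv hG Gg.
pose near := [pred h : X -> X | d (g o) (h o) <= L].
have [|||l' [ul' sl' szl' sep']] := IH [seq h <- l | ~~ near h].
- by apply: leq_ltn_trans ln; rewrite size_filter count_size.
- exact: filter_uniq.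
- by move=> h; rewrite mem_filter => /andP[_ hl]; apply: hG'; rewrite inE hl orbT.
have far h : h \in l' -> L < d (g o) (h o).
  by move=> /sl'; rewrite mem_filter /= -ltNge => /andP[].
exists (g :: l'); split.
- rewrite /= ul' andbT; apply/negP => /far.
  by rewrite mdistxx ltNge L0.
- move=> h; rewrite !inE => /orP[->//|/sl'].
  by rewrite mem_filter => /andP[_ ->]; rewrite orbT.
- have -> : ((size l).+1 = (size [seq h <- l | near h]).+1 + size [seq h <- l | ~~ near h])%N.
    by rewrite !size_filter addSn count_predC.
  rewrite /= mulnS leq_add //.
  have sub : {subset [seq u \o h | h <- g :: [seq h <- l | near h]] <= q}.
    move=> _ /mapP [h hin ->].
    have [Gh dh] : G h /\ d (g o) (h o) <= L.
      move: hin; rewrite inE => /orP[/eqP ->|]; first by rewrite mdistxx.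
      by rewrite mem_filter /= => /andP[? hl]; split=> //; apply: hG'; rewrite inE hl orbT.
    apply: hq; first exact: (group_comp hG).
    have -> : d o ((u \o h) o) = d (u (g o)) (u (h o)).
      by rewrite -[u (g o)]/((u \o g) o) ug.
    by rewrite (group_mdist hG).
  have inj : injective (fun h : X -> X => u \o h).
    move=> h1 h2 /(congr1 (fun f => g \o f)) e.
    have {}e : (g \o u) \o h1 = (g \o u) \o h2 by exact: e.
    by rewrite gu in e.
  have := uniq_leq_size (_ : uniq [seq u \o h | h <- g :: [seq h <- l | near h]]) sub.
  rewrite size_map (map_inj_uniq inj) => -> //.
  by rewrite /= mem_filter negb_and gl orbT filter_uniq.
- move=> h1 h2; rewrite !inE => /orP[/eqP ->|i1] /orP[/eqP ->|i2] ne //.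
  + exact: far.
  + by rewrite metric_sym; exact: far.
  + exact: sep'.
Qed.

Lemma geometric_nneseries (a r : R) : 0 <= a -> 0 <= r -> r < 1 ->
  (\sum_(0 <= n <oo) (a * r ^+ n)%:E < +oo)%E.
Proof.
move=> a0 r0 r1; apply: (@le_lt_trans _ _ (a / (1 - r))%:E); last exact: ltry.
apply: lime_le.
  by apply: is_cvg_nneseries => n _ _; rewrite lee_fin mulr_ge0 // exprn_ge0.
apply: nearW => n; rewrite sumEFin lee_fin -mulr_sumr ler_wpM2l //.
rewrite -[leRHS]mul1r ler_pdivlMr ?subr_gt0 //.
have -> : (\sum_(0 <= i < n) r ^+ i) * (1 - r) = 1 - r ^+ n.
  by rewrite mulrC -[1 - r]opprB mulNr big_mkord -subrX1 opprB.
by rewrite gerBl exprn_ge0.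
Qed.

Hypothesis three : exists a b c, [/\ limit_set o G a, limit_set o G b,
  limit_set o G c & [/\ a <> b, b <> c & a <> c]].
Variables (s t : R).
Hypotheses (s0 : 0 < s) (st : s < t).
Hypothesis div : ~ (poincare_series o G t < +oo)%E.

Let wt g := expR (- t * d o (g o)).
Let wt0 g : 0 <= wt g. Proof. exact: expR_ge0. Qed.

(** Every member of a finer ultrafilter carries a divergent part of the series,
    which is a pigeonhole principle for all partitions of [G] at once. *)
Definition heavy : set_system (X -> X) :=
  [set A | (\esum_(g in G `\` A) (wt g)%:E < +oo)%E].

Lemma heavy_proper_filter : ProperFilter heavy.
Proof.
split; first by rewrite /heavy /= setD0.
split.
- by rewrite /heavy /= setDT esum_set0.
- move=> A B hA hB; rewrite /heavy /=.
  rewrite (esumID A); last by move=> *; rewrite lee_fin.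
  apply: lte_add_pinfty.
    apply: le_lt_trans hB; apply: esum_subset => // g [[Gg nAB] Ag]; split=> // Bg.
    exact: nAB.
  by apply: le_lt_trans hA; apply: esum_subset => // g [[Gg nAB] nAg]; split.
- move=> A B AB; apply: le_lt_trans; apply: esum_subset => // g [Gg nB].
  by split=> // /AB.
Qed.

Lemma heavy_finite (A : set (X -> X)) : finite_set (G `\` A) -> heavy A.
Proof.
move=> fin; rewrite /heavy /= esum_fset //; last by move=> *; rewrite lee_fin.
by rewrite fsbig_finite //= sumEFin ltry.
Qed.

(** Along an ultrafilter of heavy sets [g o] converges to some [xi] and the points
    of the inverses to some [eta]. On a member of the ultrafilter both are nearly
    reached, so composing with [k], which moves [xi] away from [eta], prevents
    backtracking. Since the series diverges there at [t > s], some annulus contains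
    enough elements, also after thinning out to a separated subset. *)
Lemma divergent_semigroup :
  hausdorff_premeasure (visual_dist o) s 1 (limit_set o G) <> 0%E.
Proof.
have PF := heavy_proper_filter.
have [U [UU sU]] := ultraFilterLemma PF.
have PU : ProperFilter U by exact: ultra_proper.
have FU : Filter U by exact: filter_filter.
have bigU A : U A -> ~ (\esum_(g in G `&` A) (wt g)%:E < +oo)%E.
  move=> UA fin; have : U (~` A) by apply: sU; rewrite /heavy /= setDE setCK.
  move=> UnA; have := filterI UA UnA; rewrite setICr => h0; by case: PU => + _; apply; exact: h0.
pose r g := if pselect (G g) then g else id.
have Gr g : G (r g).
  by rewrite /r; case: pselect => [|nGg] //; exact: (group_id hG).
have rE g : G g -> r g = g by rewrite /r; case: pselect.
have UG : U G by apply: sU; rewrite /heavy /= setDv esum_set0.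
have far M : U [set g | M <= d o (r g o)].
  apply: sU; apply: heavy_finite; apply: sub_finite_set (finG M) => g [Gg /= nM].
  by split=> //=; rewrite rE // in nM; rewrite leNgt; apply/negP => h; exact: nM (ltW h).
have [iv hiv] := choice (fun g => group_inv hG (Gr g)).
have [xi lxi txi] := @orbit_ultralimit _ _ hproper hcat o G _ U r UU Gr far.
have [g|M|eta leta teta] := @orbit_ultralimit _ _ hproper hcat o G _ U iv UU.
- by have [] := hiv g.
- apply: (@filterS _ U FU _ _ _ (far M)) => g /=.
  by have [Gi gi _] := hiv g; rewrite (mdist_inv o hG (Gr g) gi).
have [k Gk [C1 hC1]] := separating_element hproper hcat hG finG three xi eta.
pose ka := d o (k o); have ka0 : 0 <= ka := mdist_ge0 _ _.
pose C0 := `|C1|; have C00 : 0 <= C0 := normr_ge0 _; have C10 : C1 <= C0 := ler_norm _.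
pose C := C0 + 2 + ka; pose L := 2 * (6 + 2 * ka + C); pose m0 := 2 * C + 6 + ka.
pose M1 := C0 + ka + 5.
have [t1 t10 ht1] := txi M1; have [t2 t20 ht2] := teta M1.
pose T := Num.max t1 t2.
have T0 : 0 <= T by rewrite le_max t10.
have lt1 : t1 <= T by rewrite le_max lexx.
have lt2 : t2 <= T by rewrite le_max lexx orbT.
pose A := [set g | [/\ G g, M1 <= gp o (g o) (ray_to o xi T),
  M1 <= gp o (iv g o) (ray_to o eta T) & m0 <= d o (g o)]].
have UA : U A.
  apply: (@filterS _ U FU _ _ _
    (filterI (filterI UG (far m0)) (filterI (ht1 T lt1) (ht2 T lt2)))).
  by move=> g [[Gg /= h1] [/= h2 h3]]; rewrite (rE _ Gg) in h1 h2.
pose Am (m : nat) := A `&` [set g | m%:R <= d o (g o) /\ d o (g o) < m.+1%:R].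
have L0 : 0 <= L by rewrite /L /C; lra.
have /finite_seqP [q hq] := finG L.
have hq' g : G g -> d o (g o) <= L -> g \in q.
  by move=> Gg gL; have : (G `&` [set g | d o (g o) <= L]) g by []; rewrite hq.
pose K (m : nat) := expR (s * (m%:R + 1 + ka)).
(* if every annulus were thin then the series would converge *)
have [m [l [ul lA sep szl]]] : exists m l, [/\ uniq l, forall g, g \in l -> Am m g,
    forall g h, g \in l -> h \in l -> g <> h -> L < d (g o) (h o) &
    K m <= (size l)%:R].
  apply: contrapT => thin; apply: (bigU A UA).
  have -> : G `&` A = \bigcup_m Am m.
    apply/seteqP; split=> [g [Gg Ag]|g [m _ [Ag _]]]; last by split=> //; case: Ag.
    have ex : exists n : nat, d o (g o) < n.+1%:R.
      by have [n hn] := nat_above (d o (g o)); exists n; rewrite -natr1; lra.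
    case: (ex_minnP ex) => n hn hmin; exists n => //; split=> //; split=> //.
    case: n hn hmin => [|n] hn hmin; first exact: mdist_ge0.
    by rewrite leNgt; apply/negP => /hmin; rewrite ltnn.
  rewrite (nneseries_sum_bigcup _); last by move=> g; rewrite lee_fin.
    pose a := (size q)%:R * expR (s * (1 + ka)).
    apply: (@le_lt_trans _ _ (\sum_(0 <= m <oo) (a * expR (s - t) ^+ m)%:E)%E); last first.
      by apply: geometric_nneseries; rewrite ?mulr_ge0 ?expR_ge0 // expR_lt1 subr_lt0.
    apply: lee_nneseries => m *.
      by apply: esum_ge0 => g _; rewrite lee_fin.
    apply: esum_le_sum => l ul lA; rewrite lee_fin.
    have [g /lA [[]]//|l' [ul' sl' szl' sep']] := separated_subset L0 hq' ul.
    have {}thin : (size l')%:R < K m.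
      rewrite ltNge; apply/negP => big; apply: thin; exists m, l'; split=> //.
      by move=> g /sl'/lA.
    apply: (@le_trans _ _ (\sum_(g <- l) expR (- t * m%:R))).
      rewrite big_seq [leRHS]big_seq; apply: ler_sum => g /lA [_ [gm _]].
      by rewrite /wt ler_expR !mulNr lerN2 ler_pM2l // (lt_trans s0).
    rewrite big_const_seq count_predT iter_addr_0 -[_ *+ size l]mulr_natl.
    have : (size l)%:R <= (size q)%:R * K m.
      apply: (@le_trans _ _ ((size q * size l')%:R)); first by rewrite ler_nat.
      by rewrite natrM ler_wpM2l // ltW.
    move=> /(ler_wpM2r (expR_ge0 (- t * m%:R))) /le_trans; apply.
    rewrite /a /K -!mulrA ler_wpM2l // -expRM_natl -!expRD ler_expR.
    by rewrite le_eqVlt; apply/orP; left; apply/eqP; ring.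
  apply/trivIsetP => i j _ _ ij; apply/seteqP; split=> // g [[_ [i1 i2]] [_ [j1 j2]]].
  move: ij => /negP; apply.
  have h1 : (i < j.+1)%N by rewrite -(ltr_nat R); exact: le_lt_trans i1 j2.
  have h2 : (j < i.+1)%N by rewrite -(ltr_nat R); exact: le_lt_trans j1 i2.
  by rewrite eqn_leq -ltnS h1 -ltnS h2.
pose bs (a : 'I_(size l)) := k \o nth id l a.
have lin (a : 'I_(size l)) : nth id l a \in l by rewrite mem_nth.
have m0m : m0 < m%:R + 1.
  have : (0 < size l)%N.
    by rewrite -(ltr_nat R); apply: lt_le_trans szl; exact: expR_gt0.
  move=> l0; have [[_ _ _ h1] [_ h2]] := lA _ (lin (Ordinal l0)).
  by rewrite natr1; exact: le_lt_trans h1 h2.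
have lN : (0 < size l)%N.
  by rewrite -(ltr_nat R); apply: lt_le_trans szl; exact: expR_gt0.
pose n := m%:R - ka - 1.
have kd g : d o (g o) - ka <= d o (k (g o)) <= d o (g o) + ka.
  have e := group_mdist hG o (g o) Gk; rewrite -e /ka.
  have := metric_triangle (k o) o (k (g o)); have := metric_triangle o (k o) (k (g o)).
  by rewrite [d (k o) o]metric_sym => *; apply/andP; split; lra.
apply: (@semigroup_premeasure _ _ hproper hcat o G hG (size l) bs n C (m%:R + 1 + ka)) => //.
- by move=> a; apply: (group_comp hG) => //; have [[]] := lA _ (lin a).
- by rewrite /C; lra.
- by rewrite /n; move: m0m; rewrite /m0; lra.
- move=> a; have [_ [h1 _]] := lA _ (lin a).
  by have /andP[] := kd (nth id l a); rewrite /n /bs /=; lra.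
- move=> a; have [_ [_ h1]] := lA _ (lin a).
  by have /andP[_] := kd (nth id l a); rewrite -natr1 in h1; rewrite /bs /=; lra.
- move=> a a' u Gu bu.
  have [[Gg _ i1 _] _] := lA _ (lin a); have [[Gg' i2 _ _] _] := lA _ (lin a').
  have [Gi gi _] := hiv (nth id l a); rewrite (rE _ Gg) in gi.
  have du : d (u o) (iv (nth id l a) o) = ka.
    rewrite -(group_mdist hG _ _ Gg) -(group_mdist hG _ _ Gk).
    rewrite -[k (_ (u o))]/((bs a \o u) o) bu.
    by rewrite -[nth id l a (iv _ o)]/((nth id l a \o iv (nth id l a)) o) gi.
  have h1 := gp_lip_l o (u o) (bs a' o) (iv (nth id l a) o); rewrite du in h1.
  suff : gp o (iv (nth id l a) o) (bs a' o) <= C0 + 2 by rewrite /C; lra.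
  have h2 := group_gp_unshift (nth id l a' o) (ray_to o xi T) Gk; rewrite -/ka in h2.
  have h3 := hC1 T T0.
  have f1 := four_point hcat o (k (ray_to o xi T)) (bs a' o) (ray_to o eta T).
  have f2 := four_point hcat o (bs a' o) (iv (nth id l a) o) (ray_to o eta T).
  rewrite leNgt; apply/negP => h4.
  rewrite [gp o (iv _ _) (bs a' o)]gpC in h4.
  rewrite [gp o (k (ray_to o xi T)) (bs a' o)]gpC in f1.
  have h5 : C0 + 5 <= gp o (bs a' o) (k (ray_to o xi T)).
    by rewrite /bs /=; move: i2 h2; rewrite /M1; lra.
  rewrite /M1 in i1; clear - f1 f2 h3 h4 h5 i1 C10 C00 ka0.
  by move: f1 f2; rewrite !lerBlDr !ge_min => /orP[?|?] /orP[?|?]; lra.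
- move=> a a' aa'.
  have [[Gg _ _ _] [_ i1]] := lA _ (lin a); have [[Gg' _ _ _] [_ i2]] := lA _ (lin a').
  have ne : nth id l a <> nth id l a'.
    by move=> /eqP; rewrite nth_uniq // => /eqP/val_inj/eqP; exact/negP.
  have h1 := sep _ _ (lin a) (lin a') ne.
  have h2 := group_gp_shift o hG (nth id l a o) (nth id l a' o) Gk.
  have h3 : gp o (nth id l a o) (nth id l a' o) < (2 * (m%:R + 1) - L) / 2.
    rewrite /gromov_product ltr_pM2r // -natr1 in i1 i2 *; lra.
  by rewrite /bs /n /=; move: h2 h3; rewrite -/ka /L; lra.
Qed.

End SemigroupInGroup.

(** * The theorem *)

Section HausdorffMeasure.
Context {R : realType} {T : Type}.
Variable (D : T -> T -> R).

Lemma hausdorff_premeasure_mono (a eps eps' : R) (E : set T) : eps <= eps' ->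
  (hausdorff_premeasure D a eps' E <= hausdorff_premeasure D a eps E)%E.
Proof.
move=> ee; apply: ereal_inf_le_tmp => _ [U [EU dU] <-]; exists U => //; split=> // j.
by apply: le_trans (dU j) _; rewrite lee_fin.
Qed.

(** The premeasures increase as [eps] decreases, so the limit is their supremum. *)
Lemma hausdorff_premeasure_le (a eps : R) (E : set T) : 0 < eps ->
  (hausdorff_premeasure D a eps E <= hausdorff_measure D a E)%E.
Proof.
move=> eps0; apply: lime_ge.
  apply: nonincreasing_at_right_is_cvge.
  near=> x => y z _ _ yz; exact: hausdorff_premeasure_mono.
near=> x; apply: hausdorff_premeasure_mono; apply: ltW; near: x.
exact: nbhs_right_lt.
Unshelve. all: by end_near. Qed.

End HausdorffMeasure.

Lemma non_elementary_three (R : realType) (X : metricType R) (o : X)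
    (G : set (X -> X)) : non_elementary o G ->
  exists a b c, [/\ limit_set o G a, limit_set o G b,
    limit_set o G c & [/\ a <> b, b <> c & a <> c]].
Proof.
move=> /card_leP [f].
pose e (i : 'I_3) : [set: 'I_3] := exist _ i (mem_setT i).
pose z i : boundary X := val (f (e i)).
have lz i : limit_set o G (z i) by apply: set_mem; exact: valP.
have inj i j : i != j -> z i <> z j.
  move=> /eqP ij /val_inj /(inj (f := f)) h; apply: ij.
  by have := h (in_setT _) (in_setT _) => /(congr1 val).
exists (z (@Ordinal 3 0 isT)), (z (@Ordinal 3 1 isT)), (z (@Ordinal 3 2 isT)).
by split=> //; split; exact: inj.
Qed.

Theorem theorem1p1 (R : realType) (X : metricType R) (o : X)
    (Gamma : set (X -> X)) (alpha : R) :
  proper_space X -> cat_minus_one X ->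
  isometry_group Gamma -> finitely_generated Gamma ->
  discrete_group Gamma -> non_elementary o Gamma ->
  0 < alpha -> alpha <= 1 ->
  (poincare_series o Gamma alpha < +oo)%E ->
  [/\ hausdorff_measure (visual_dist o) alpha (limit_set o Gamma) = 0%E,
      homeomorphic (limit_space o Gamma) cantor_space &
      hausdorff_dim (visual_dist o) (limit_set o Gamma) =
        critical_exponent o Gamma].
Proof.
move=> hproper hcat hG fgG _ /non_elementary_three three al0 al1 hP.
have zero s : 0 < s -> s <= 1 -> (poincare_series o Gamma s < +oo)%E ->
    hausdorff_measure (visual_dist o) s (limit_set o Gamma) = 0%E.
  exact: limit_set_hausdorff_measure.
have finG M : finite_set (Gamma `&` [set g | mdist o (g o) <= M]).
  exact: poincare_finite_ball al0 hP.
split; first exact: zero.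
- have [xi [_ [_ [lxi _ _ _]]]] := three.
  apply: limit_space_cantor => //; first by exists xi.
    by move=> eta leta n; exact: limit_set_perfect.
  move=> eta zeta leta lzeta ne.
  have [s s0 ds] := boundary_neq_ray hproper hcat o ne.
  have P1 : (poincare_series o Gamma 1 < +oo)%E.
    apply: le_lt_trans hP; apply: le_esum => g _.
    by rewrite lee_fin ler_expR !mulNr lerN2 ler_wpM2r ?mdist_ge0.
  have [r [r0 rd hr]] := avoided_distance hproper hcat eta s0 ds
    (limit_set_premeasure hproper hcat hG fgG ltr01 (lexx _) P1 ltr01).
  by exists s, r.
- apply/eqP; rewrite eq_le; apply/andP; split.
    apply/ereal_infP => _ [s [s0 Ps] <-].
    have [s1|s1] := leP s 1; first by apply: ereal_inf_lbound; exists s => //; split=> //; exact: zero.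
    apply: (@le_trans _ _ alpha%:E); last by rewrite lee_fin (le_trans al1) // ltW.
    by apply: ereal_inf_lbound; exists alpha => //; split=> //; exact: zero.
  apply/ereal_infP => _ [s [s0 Hs] <-]; apply/lee_addgt0Pr => e e0.
  rewrite -EFinD; apply: ereal_inf_lbound; exists (s + e) => //; split; first exact: addr_gt0.
  apply: contrapT => div.
  have := divergent_semigroup hproper hcat hG finG three s0 (_ : s < s + e) div.
  rewrite ltrDl => /(_ e0); apply; apply/eqP.
  by rewrite eq_le hausdorff_premeasure_ge0 andbT -Hs hausdorff_premeasure_le.
Qed.
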